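(* Let $\alpha,\beta\in(0,1)$ and let $f\in L^p(G_{\mathbf m}^2)$ for some $p\in[1,\infty]$. If $$M_k^{\alpha}\,\omega_1\Big(f,\frac1{M_k}\Big)_p\to0\quad\text{as }k\to\infty,$$ $$M_l^{\beta}\,\omega_2\Big(f,\frac1{M_l}\Big)_p\to0\quad\text{as }l\to\infty,$$ $$M_k^{\alpha}M_l^{\beta}\,\omega_{1,2}\Big(f,\frac1{M_k},\frac1{M_l}\Big)_p\to0\quad\text{as }k,l\to\infty,$$ then $$\left\Vert\sigma_{n,m}^{-\alpha,-\beta}(f)-f\right\Vert_p\to0\quad\text{as }n,m\to\infty.$$
   Context: Vilenkin group: $\mathbf m=(m_0,m_1,\dots)$ is a fixed bounded sequence of integers $m_k\ge 2$. $G_{\mathbf m}=\prod_{k\ge0}\mathbb Z/m_k\mathbb Z$ is the compact product group (discrete topology on each factor, coordinatewise addition modulo $m_k$), with elements $x=(x_0,x_1,\dots)$, $x_k\in\{0,\dots,m_k-1\}$, and $\mu$ is its normalized Haar measure; the normalized Haar measure on $G_{\mathbf m}^2=G_{\mathbf m}\times G_{\mathbf m}$ is also denoted $\mu$. Put $I_0=G_{\mathbf m}$ and $I_n=\{x\in G_{\mathbf m}:x_0=\dots=x_{n-1}=0\}$ for $n\ge1$. Put $M_0=1$, $M_{k+1}=m_kM_k$. Each integer $n\ge 0$ is uniquely $n=\sum_{j\ge0}n_jM_j$ with $n_j\in\{0,\dots,m_j-1\}$, finitely many nonzero. Vilenkin system: $r_k(x)=\exp(2\pi i x_k/m_k)$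 and $\psi_n(x)=\prod_{k\ge0}r_k(x)^{n_k}$. Spaces: functions are complex valued. For $1\le p<\infty$, $L^p(G_{\mathbf m}^2)$ has norm $\|f\|_p=(\int_{G_{\mathbf m}^2}|f|^p\,d\mu)^{1/p}$; by convention $L^\infty(G_{\mathbf m}^2)$ means $C(G_{\mathbf m}^2)$, the continuous functions with the supremum norm. Fourier coefficients: $\widehat f(i,j)=\int_{G_{\mathbf m}^2}f(x,y)\overline{\psi_i(x)}\,\overline{\psi_j(y)}\,d\mu(x,y)$. Cesàro numbers: $A_0^{\gamma}=1$, $A_n^{\gamma}=\frac{(\gamma+1)\cdots(\gamma+n)}{n!}$. Cesàro means: $$\sigma_{n,m}^{-\alpha,-\beta}(x,y,f)=\frac1{A_n^{-\alpha}A_m^{-\beta}}\sum_{i=0}^n\sum_{j=0}^mA_{n-i}^{-\alpha}A_{m-j}^{-\beta}\widehat f(i,j)\psi_i(x)\psi_j(y),$$ and $\sigma_{n,m}^{-\alpha,-\beta}(f)$ is this function of $(x,y)$. Moduli of continuity: $\omega_1(f,1/M_n)_p=\sup_{u\in I_n}\|f(\cdot-u,\cdot)-f(\cdot,\cdot)\|_p$, $\omega_2(f,1/M_n)_p=\sup_{v\in I_n}\|f(\cdot,\cdot-v)-f(\cdot,\cdot)\|_p$, $\omega_{1,2}(f,1/M_n,1/M_m)_p=\sup_{(u,v)\in I_n\times I_m}\|f(\cdot-u,\cdot-v)-f(\cdot-u,\cdot)-f(\cdot,\cdot-v)+f(\cdot,\cdot)\|_p$. Double limits ''as $k,l\to\infty$''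 and ''as $n,m\to\infty$'' mean that both indices tend to infinity independently. *)

(* Defs.v *)
From HB Require Import structures.
From mathcomp Require Import all_boot all_order all_algebra complex.
From mathcomp Require Import all_classical all_reals all_analysis.

Set Implicit Arguments.
Unset Strict Implicit.
Unset Printing Implicit Defensive.

Import Order.TTheory GRing.Theory Num.Theory.
Import numFieldNormedType.Exports.

Local Open Scope classical_set_scope.
Local Open Scope ring_scope.

(* ['Z_n] is the ring of integers modulo [n] only when [2 <= n], so [vilenkin m]
   is the intended group under the hypothesis [forall k, (2 <= m k)%N]. *)
Definition vilenkin (m : nat -> nat) : Type :=
  prod_topology (fun k => discrete_topology 'Z_(m k)).

HB.instance Definition _ m := Topological.on (vilenkin m).

Section vilenkin_group.
Variable m : nat -> nat.
Implicit Types x y : vilenkin m.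

Let add x y : vilenkin m := fun k => (x k : 'Z_(m k)) + (y k : 'Z_(m k)).
Let opp x : vilenkin m := fun k => - (x k : 'Z_(m k)).
Let zero : vilenkin m := fun k => 0 : 'Z_(m k).

Let addA : associative add.
Proof. by move=> x y z; apply: functional_extensionality_dep => k; exact: addrA. Qed.
Let addC : commutative add.
Proof. by move=> x y; apply: functional_extensionality_dep => k; exact: addrC. Qed.
Let add0 : left_id zero add.
Proof. by move=> x; apply: functional_extensionality_dep => k; exact: add0r. Qed.
Let addN : left_inverse zero opp add.
Proof. by move=> x; apply: functional_extensionality_dep => k; exact: addNr. Qed.

HB.instance Definition _ :=
  GRing.isZmodule.Build (vilenkin m) addA addC add0 addN.
HB.instance Definition _ := isPointed.Build (vilenkin m) 0.

Let sub_continuous :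
  continuous (fun z : vilenkin m * vilenkin m => z.1 - z.2).
Proof.
pose K k : topologicalType := discrete_topology 'Z_(m k).
move=> [x y]; apply/cvg_sup.
move=> k U [V] [[W] oW <-] /= Wxy WU.
have coordN (u : vilenkin m) : nbhs u [set v : vilenkin m | v k = u k].
  have := @proj_continuous nat K k u _ (discrete_set1 (u k : K k)).
  by [].
exists ([set v : vilenkin m | v k = x k], [set v : vilenkin m | v k = y k]).
  by split; exact: coordN.
move=> [a b] [/= ax bx]; apply: WU => /=.
suff -> : (a - b) k = (x - y) k by [].
exact: (congr2 (fun s t : 'Z_(m k) => s - t) ax bx).
Qed.

HB.instance Definition _ :=
  PreTopologicalNmodule_isTopologicalZmodule.Build (vilenkin m) sub_continuous.

(* Borel sets.  The library's product sigma-algebra on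
   [vilenkin m * vilenkin m] is again the Borel one, because [vilenkin m] has a
   countable base. *)
HB.instance Definition _ := @isMeasurable.Build
  (sigma_display (@open (vilenkin m))) (vilenkin m) <<s @open (vilenkin m) >>
  (@sigma_algebra0 _ setT _) (@sigma_algebraC _ _)
  (@sigma_algebra_bigcup _ setT _).

Definition vilenkin_I (n : nat) : set (vilenkin m) :=
  [set x | forall k, (k < n)%N -> x k = (0 : 'Z_(m k))].

End vilenkin_group.

Section mixed_radix.
Variable m : nat -> nat.

Fixpoint vilenkin_M (k : nat) : nat :=
  if k is k'.+1 then (m k' * vilenkin_M k')%N else 1%N.

Definition digit (n j : nat) : nat := ((n %/ vilenkin_M j) %% m j)%N.

Hypothesis m_ge2 : forall k, (2 <= m k)%N.

Lemma ltn_vilenkin_M k : (k < vilenkin_M k)%N.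
Proof.
elim: k => // k IH; rewrite /= (leq_trans (n := 2 * k.+1)) //.
  by rewrite mul2n -addnn addnS ltnS leq_addr.
exact: leq_mul (m_ge2 k) IH.
Qed.

Lemma digit_lt n j : (digit n j < m j)%N.
Proof. by rewrite ltn_mod (leq_trans _ (m_ge2 j)). Qed.

Lemma digit_eq0 n j : (n <= j)%N -> digit n j = 0%N.
Proof.
move=> nj; rewrite /digit divn_small ?mod0n //.
exact: leq_ltn_trans nj (ltn_vilenkin_M j).
Qed.

Lemma digit_sum n : n = (\sum_(j < n) digit n j * vilenkin_M j)%N.
Proof.
suff H k : (n = n %/ vilenkin_M k * vilenkin_M k
                + \sum_(j < k) digit n j * vilenkin_M j)%N.
  by rewrite [LHS](H n) divn_small ?ltn_vilenkin_M.
elim: k => [|k IH]; first by rewrite big_ord0 divn1 muln1 addn0.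
rewrite big_ord_recr /= [LHS]IH [X in (_ = _ + X)%N]addnC addnA; congr addn.
rewrite /digit mulnA -mulnDl mulnC [(m k * _)%N]mulnC divnMA.
by rewrite -divn_eq mulnC.
Qed.

End mixed_radix.

Section vilenkin_fourier.
Variables (R : realType) (m : nat -> nat).
Local Notation G := (vilenkin m).
Local Notation C := R[i].
Implicit Types (x y : G) (f : G * G -> C) (p : \bar R).

(* exp(i t) *)
Definition expi (t : R) : C := (cos t +i* sin t)%C.

Definition rademacher (k : nat) x : C :=
  expi (2 * pi * (val (x k : 'Z_(m k)))%:R / (m k)%:R).

(* The infinite product is cut at [n]: the digits [n_k] with [n <= k] vanish
   ([digit_eq0]). *)
Definition psi (n : nat) x : C :=
  \prod_(k < n) rademacher k x ^+ digit m n k.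

(* Normalization is part of [probability]; translation invariance then
   determines [mu] among the Borel measures on the compact group [G * G]. *)
Definition haar (mu : probability (G * G)%type R) : Prop :=
  forall (a : G * G) (A : set (G * G)), measurable A ->
    mu [set a + z | z in A] = mu A.

Variable mu : probability (G * G)%type R.

Definition cintegral f : C :=
  ((\int[mu]_z complex.Re (f z)) +i* (\int[mu]_z complex.Im (f z)))%C.

(* For [p = +oo] this is the supremum, not the essential supremum of the
   library's [Lnorm]. *)
Definition Lp_norm p f : \bar R :=
  if p == +oo%E then ereal_sup [set (Normc.normc (f z))%:E | z in setT]
  else Lnorm mu p (fun z => (Normc.normc (f z))%:E).

Definition in_Lp p f : Prop :=
  if p == +oo%E then continuous (f : G * G -> (C : numFieldType))
  else [/\ measurable_fun setT (fun z => complex.Re (f z)),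
           measurable_fun setT (fun z => complex.Im (f z))
         & (Lp_norm p f < +oo)%E].

Definition fourier_coef f (i j : nat) : C :=
  cintegral (fun z => f z * (psi i z.1)^*%C * (psi j z.2)^*%C).

Definition cesaro_number (gamma : R) (n : nat) : R :=
  (\prod_(1 <= i < n.+1) (gamma + i%:R)) / n`!%:R.

(* [cesaro_mean a b] is sigma^{a,b}; negative orders are passed as such. *)
Definition cesaro_mean (a b : R) (n l : nat) f (z : G * G) : C :=
  ((cesaro_number a n * cesaro_number b l)^-1)%:C%C *
  \sum_(0 <= i < n.+1) \sum_(0 <= j < l.+1)
    (cesaro_number a (n - i) * cesaro_number b (l - j))%:C%C *
    fourier_coef f i j * psi i z.1 * psi j z.2.

(* The moduli of continuity at 1/M_n (and 1/M_l), as functions of [n], [l]. *)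
Definition omega1 p f (n : nat) : \bar R :=
  ereal_sup [set Lp_norm p (fun z => f (z.1 - u, z.2) - f z)
            | u in @vilenkin_I m n].

Definition omega2 p f (n : nat) : \bar R :=
  ereal_sup [set Lp_norm p (fun z => f (z.1, z.2 - v) - f z)
            | v in @vilenkin_I m n].

Definition omega12 p f (n l : nat) : \bar R :=
  ereal_sup [set Lp_norm p (fun z => f (z.1 - w.1, z.2 - w.2)
                                     - f (z.1 - w.1, z.2)
                                     - f (z.1, z.2 - w.2) + f z)
            | w in @vilenkin_I m n `*` @vilenkin_I m l].

End vilenkin_fourier.

(* Main.v *)
(* On the finite subgroup of the [x] with [x_k = 0] for [k >= K], the Fourier
   projections [P_i], [i < M_K], are averages of translations, [P_i P_j] is [P_i] or
   [0], and the sum of [P_i] over an aligned block [cM_s <= i < (c+1)M_s] is a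
   contraction for every translation-invariant seminorm [N].  Cutting [0, n] at the
   multiples [cut n s] of [M_s], which get closer to [n] as [s] decreases, and summing
   by parts against the monotone weights [A_(n-i)] on each piece bounds the Cesaro
   means of order [-a] by [C n^a], without a logarithm.  With
   [E_j v = \sum_(i < M_j) P_i v], a second summation by parts applied to [v - E_j v]
   on the shell [M_j <= i < M_(j+1)] gives, for [M_(k+1) <= n < M_(k+2)],
     [N (sigma_n v - v) <= C \sum_(j <= k) 2^(j-k) M_j^a N (v - E_j v)],
   and [N (v - E_j v)] is at most the modulus of continuity at level [j].

   In two variables, [sigma' sigma'' - 1] is [Q' Q'' + Q' + Q''] with [Q = sigma - 1]
   in each variable; the three hypotheses control the three terms by a Toeplitz
   argument.

   The Fourier coefficients of [f] are integrals rather than finite averages, but up to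
   order [M_K] they are the discrete coefficients of the average of [f] over the cosets
   of [I_K x I_K].  By Jensen's inequality this average tends to [f] in L^p as [K]
   grows, so for fixed [n] and [l] it can replace [f]. *)

(* The logarithm is avoided as follows. An initial piece of an aligned block of length [M s] costs a
   factor of order s, at most [B] per digit. In the kernel estimate each cut stays a full block away
   from [n.+1], so the weights there are at most M_s^(-a), and the sum of s M_s^(-a) converges. In
   the error estimate the factor j is absorbed into M_j^a. The ratio 2^(j-k) comes from A_(n-i) /
   A_n - 1 = O(i/n) for i <= n/2; the levels satisfy M_(k+1) <= n so that all shells below M_k lie
   in the first half of [0, n].

   The one-variable bounds hold for every vector of a module with a seminorm, so they apply to S2 v
   - v as well as to v; commutation of the two actions turns the iterated errors into mixed
   differences.

   The third hypothesis is silent when one index stays bounded, whereas the Toeplitz sums contain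
   all pairs of levels. There the mixed modulus is at most twice either simple modulus, and the
   first two hypotheses keep the weighted values bounded.

   The level [K] is chosen after n and l, so the cost of discretizing may be estimated by operator
   norms that depend on n and l. *)
Require Import Defs.
From HB Require Import structures.
From mathcomp Require Import all_boot all_order all_algebra complex.
From mathcomp Require Import all_classical all_reals all_analysis.
From mathcomp Require Import measurable_realfun ring lra zify.

Import Order.TTheory GRing.Theory Num.Theory.
Import numFieldNormedType.Exports.

Set Implicit Arguments.
Unset Strict Implicit.

Local Open Scope classical_set_scope.
Local Open Scope ring_scope.

(** * Monotonicity and size of the Cesaro numbers of order -a *)

Section cesaro_numbers.
Variables (R : realType) (a : R).
Hypothesis a01 : 0 < a < 1.
Local Notation A := (cesaro_number (- a)).

Lemma cesaro_number0 : A 0 = 1.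
Proof. by rewrite /cesaro_number big_geq // divr1. Qed.

Lemma cesaro_numberS n : A n.+1 = A n * (1 - a / n.+1%:R).
Proof.
rewrite /cesaro_number big_nat_recr //= factS natrM invfM [_^-1 * _^-1]mulrC.
rewrite mulrACA; congr (_ * _).
by rewrite mulrDl mulfV ?pnatr_eq0 // mulNr addrC.
Qed.

Lemma cesaro_ratio_gt0 n : 0 < 1 - a / n.+1%:R.
Proof.
case/andP: a01 => a0 a1; rewrite subr_gt0 ltr_pdivrMr // mul1r.
by rewrite (lt_le_trans a1) // ler1n.
Qed.

Lemma cesaro_number_gt0 n : 0 < A n.
Proof.
elim: n => [|n IH]; first by rewrite cesaro_number0.
by rewrite cesaro_numberS mulr_gt0 // cesaro_ratio_gt0.
Qed.

Lemma cesaro_numberB n : A n - A n.+1 = A n * (a / n.+1%:R).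
Proof. by rewrite cesaro_numberS mulrBr mulr1 opprB addrC subrK. Qed.

Lemma cesaro_number_nincr n k : (n <= k)%N -> A k <= A n.
Proof.
move=> /subnK <-; elim: (k - n)%N => // d IH; apply: le_trans IH.
rewrite addSn -subr_ge0 cesaro_numberB mulr_ge0 ?ltW ?cesaro_number_gt0 //.
by case/andP: a01 => ? ?; rewrite divr_gt0.
Qed.

(** The left side does not increase with n: with x = 1/(n+1) its successive ratio is (1 - a x)(1 +
    x)^a <= exp(-a x) exp(a x) = 1. *)
Lemma cesaro_number_le n : A n * n.+1%:R `^ a <= 1.
Proof.
case/andP: a01 => a0 a1.
elim: n => [|n IH]; first by rewrite cesaro_number0 mul1r powR1.
apply: le_trans IH; rewrite cesaro_numberS -mulrA ler_pM2l ?cesaro_number_gt0 //.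
set x := n.+1%:R^-1 : R.
have x0 : 0 < x by rewrite invr_gt0.
have -> : n.+2%:R = n.+1%:R * (1 + x) :> R.
  by rewrite mulrDr mulr1 mulfV ?pnatr_eq0 // [in LHS]mulrS addrC.
rewrite powRM ?addr_ge0 ?(ltW x0) // mulrCA ger_pMr ?powR_gt0 //.
have h : (1 + x) `^ a <= expR (a * x).
  rewrite /powR gt_eqF ?addr_gt0 // ler_expR ler_pM2l //.
  by rewrite -[leRHS]expRK ler_ln ?posrE ?expR_gt0 ?addr_gt0 // expR_ge1Dx.
have h' : 1 - a / n.+1%:R <= expR (- (a * x)) by apply: expR_ge1Dx.
apply: le_trans (ler_pM _ _ h' h) _.
- exact/ltW/cesaro_ratio_gt0.
- exact: powR_ge0.
by rewrite -expRD addNr expR0.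
Qed.

(** Young's inequality with exponents 1/a and 1/(1-a), applied to (1-x)^a times 1, gives a (1-x) +
    (1-a) = 1 - a x. *)
Lemma bernoulli_powR (x : R) : 0 <= x -> (1 - x) `^ a <= 1 - a * x \/ 1 < x.
Proof.
case/andP: a01 => a0 a1 x0; have [x1|] := leP x 1; last by right.
left; have x1' : 0 <= 1 - x by rewrite subr_ge0.
have := @conjugate_powR R ((1 - x) `^ a) 1 a^-1 (1 - a)^-1 (powR_ge0 _ _) ler01.
rewrite !invr_gt0 !invrK a0 subr_gt0 a1 subrKC => /(_ isT isT erefl).
rewrite mulr1 powR1 -powRrM mulfV ?gt_eqF // powRr1 //; lra.
Qed.

(** The product does not decrease with n: with x = 1/(n+2) its successive ratio is (1 - a x) /
    (1-x)^a >= 1 by Bernoulli. The first value is A_1 = 1 - a. *)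
Lemma cesaro_number_ge n : 1 - a <= A n.+1 * n.+1%:R `^ a.
Proof.
case/andP: a01 => a0 a1.
elim: n => [|n IH].
  by rewrite cesaro_numberS cesaro_number0 powR1 divr1 mul1r mulr1.
apply: (le_trans IH); rewrite [A n.+2]cesaro_numberS.
rewrite -mulrA ler_pM2l ?cesaro_number_gt0 //.
set x := n.+2%:R^-1 : R.
have x0 : 0 <= x by rewrite invr_ge0.
have x1 : x <= 1 by rewrite invf_le1 // ler1n.
have -> : n.+1%:R = n.+2%:R * (1 - x) :> R.
  by rewrite mulrBr mulr1 mulfV ?pnatr_eq0 // [in RHS]mulrS addrAC subrr add0r.
rewrite powRM ?subr_ge0 // mulrC ler_pM2r ?powR_gt0 //.
by have [//|] := bernoulli_powR x0; rewrite ltNge x1.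
Qed.

(** A_(n-i) - A_n telescopes into i differences A_r - A_(r+1) = A_r a / (r+1), each at most A_(n-i)
    2a/n because r >= n/2. The size bounds then replace A_(n-i) by A_n, at the price of 2^a <= 2 and
    1/(1-a). *)
Lemma cesaro_number_ratio_le n i : (0 < n)%N -> (2 * i <= n)%N ->
  A (n - i) / A n - 1 <= 4 / (1 - a) * (i%:R / n%:R).
Proof.
case/andP: a01 => a0 a1 n0 hi.
have An0 := cesaro_number_gt0 n.
have nR : 0 < n%:R :> R by rewrite ltr0n.
have i_n : (i <= n)%N by lia.
have an : 1 - a <= A n * n%:R `^ a.
  by case: (n) n0 => // n' _; exact: cesaro_number_ge.
pose c := A (n - i) * (2 * a / n%:R).
have tel k : (k <= i)%N -> A (n - i) - A (n - i + k) <= k%:R * c.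
  elim: k => [|k IH] ki; first by rewrite addn0 subrr mul0r.
  have := IH (ltnW ki); rewrite addnS.
  have : A (n - i + k) - A (n - i + k).+1 <= c.
    rewrite cesaro_numberB; apply: ler_pM.
    - exact/ltW/cesaro_number_gt0.
    - by rewrite divr_ge0 // ltW.
    - by apply: cesaro_number_nincr; lia.
    - rewrite ler_pdivrMr // mulrAC ler_pdivlMr // [2 * a]mulrC -mulrA.
      by rewrite ler_pM2l // -natrM ler_nat; lia.
  rewrite (_ : k.+1%:R = k%:R + 1); last by rewrite -natr1.
  by rewrite mulrDl mul1r; lra.
have := tel i (leqnn _); rewrite subnK // => h.
have p2 : 2 `^ a <= 2 :> R by rewrite ler1_powR // ?ler1n ?ltW.
have h1 : A (n - i) * n%:R `^ a <= 2.
  apply: le_trans p2.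
  have : n%:R `^ a <= 2 `^ a * (n - i).+1%:R `^ a.
    rewrite -powRM //; apply: ge0_ler_powR; rewrite ?nnegrE ?(ltW a0) //.
    by rewrite -natrM ler_nat; lia.
  move=> /(ler_wpM2l (ltW (cesaro_number_gt0 (n - i)))) /le_trans; apply.
  by rewrite mulrCA ler_piMr ?powR_ge0 // cesaro_number_le.
have nA : 0 < n%:R `^ a :> R by rewrite powR_gt0.
rewrite lerBlDr ler_pdivrMr // mulrDl mul1r -lerBlDr.
apply: (le_trans h); rewrite /c -(ler_pM2r nA).
have -> : i%:R * (A (n - i) * (2 * a / n%:R)) * n%:R `^ a =
          (2 * a) * (A (n - i) * n%:R `^ a) * (i%:R / n%:R) by ring.
have -> : 4 / (1 - a) * (i%:R / n%:R) * A n * n%:R `^ a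
          = 4 / (1 - a) * (A n * n%:R `^ a) * (i%:R / n%:R) by ring.
apply: ler_wpM2r; first by rewrite divr_ge0.
apply: (@le_trans _ _ 4).
  have X0 : 0 <= A (n - i) * n%:R `^ a.
    by rewrite mulr_ge0 ?(ltW nA) // ltW // cesaro_number_gt0.
  have := ler_pM (ltW a0) X0 (ltW a1) h1; lra.
by rewrite mulrAC ler_pdivlMr ?subr_gt0 // ler_pM2l.
Qed.

End cesaro_numbers.

Lemma sum_exp_le (R : realType) (q : R) n : 0 < q < 1 ->
  \sum_(0 <= i < n) q ^+ i <= (1 - q)^-1.
Proof.
case/andP=> q0 q1; have q1' : 0 < 1 - q by rewrite subr_gt0.
suff -> : \sum_(0 <= i < n) q ^+ i = (1 - q ^+ n) / (1 - q).
  by rewrite ler_pdivrMr // mulVf ?gt_eqF // gerBl exprn_ge0 // ltW.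
elim: n => [|n IH]; first by rewrite big_geq // expr0 subrr mul0r.
rewrite big_nat_recr //= IH exprS -[X in _ + X](mulfK (lt0r_neq0 q1')) -mulrDl.
by congr (_ / _); ring.
Qed.

(** The terms of the geometric sum decrease, so each of its first n + 1 terms is at least q^n. *)
Lemma natr_exp_le (R : realType) (q : R) n : 0 < q < 1 ->
  n.+1%:R * q ^+ n <= (1 - q)^-1.
Proof.
move=> q01; apply: le_trans (sum_exp_le n.+1 q01).
case/andP: q01 => q0 q1.
have -> : n.+1%:R * q ^+ n = \sum_(0 <= i < n.+1) q ^+ n.
  by rewrite sumr_const_nat subn0 mulr_natl.
apply: ler_sum_nat => i /andP[_ ni].
by rewrite ler_wiXn2l // ltW.
Qed.

(** * Growth of the scale M_s *)

Section mixed_radix_growth.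
Variables (R : realType) (m : nat -> nat).
Hypothesis m_ge2 : forall k, (2 <= m k)%N.
Local Notation M := (vilenkin_M m).

Lemma vilenkin_M_gt0 s : (0 < M s)%N.
Proof. by apply: leq_ltn_trans (ltn_vilenkin_M m_ge2 s). Qed.

Lemma vilenkin_M_leq s t : (s <= t)%N -> (2 ^ (t - s) * M s <= M t)%N.
Proof.
move=> /subnKC; set d := (t - s)%N => <-; elim: d => [|d IH]; first by rewrite addn0 mul1n.
by rewrite addnS /= expnS -mulnA leq_mul.
Qed.

Lemma vilenkin_M_le s t : (s <= t)%N -> (M s <= M t)%N.
Proof.
by move=> /vilenkin_M_leq; apply: leq_trans; rewrite leq_pmull // expn_gt0.
Qed.

Lemma vilenkin_M_ratio_le s t : (s <= t)%N ->
  (M s)%:R / (M t)%:R <= 2^-1 ^+ (t - s) :> R.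
Proof.
move=> st; rewrite ler_pdivrMr ?ltr0n ?vilenkin_M_gt0 //.
rewrite exprVn ler_pdivlMl ?exprn_gt0 // -natrX -natrM ler_nat.
exact: vilenkin_M_leq.
Qed.

(** With q = 2^(-a/2) the decay M_s^(-a) <= 2^(-a s) splits into two powers: one q^s absorbs a
    factor s + 1, the other is left to be summed. *)
Lemma vilenkin_M_powR (a : R) : 0 < a -> exists2 q : R, 0 < q < 1 &
  forall s, ((M s)%:R `^ a)^-1 <= q ^+ s * q ^+ s.
Proof.
move=> a0; exists (2 `^ (- (a / 2))).
  rewrite powR_gt0 //= powRN invf_lt1 ?powR_gt0 //.
  have a2 : 0 < a / 2 by rewrite divr_gt0.
  have /= := gt0_ltr_powR a2 (x := 1) (y := 2).
  by rewrite powR1 !nnegrE; apply => //; rewrite ltr1n.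
move=> s; rewrite -exprMn -powRD ?pnatr_eq0 ?implybT // -opprD -splitr.
rewrite powRN exprVn lef_pV2 ?posrE ?exprn_gt0 ?powR_gt0 ?ltr0n ?vilenkin_M_gt0 //.
rewrite -powR_mulrn ?powR_ge0 // powRAC powR_mulrn //.
apply: ge0_ler_powR; rewrite ?nnegrE ?(ltW a0) //.
rewrite -natrX ler_nat; have := vilenkin_M_leq (leq0n s).
by rewrite subn0 /= muln1.
Qed.

Lemma vilenkin_M_powR_ge1 (a : R) s : 0 < a -> 1 <= (M s)%:R `^ a :> R.
Proof.
move=> a0; rewrite -[leLHS](powRr0 (M s)%:R) ler_powR ?(ltW a0) //.
by rewrite ler1n vilenkin_M_gt0.
Qed.

(** Absorbs the linear cost of initial sums at level s into the weight M_s^a; the constant is the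
    geometric sum 1/(1 - q). *)
Lemma natr_vilenkin_M_powR (a : R) : 0 < a ->
  exists2 c : R, 0 < c & forall s, s.+1%:R <= c * (M s)%:R `^ a.
Proof.
move=> a0; have [q q01 hq] := vilenkin_M_powR a0.
have q1 : 0 < 1 - q by rewrite subr_gt0; case/andP: q01.
exists (1 - q)^-1; first by rewrite invr_gt0.
move=> s; have M0 : 0 < (M s)%:R `^ a :> R.
  by rewrite powR_gt0 // ltr0n vilenkin_M_gt0.
rewrite -ler_pdivrMr //; apply: le_trans (natr_exp_le s q01).
rewrite ler_wpM2l //; apply: le_trans (hq s) _.
case/andP: q01 => q0 /ltW q1'.
by rewrite ler_piMl ?exprn_ge0 ?exprn_ile1 // ltW.
Qed.

End mixed_radix_growth.

(** * One variable: Cesaro errors for orthogonal projections under a seminorm *)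

Section one_variable.
Variables (R : realType) (m : nat -> nat) (B : nat).
Hypotheses (m_ge2 : forall k, (2 <= m k)%N) (m_le : forall k, (m k <= B)%N).
Local Notation M := (vilenkin_M m).
Variables (V : lmodType R[i]) (N : V -> R).
Hypothesis N_triangle : forall u v, N (u + v) <= N u + N v.
Hypothesis N_scale : forall c v, N (c *: v) = Normc.normc c * N v.
Variables (K : nat) (P : nat -> {linear V -> V}).
Hypothesis P_ortho : forall i j v, (i < M K)%N -> (j < M K)%N ->
  P i (P j v) = if i == j then P i v else 0.
Hypothesis P_block : forall s c v, ((c * M s) + M s <= M K)%N ->
  N (\sum_(c * M s <= i < c * M s + M s) P i v) <= N v.

Lemma seminorm_real (c : R) v : N (c%:C%C *: v) = `|c| * N v.
Proof. by rewrite N_scale /= expr0n /= addr0 sqrtr_sqr. Qed.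

Lemma seminorm0 : N 0 = 0.
Proof. by rewrite -(scale0r 0) -[0]/(0%:C%C) seminorm_real normr0 mul0r. Qed.

Lemma seminormN v : N (- v) = N v.
Proof.
have e : -1 = (-1)%:C%C :> R[i] by rewrite rmorphN1.
by rewrite -scaleN1r e seminorm_real normrN1 mul1r.
Qed.

Lemma seminorm_ge0 v : 0 <= N v.
Proof. by have := N_triangle v (- v); rewrite subrr seminorm0 seminormN; lra. Qed.

Lemma seminormB u v : N (u - v) <= N u + N v.
Proof. by rewrite -[N v]seminormN. Qed.

Lemma seminorm_sum (I : Type) (r : seq I) (Q : pred I) (F : I -> V) :
  N (\sum_(i <- r | Q i) F i) <= \sum_(i <- r | Q i) N (F i).
Proof.
elim/big_rec2: _ => [|i y1 y2 _ IH]; first by rewrite seminorm0.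
by apply: le_trans (N_triangle _ _) _; rewrite lerD2l.
Qed.

Lemma block_sum_le s c q v : (c * M s + q * M s <= M K)%N ->
  N (\sum_(c * M s <= i < c * M s + q * M s) P i v) <= q%:R * N v.
Proof.
elim: q => [|q IH] h; first by rewrite addn0 big_geq // seminorm0 mul0r.
rewrite (@big_cat_nat _ _ _ (c * M s + q * M s)) /= ?leq_addr //; last first.
  by rewrite leq_add2l leq_mul2r leqnSn orbT.
apply: (le_trans (N_triangle _ _)); rewrite -natr1 mulrDl mul1r; apply: lerD.
  by apply: IH; apply: leq_trans h; rewrite leq_add2l leq_mul2r leqnSn orbT.
have e : (c * M s + q.+1 * M s = (c + q) * M s + M s)%N by lia.
by rewrite e -mulnDl; apply: P_block; rewrite -e.
Qed.

(** Greedy expansion of t in mixed radix: at each level at most [B] whole blocks are removed, each a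
    contraction, and the remainder is an initial piece of the next block one level down. *)
Lemma initial_sum_le s c t v : (t <= M s)%N -> (c * M s + M s <= M K)%N ->
  N (\sum_(c * M s <= i < c * M s + t) P i v) <= (B * s).+1%:R * N v.
Proof.
elim: s c t v => [|s IH] c t v /=.
  case: t => [|[|//]] _ h.
    by rewrite addn0 big_geq // seminorm0 mulr_ge0 // seminorm_ge0.
  rewrite muln0 mul1r; exact: (@P_block 0 c v).
move=> tM h; have M0 := vilenkin_M_gt0 m_ge2 s.
rewrite (divn_eq t (M s)) mulnA.
set q := (t %/ M s)%N; set r := (t %% M s)%N; set d := (c * m s)%N.
have rM : (r < M s)%N by rewrite ltn_mod.
have qm : (q <= m s)%N by rewrite /q -[m s](mulnK _ M0) leq_div2r.
have hd : (d * M s + m s * M s <= M K)%N by rewrite -mulnA.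
have hq : (d * M s + q * M s <= M K)%N.
  by apply: leq_trans hd; rewrite leq_add2l leq_mul2r qm orbT.
rewrite (@big_cat_nat _ _ _ (d * M s + q * M s)) /= ?leq_addr //; last first.
  by rewrite addnA leq_addr.
apply: (le_trans (N_triangle _ _)).
apply: (@le_trans _ _ (q%:R * N v + (B * s).+1%:R * N v)); last first.
  rewrite -mulrDl ler_wpM2r ?seminorm_ge0 // -natrD ler_nat mulnS addnS ltnS leq_add2r.
  exact: leq_trans qm (m_le s).
apply: lerD; first exact: block_sum_le.
(* The zero remainder is separate: then [q] may equal [m s], and the block that the induction
   hypothesis would use could leave [0, M_K). *)
have [->|r0] := posnP r.
  by rewrite addn0 big_geq // seminorm0 mulr_ge0 // seminorm_ge0.
rewrite addnA -mulnDl; apply: IH; first exact: ltnW.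
have qm' : (q < m s)%N.
  rewrite ltn_neqAle qm andbT; apply/eqP => qE.
  by move: tM; rewrite (divn_eq t (M s)) -/q -/r qE; lia.
apply: leq_trans hd; rewrite mulnDl -addnA leq_add2l -mulSnr.
by rewrite leq_mul2r qm' orbT.
Qed.

Lemma abel_sum (x : nat -> V) (w : nat -> R) a T :
  \sum_(a <= i < a + T) (w i)%:C%C *: x i =
  (w (a + T)%N)%:C%C *: (\sum_(a <= i < a + T) x i) -
  \sum_(0 <= t < T) (w (a + t).+1 - w (a + t)%N)%:C%C *: (\sum_(a <= i < a + t.+1) x i).
Proof.
elim: T => [|T IH]; first by rewrite addn0 !big_geq // scaler0 subrr.
rewrite !addnS big_nat_recr ?leq_addr //= IH.
rewrite [\sum_(0 <= t < T.+1) _]big_nat_recr //= addnS.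
rewrite [\sum_(a <= i < (a + T).+1) x i]big_nat_recr ?leq_addr //=.
rewrite addrAC -scalerDr; set Y := (_ + x _); rewrite rmorphB scalerBl.
set S := \sum_(0 <= t < T) _; rewrite [S + _]addrC opprD opprB addrA.
by rewrite [_ *: Y + (_ - _)]addrC subrK.
Qed.

(** The endpoint term and the total variation of the monotone [w] each contribute at most L w(a +
    T). The weight is evaluated one past the last index, which is where callers must bound it. *)
Lemma abel_sum_le (x : nat -> V) (w : nat -> R) (L : R) a T :
  0 <= w a -> (forall i, w i <= w i.+1) ->
  (forall t, (t <= T)%N -> N (\sum_(a <= i < a + t) x i) <= L) ->
  N (\sum_(a <= i < a + T) (w i)%:C%C *: x i) <= 2 * L * w (a + T)%N.
Proof.
move=> wa wi hL; rewrite abel_sum.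
have L0 : 0 <= L by apply: le_trans (hL 0 (leq0n _)); exact: seminorm_ge0.
have wT : w a <= w (a + T)%N.
  elim: (T) => [|T' IH]; first by rewrite addn0.
  by rewrite addnS; apply: le_trans (wi _).
apply: (le_trans (seminormB _ _)); rewrite seminorm_real ger0_norm; last exact: le_trans wT.
apply: (@le_trans _ _ (w (a + T)%N * L + (w (a + T)%N - w a) * L)); last first.
  by have := mulr_ge0 wa L0; lra.
apply: lerD; first by rewrite ler_wpM2l ?hL // (le_trans wa).
apply: (le_trans (seminorm_sum _ _ _)).
have -> : w (a + T)%N - w a = \sum_(0 <= t < T) (w (a + t).+1 - w (a + t)%N).
  rewrite (@telescope_sumr_eq _ _ _ (fun t => w (a + t)%N)) ?addn0 // => i _.
  by rewrite addnS.
rewrite mulr_suml; apply: ler_sum_nat => t /andP[_ tT].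
by rewrite seminorm_real ger0_norm ?subr_ge0 // ler_wpM2l ?subr_ge0 // hL.
Qed.

Variable a : R.
Hypothesis a01 : 0 < a < 1.
Local Notation A := (cesaro_number (- a)).

(** The predecessor leaves a whole block of length [M s] between a positive cut and [n.+1], so that
    up to the cut the weights A_(n-i) are at most A_(M_s - 1) <= M_s^(-a). When n + 1 < 2 M_s the
    cut is 0. *)
Let cut n s := ((n.+1 %/ M s).-1 * M s)%N.

Let cut_le n s d : (d.+1 * M s <= cut n s)%N -> (d.+1 * M s + M s <= n.+1)%N.
Proof.
rewrite /cut leq_pmul2r ?vilenkin_M_gt0 // => h.
rewrite -mulSnr -leq_divRL ?vilenkin_M_gt0 //; lia.
Qed.

Lemma cesaro_blocks_le n s c q v : (n < M K)%N -> ((c + q) * M s <= cut n s)%N ->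
  N (\sum_(c * M s <= i < (c + q) * M s) (A (n - i))%:C%C *: P i v) <=
  q%:R * (2 * ((B * s).+1%:R * N v) * ((M s)%:R `^ a)^-1).
Proof.
move=> nK; set D := (2 * _ * _); have M0 := vilenkin_M_gt0 m_ge2 s.
elim: q => [|q IH] h; first by rewrite addn0 big_geq // seminorm0 mul0r.
have h' : ((c + q) * M s <= cut n s)%N.
  by apply: leq_trans h; rewrite leq_mul2r addnS leqnSn orbT.
rewrite (@big_cat_nat _ _ _ ((c + q) * M s)) /= ?leq_mul2r ?leq_addr ?orbT //; last first.
  by rewrite addnS leqnSn orbT.
apply: (le_trans (N_triangle _ _)); rewrite -natr1 mulrDl mul1r; apply: lerD.
  exact: IH.
rewrite addnS in h; have hn := cut_le h.
rewrite addnS mulSnr.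
apply: (le_trans (@abel_sum_le (fun i => P i v) (fun i => A (n - i))
    ((B * s).+1%:R * N v) _ _ _ _ _)).
- exact/ltW/cesaro_number_gt0.
- by move=> i; apply: cesaro_number_nincr => //; lia.
- by move=> t tM; apply: initial_sum_le => //; lia.
apply: ler_wpM2l; first by rewrite !mulr_ge0 // seminorm_ge0.
have Ma : 0 < (M s)%:R `^ a :> R by rewrite powR_gt0 // ltr0n.
rewrite -[leRHS]mul1r ler_pdivlMr //.
(* The block ends at least M_s - 1 before n, and A_(M_s - 1) M_s^a <= 1. *)
apply: le_trans (cesaro_number_le a01 (M s).-1); rewrite prednK // ler_pM2r //.
by apply: cesaro_number_nincr => //; lia.
Qed.

(** [T s] is the part of the sum beyond the cut at level s: only the term i = n for s = 0, the whole
    sum for s = K. Each level adds at most [2 * B] blocks, whose total cost is at most a constant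
    times (s + 1) q^(2s). *)
Lemma cesaro_kernel_le q n v : 0 < q < 1 ->
  (forall s, ((M s)%:R `^ a)^-1 <= q ^+ s * q ^+ s) -> (n < M K)%N ->
  N (\sum_(0 <= i < n.+1) (A (n - i))%:C%C *: P i v) <=
  (1 + 4 * B%:R * B.+1%:R * (1 - q)^-1 ^+ 2) * N v.
Proof.
move=> q01 hq nK; have [q0 q1] := andP q01.
have q1' : 0 <= (1 - q)^-1 by rewrite invr_ge0 subr_ge0 ltW.
have Nv := seminorm_ge0 v.
pose T s := \sum_(cut n s <= i < n.+1) (A (n - i))%:C%C *: P i v.
have cut0 : cut n 0 = n by rewrite /cut divn1 muln1.
have cutK : cut n K = 0%N.
  rewrite /cut; have : (n.+1 %/ M K <= 1)%N by rewrite -ltnS ltn_divLR ?vilenkin_M_gt0 //; lia.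
  by case: (_ %/ _)%N => [|[|]].
have cutS s : (cut n s.+1 <= cut n s)%N /\
  exists c q', [/\ cut n s.+1 = c * M s, cut n s = (c + q') * M s & q' <= 2 * B]%N.
  have M0 := vilenkin_M_gt0 m_ge2 s.
  rewrite /cut /= [(m s * M s)%N]mulnC divnMA.
  set d := (n.+1 %/ M s)%N; have mB := m_le s; have m2 := m_ge2 s.
  have m0 : (0 < m s)%N by apply: leq_trans m2.
  have := divn_eq d (m s); have := ltn_pmod d m0.
  set u := (d %/ m s)%N; set r := (d %% m s)%N => rm dE.
  have uE : (u.-1 * m s <= d.-1)%N by case: (u) dE => [|u'] /=; rewrite ?mulSn; lia.
  split; first by rewrite [(M s * m s)%N]mulnC mulnA leq_mul2r uE orbT.
  (* With d = u m_s + r, the cuts differ by (d - 1) - (u - 1) m_s = m_s + r - 1 blocks if u > 0, and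
     by fewer if u = 0. *)
  exists (u.-1 * m s)%N, (d.-1 - u.-1 * m s)%N; split.
  - by rewrite [(M s * m s)%N]mulnC mulnA.
  - by rewrite subnKC.
  - by case: (u) dE => [|u'] /=; rewrite ?mulSn; lia.
have step s : N (T s.+1) <= (4 * B%:R * B.+1%:R * (1 - q)^-1 * q ^+ s) * N v + N (T s).
  have [le_cut [c [q' [cE cE' q'B]]]] := cutS s.
  have le_cut' : (cut n s <= n.+1)%N.
    rewrite /cut (leq_trans _ (leq_divM n.+1 (M s))) // leq_mul2r leq_pred orbT //.
  rewrite /T (@big_cat_nat _ _ _ (cut n s)) //=.
  apply: (le_trans (N_triangle _ _)); rewrite lerD2r cE cE'.
  apply: (le_trans (cesaro_blocks_le v nK _)); first by rewrite cE'.
  rewrite -!mulrA [N v * _]mulrC !mulrA ler_wpM2r //.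
  (* From B s + 1 <= (B + 1)(s + 1); one power q^s then absorbs s + 1. *)
  apply: (@le_trans _ _ ((2 * B)%:R * (2 * (B.+1%:R * s.+1%:R)) * (q ^+ s * q ^+ s))).
    apply: ler_pM; rewrite ?mulr_ge0 ?invr_ge0 ?powR_ge0 ?hq //.
    rewrite -mulrA; apply: ler_pM; rewrite ?mulr_ge0 ?ler_nat //.
    by rewrite ler_wpM2l // -natrM ler_nat; lia.
  rewrite [leLHS](_ : _ = 4 * B%:R * B.+1%:R * (s.+1%:R * q ^+ s) * q ^+ s); last first.
    by rewrite natrM; ring.
  rewrite ler_wpM2r ?exprn_ge0 ?(ltW q0) // ler_wpM2l ?mulr_ge0 //.
  exact: natr_exp_le.
have main s : N (T s) <=
    (1 + 4 * B%:R * B.+1%:R * (1 - q)^-1 * \sum_(0 <= r < s) q ^+ r) * N v.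
  elim: s => [|s IH].
    rewrite big_geq // mulr0 addr0 mul1r /T cut0 big_nat1 subnn cesaro_number0.
    rewrite scale1r.
    have := @P_block 0 n v; rewrite muln1 addn1 big_nat1; exact.
  by apply: (le_trans (step s)); rewrite big_nat_recr //=; move: IH; lra.
have := main K; rewrite /T cutK => /le_trans; apply.
rewrite ler_wpM2r // lerD2l exprS expr1 !mulrA ler_wpM2l ?mulr_ge0 //.
exact: sum_exp_le.
Qed.

Definition partial_sum (k : nat) v : V := \sum_(0 <= i < M k) P i v.

Definition cesaro_sum (n : nat) v : V :=
  \sum_(0 <= i < n.+1) (A (n - i) / A n)%:C%C *: P i v.

Lemma P_partial_sum i k v : (i < M K)%N -> (k <= K)%N ->
  P i (partial_sum k v) = if (i < M k)%N then P i v else 0.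
Proof.
move=> iK kK; have MkK := vilenkin_M_le m_ge2 kK.
rewrite /partial_sum raddf_sum /=.
rewrite (eq_big_nat _ _ (F2 := fun j => if i == j then P i v else 0)); last first.
  by move=> j /andP[_ jk]; rewrite P_ortho // (leq_trans jk).
rewrite big_mkord -big_mkcond /=; case: ltnP => ik.
  by rewrite (big_pred1 (Ordinal ik)) // => j /=; rewrite eq_sym.
by rewrite big_pred0 // => j; rewrite gtn_eqF // (leq_trans (ltn_ord j)).
Qed.

(** On E_k v the mean is a finite sum over i < M_k, since P_i E_k is P_i there and 0 beyond. The
    error on v - E_k v needs no cancellation, and the rest carries the small multipliers A_(n-i)/A_n
    - 1. *)
Lemma cesaro_error_split n k v : (M k <= n)%N -> (n < M K)%N -> (k <= K)%N ->
  let w := v - partial_sum k v in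
  cesaro_sum n v - v = (cesaro_sum n w - w) +
    \sum_(0 <= i < M k) (A (n - i) / A n - 1)%:C%C *: P i v.
Proof.
move=> kn nK kK w.
have -> : cesaro_sum n v = cesaro_sum n w + cesaro_sum n (partial_sum k v).
  rewrite /cesaro_sum -big_split /=; apply: eq_bigr => i _.
  by rewrite -scalerDr -linearD subrK.
have -> : cesaro_sum n (partial_sum k v) =
    \sum_(0 <= i < M k) (A (n - i) / A n)%:C%C *: P i v.
  rewrite /cesaro_sum (@big_cat_nat _ _ _ (M k)) //=; last exact: leqW.
  rewrite [X in _ + X]big_nat_cond [X in _ + X]big1 ?addr0.
    apply: eq_big_nat => i /andP[_ ik].
    by rewrite P_partial_sum ?ik // (leq_trans ik) // ltnW // (leq_ltn_trans kn).
  move=> i /andP[/andP[ki iN] _].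
  by rewrite P_partial_sum ?(leq_ltn_trans _ nK) // ltnNge ki scaler0.
have -> : \sum_(0 <= i < M k) (A (n - i) / A n - 1)%:C%C *: P i v =
   \sum_(0 <= i < M k) (A (n - i) / A n)%:C%C *: P i v - partial_sum k v.
  rewrite /partial_sum -sumrB; apply: eq_bigr => i _.
  by rewrite rmorphB scalerBl scale1r.
set L := \sum_(0 <= i < M k) _.
by rewrite -[X in _ - X = _](subrK (partial_sum k v)) -/w opprD addrACA.
Qed.

(** First line: the kernel bound times 1/A_n <= n^a/(1-a), with n < B^2 M_k, and 1 for the
    subtracted vector. Second line: 2 from summation by parts, [2 * B.+1 * c] from the initial sums,
    [4 / (1 - a) * B] from the ratio of weights. *)
Definition cesaro_const (q c : R) : R :=
  (1 + 4 * B%:R * B.+1%:R * (1 - q)^-1 ^+ 2) * ((B * B)%:R `^ a / (1 - a)) + 1 +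
  16 * B%:R * B.+1%:R * c / (1 - a).

(** The weight M_j^a has two origins: 1/A_n for j = k, where the kernel bound is used on v - E_k v,
    and the cost of initial sums for j < k, where 2^(j-k) comes from the ratio of weights. *)
Lemma cesaro_error_le q c n k v : 0 < q < 1 ->
  (forall s, ((M s)%:R `^ a)^-1 <= q ^+ s * q ^+ s) ->
  0 < c -> (forall s, s.+1%:R <= c * (M s)%:R `^ a) ->
  (M k.+1 <= n < M k.+2)%N -> (n < M K)%N ->
  N (cesaro_sum n v - v) <= cesaro_const q c *
    \sum_(0 <= j < k.+1) 2^-1 ^+ (k - j) * ((M j)%:R `^ a * N (v - partial_sum j v)).
Proof.
have hnat b j : ((b * j.+1).+1 <= 2 * b.+1 * j.+1)%N by lia.
move=> q01 hq c0 hc /andP[kn nk] nK.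
have [a0 a1] := andP a01; have a1' : 0 < 1 - a by rewrite subr_gt0.
have Mpos s : 0 < (M s)%:R :> R by rewrite ltr0n vilenkin_M_gt0.
have Mapos s : 0 < (M s)%:R `^ a :> R by rewrite powR_gt0.
have kn' : (M k <= n)%N by apply: leq_trans kn; apply: vilenkin_M_le.
have n0 : (0 < n)%N by apply: leq_trans kn'; apply: vilenkin_M_gt0.
have kK : (k <= K)%N.
  rewrite leqNgt; apply/negP => Kk.
  have := vilenkin_M_le m_ge2 (ltnW Kk); lia.
have An0 := cesaro_number_gt0 a01 n.
set F := fun j => 2^-1 ^+ (k - j) * ((M j)%:R `^ a * N (v - partial_sum j v)).
have F0 j : 0 <= F j by rewrite !mulr_ge0 ?powR_ge0 ?seminorm_ge0 // exprn_ge0.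
set C1 := (1 + 4 * B%:R * B.+1%:R * (1 - q)^-1 ^+ 2) * ((B * B)%:R `^ a / (1 - a)) + 1.
set C2 := 16 * B%:R * B.+1%:R * c / (1 - a).
have Ck0 : 0 <= 1 + 4 * B%:R * B.+1%:R * (1 - q)^-1 ^+ 2.
  by rewrite addr_ge0 // mulr_ge0 ?sqr_ge0 // !mulr_ge0.
have C10 : 0 <= C1 by rewrite addr_ge0 // !mulr_ge0 ?powR_ge0 // invr_ge0 ltW.
have C20 : 0 <= C2 by rewrite !mulr_ge0 // ?invr_ge0 ltW.
rewrite /cesaro_const -/C1 -/C2 (cesaro_error_split v kn' nK kK) /=.
set w := v - partial_sum k v.
have first : N (cesaro_sum n w - w) <= C1 * F k.
  apply: (le_trans (seminormB _ _)).
  have -> : cesaro_sum n w =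
      ((A n)^-1)%:C%C *: \sum_(0 <= i < n.+1) (A (n - i))%:C%C *: P i w.
    rewrite scaler_sumr; apply: eq_bigr => i _.
    by rewrite scalerA -rmorphM mulrC.
  rewrite seminorm_real ger0_norm ?invr_ge0 ?(ltW An0) //.
  rewrite /F subnn expr0 mul1r mulrA /C1 mulrDl mul1r [leRHS]mulrDl.
  have Nw := seminorm_ge0 w.
  apply: lerD; last first.
    by rewrite ler_peMl // vilenkin_M_powR_ge1.
  have hA : (A n)^-1 <= (B * B)%:R `^ a / (1 - a) * (M k)%:R `^ a.
    rewrite [leRHS]mulrAC ler_pdivlMr // ler_pdivrMl //.
    have : 1 - a <= A n * n%:R `^ a.
      by case: (n) n0 => // n' _; exact: cesaro_number_ge.
    move=> /le_trans; apply.
    rewrite ler_pM2l // -powRM //.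
    apply: ge0_ler_powR; rewrite ?nnegrE ?(ltW a0) // -natrM ler_nat.
    apply: (leq_trans (ltnW nk)); rewrite /= mulnA leq_mul //.
    exact: leq_mul (m_le _) (m_le _).
  apply: (le_trans (ler_pM _ _ hA (cesaro_kernel_le w q01 hq nK))).
  - by rewrite invr_ge0 ltW.
  - exact: seminorm_ge0.
  by rewrite mulrACA [X in X * _]mulrC !mulrA.
have second j : (j < k)%N ->
    N (\sum_(M j <= i < M j.+1) (A (n - i) / A n - 1)%:C%C *: P i v) <= C2 * F j.
  move=> jk; set u := v - partial_sum j v.
  have jM : (M j.+1 <= M K)%N by apply: vilenkin_M_le => //; exact: leq_trans kK.
  have jK : (j <= K)%N by exact: ltnW (leq_trans jk kK).
  have nI i : (A (n - i) / A n - 1) <= (A (n - i.+1) / A n - 1).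
    rewrite lerD2r ler_pM2r ?invr_gt0 //.
    by apply: cesaro_number_nincr; rewrite ?leq_sub2l.
  have Pu i : (M j <= i < M j.+1)%N -> P i v = P i u.
    move=> /andP[ji ij]; have iK := leq_trans ij jM.
    by rewrite /u linearB /= (P_partial_sum v iK jK) ltnNge ji subr0.
  have Pu0 i : (0 <= i < M j)%N -> P i u = 0.
    move=> /andP[_ ij]; have iK := leq_trans ij (vilenkin_M_le m_ge2 jK).
    by rewrite /u linearB /= (P_partial_sum v iK jK) ij subrr.
  (* [P i u] vanishes for i < M_j, so the sum may start at 0, where the increasing weight is 0 and
     [initial_sum_le] applies with block number 0. *)
  have -> : \sum_(M j <= i < M j.+1) (A (n - i) / A n - 1)%:C%C *: P i v =
      \sum_(0 <= i < 0 + M j.+1) (A (n - i) / A n - 1)%:C%C *: P i u.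
    rewrite add0n [in RHS](@big_cat_nat _ _ _ (M j)) ?vilenkin_M_le //=.
    rewrite [X in _ = X + _]big_nat_cond [X in _ = X + _]big1 ?add0r.
      by apply: eq_big_nat => i hi; rewrite Pu.
    by move=> i /andP[hi _]; rewrite Pu0 // scaler0.
  have hL t : (t <= M j.+1)%N -> N (\sum_(0 <= i < 0 + t) P i u) <= (B * j.+1).+1%:R * N u.
    by move=> tM; have := @initial_sum_le j.+1 0 t u tM; rewrite mul0n; apply; rewrite add0n.
  have w0 : 0 <= A (n - 0) / A n - 1 by rewrite subn0 divff ?gt_eqF // subrr.
  apply: (le_trans (abel_sum_le w0 nI hL)); rewrite add0n.
  (* Here 2 M_(j+1) <= 2 M_k <= M_(k+1) <= n, as the ratio bound requires. *)
  have hl : A (n - M j.+1) / A n - 1 <=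
      4 / (1 - a) * (B%:R * (2^-1 ^+ (k - j))).
    apply: (le_trans (cesaro_number_ratio_le _ _ _)) => //.
      apply: leq_trans kn; rewrite /= leq_mul ?m_ge2 //.
      exact: (vilenkin_M_le m_ge2 jk).
    apply: ler_wpM2l; first by rewrite divr_ge0 // ltW.
    apply: (@le_trans _ _ ((m j)%:R * ((M j)%:R / (M k)%:R))).
      rewrite /= natrM -mulrA ler_wpM2l // ler_wpM2l //.
      by rewrite lef_pV2 ?posrE ?ltr0n ?vilenkin_M_gt0 // ler_nat.
    by rewrite ler_pM ?divr_ge0 ?ler_nat // vilenkin_M_ratio_le // ltnW.
  have Nu := seminorm_ge0 u.
  have hB : (B * j.+1).+1%:R <= 2 * B.+1%:R * (c * (M j)%:R `^ a).
    apply: (@le_trans _ _ (2 * B.+1%:R * j.+1%:R)).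
      by rewrite -!natrM ler_nat hnat.
    by rewrite ler_wpM2l // hc.
  have l0 : 0 <= A (n - M j.+1) / A n - 1.
    by rewrite subr_ge0 ler_pdivlMr // mul1r cesaro_number_nincr // leq_subr.
  have := ler_wpM2r Nu hB => hB'.
  have h := ler_pM (mulr_ge0 (ler0n _ _) Nu) l0 hB' hl.
  rewrite -mulrA; apply: (@le_trans _ _ (2 * (2 * B.+1%:R * (c * (M j)%:R `^ a) * N u *
     (4 / (1 - a) * (B%:R * 2^-1 ^+ (k - j)))))).
    by rewrite ler_wpM2l.
  by rewrite le_eqVlt; apply/orP; left; apply/eqP; rewrite /C2 /F -/u; ring.
have -> : \sum_(0 <= i < M k) (A (n - i) / A n - 1)%:C%C *: P i v =
    \sum_(0 <= j < k) \sum_(M j <= i < M j.+1) (A (n - i) / A n - 1)%:C%C *: P i v.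
  elim: (k) => [|k' IH].
    by rewrite big_nat1 big_geq // subn0 divff ?gt_eqF // subrr scale0r.
  rewrite [RHS]big_nat_recr // -IH -big_cat_nat //.
  exact: vilenkin_M_le (leqnSn k').
apply: (le_trans (N_triangle _ _)).
apply: (@le_trans _ _ (C1 * F k + \sum_(0 <= j < k) C2 * F j)).
  apply: lerD => //; apply: (le_trans (seminorm_sum _ _ _)).
  by apply: ler_sum_nat => j /andP[_]; exact: second.
rewrite -mulr_sumr big_nat_recr //= mulrDr [leRHS]addrC.
have S0 : 0 <= \sum_(0 <= j < k) F j by apply: sumr_ge0.
by rewrite lerD // ler_wpM2r // ?lerDl ?lerDr.
Qed.
End one_variable.

Lemma sum_nat_shift (V : nmodType) a n (F : nat -> V) :
  \sum_(a <= i < a + n) F i = \sum_(0 <= i < n) F (a + i)%N.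
Proof.
rewrite -{1}[a]add0n big_addn addKn; apply: eq_bigr => i _.
by rewrite addnC.
Qed.

(** * Characters, digits and the Dirichlet kernel *)

Section vilenkin_characters.
Variables (R : realType) (m : nat -> nat).
Hypothesis m_ge2 : forall k, (2 <= m k)%N.
Local Notation G := (vilenkin m).
Local Notation M := (vilenkin_M m).
Local Notation expi := (@expi R).
Local Notation psi := (@psi R m).

Lemma expiD s t : expi (s + t) = expi s * expi t.
Proof.
rewrite /expi cosD sinD; apply/eqP; rewrite eq_complex /=.
by apply/andP; split; apply/eqP; ring.
Qed.

Lemma expi0 : expi 0 = 1.
Proof. by rewrite /expi cos0 sin0. Qed.

Lemma expi_natM n t : expi (n%:R * t) = expi t ^+ n.
Proof.
elim: n => [|n IH]; first by rewrite mul0r expi0 expr0.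
by rewrite -natr1 mulrDl mul1r expiD IH exprSr.
Qed.

Lemma normc_expi t : Normc.normc (expi t) = 1.
Proof. by rewrite /= cos2Dsin2 sqrtr1. Qed.

(** cos t = 1 - 2 sin^2(t/2), and this sine is positive because t/2 lies in (0, pi). *)
Lemma expi_eq1 t : 0 < t < 2 * pi -> expi t != 1.
Proof.
case/andP=> t0 t2; apply/negP => /eqP[+ _].
have -> : t = t / 2 + t / 2 by rewrite -splitr.
have s0 : 0 < sin (t / 2).
  by apply: sin_gt0_pi; rewrite divr_gt0 // ltr_pdivrMr // [X in _ < X]mulrC.
rewrite cosD => h; have := cos2Dsin2 (t / 2); nra.
Qed.

Local Notation zeta k := (expi (2 * pi / (m k)%:R)).

Lemma rademacherE k (x : G) : rademacher R k x = zeta k ^+ (x k : 'Z_(m k)).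
Proof. by rewrite /rademacher -expi_natM mulrCA !mulrA. Qed.

Let m_gt0 k : (0 < m k)%N. Proof. exact: leq_trans (m_ge2 k). Qed.

Lemma zeta_unity k : zeta k ^+ m k = 1.
Proof.
rewrite -expi_natM mulrCA divff ?pnatr_eq0 ?gtn_eqF // mulr1.
have -> : 2 * pi = pi *+ 2 :> R by rewrite mulr_natl.
by rewrite /expi cos2pi sin2pi.
Qed.

Lemma zeta_neq1 k j : (0 < j < m k)%N -> zeta k ^+ j != 1.
Proof.
case/andP=> j0 jm; have pi0 := pi_gt0 R; rewrite -expi_natM; apply: expi_eq1.
have mR : 0 < (m k)%:R :> R by rewrite ltr0n.
rewrite mulr_gt0 ?ltr0n ?divr_gt0 ?mulr_gt0 //=.
rewrite mulrA ltr_pdivrMr // mulrC ltr_pM2l ?mulr_gt0 //.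
by rewrite ltr_nat.
Qed.

Lemma zeta_inj k i j : (i < m k)%N -> (j < m k)%N -> zeta k ^+ i = zeta k ^+ j -> i = j.
Proof.
wlog ij : i j / (i <= j)%N => [hw im jm h|im jm].
  by have [/hw|/ltnW/hw] := leqP i j; [apply|move=> /(_ jm im (esym h))].
have z0 : zeta k != 0.
  apply/eqP => z0; have := normc_expi (2 * pi / (m k)%:R).
  by rewrite z0 Normc.normc0 => /eqP; rewrite eq_sym oner_eq0.
rewrite -(subnKC ij) exprD -[LHS]mulr1 => /(mulfI (expf_neq0 i z0)) /esym/eqP.
have [->|d0] := posnP (j - i); first by rewrite addn0.
by rewrite (negbTE (zeta_neq1 _)) // d0 (leq_ltn_trans (leq_subr _ _)).
Qed.

Lemma rademacherD k (x y : G) : rademacher R k (x + y) = rademacher R k x * rademacher R k y.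
Proof.
rewrite !rademacherE -exprD /= [X in (_ %% X)%N](Zp_cast (m_ge2 k)).
exact: expr_mod (zeta_unity k).
Qed.

Lemma rademacher_coord0 k (x : G) : x k = (0 : 'Z_(m k)) -> rademacher R k x = 1.
Proof. by move=> x0; rewrite rademacherE x0 expr0. Qed.

Lemma normc_psi n (x : G) : Normc.normc (psi n x) = 1.
Proof.
rewrite /psi; elim/big_ind: _ => [|a b ha hb|k _]; first exact: Normc.normc1.
  by rewrite Normc.normcM ha hb mulr1.
elim: (digit _ _ _) => [|d IH]; first by rewrite expr0 Normc.normc1.
by rewrite exprS Normc.normcM IH normc_expi mulr1.
Qed.

Lemma psiD n (x y : G) : psi n (x + y) = psi n x * psi n y.
Proof.
by rewrite /psi -big_split; apply: eq_bigr => k _; rewrite rademacherD exprMn.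
Qed.

Lemma psi_arg0 n : psi n (0 : G) = 1.
Proof.
by rewrite /psi big1 // => k _; rewrite rademacher_coord0 ?expr1n.
Qed.

Lemma psi_neq0 n (x : G) : psi n x != 0.
Proof.
apply/eqP => z0; have := normc_psi n x.
by rewrite z0 Normc.normc0 => /eqP; rewrite eq_sym oner_eq0.
Qed.

Lemma psiN n (x : G) : psi n (- x) = (psi n x)^-1.
Proof. by apply: (mulfI (psi_neq0 n x)); rewrite -psiD subrr psi_arg0 mulfV ?psi_neq0. Qed.

Lemma conj_psi n (x : G) : (psi n x)^*%C = psi n (- x).
Proof.
rewrite psiN; apply: (mulfI (psi_neq0 n x)); rewrite mulfV ?psi_neq0 //.
rewrite -sqr_normc normc_def -/(Normc.normc (psi n x)).
by case: (psi n x) (normc_psi n x) => a b /= ->; rewrite expr1n.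
Qed.

Lemma psi_extend n L (x : G) : (n <= L)%N ->
  psi n x = \prod_(k < L) rademacher R k x ^+ digit m n k.
Proof.
move=> nL; rewrite /psi -!(big_mkord xpredT (fun k => rademacher R k x ^+ digit m n k)).
rewrite [RHS](@big_cat_nat _ _ _ n) //= [X in _ = _ * X]big_nat_cond.
rewrite [X in _ = _ * X]big1 ?mulr1 // => k /andP[/andP[nk _] _].
by rewrite digit_eq0 // expr0.
Qed.

Lemma digit_large n j s : (n < M s)%N -> (s <= j)%N -> digit m n j = 0%N.
Proof.
move=> ns sj; rewrite /digit divn_small ?mod0n //.
exact: leq_trans ns (vilenkin_M_le m_ge2 sj).
Qed.

Lemma vilenkin_M_dvd s t : (s <= t)%N -> (M s %| M t)%N.
Proof. by move=> /subnKC <-; elim: (t - s)%N => [|d IH]; rewrite ?addn0 // addnS dvdn_mull. Qed.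

Lemma digit_low c s j : (j < s)%N -> digit m (c * M s) j = 0%N.
Proof.
move=> js; have /dvdnP[d dE] := vilenkin_M_dvd js.
by rewrite /digit dE /= mulnA mulnA mulnK ?vilenkin_M_gt0 // modnMl.
Qed.

(** No carries: c M_s has digits only at positions >= s, and i < M_s only at positions < s. *)
Lemma digit_block c s i j : (i < M s)%N ->
  digit m (c * M s + i) j = (digit m (c * M s) j + digit m i j)%N.
Proof.
move=> iM; have [sj|js] := leqP s j.
  rewrite (digit_large iM sj) addn0 /digit.
  have /dvdnP[d dE] := vilenkin_M_dvd sj.
  rewrite dE [(d * _)%N]mulnC !divnMA divnMDl ?vilenkin_M_gt0 // (divn_small iM) addn0.
  by rewrite mulnK ?vilenkin_M_gt0.
rewrite digit_low // add0n /digit.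
have /dvdnP[d dE] := vilenkin_M_dvd js.
by rewrite dE /= mulnA mulnA divnMDl ?vilenkin_M_gt0 // modnMDl.
Qed.

Lemma psi_block c s i (x : G) : (i < M s)%N ->
  psi (c * M s + i) x = psi (c * M s) x * psi i x.
Proof.
move=> iM; rewrite (psi_extend x (leqnn _)) (psi_extend x (leq_addr i (c * M s))).
rewrite (psi_extend x (leq_addl (c * M s) i)) -big_split; apply: eq_bigr => k _.
by rewrite digit_block // exprD.
Qed.

Lemma psi_coord0 n s (x : G) : (n < M s)%N -> @vilenkin_I m s x -> psi n x = 1.
Proof.
move=> ns xs; rewrite /psi big1 // => k _; have [sk|ks] := leqP s k.
  by rewrite (digit_large ns sk) expr0.
by rewrite rademacher_coord0 ?expr1n // xs.
Qed.

Lemma psi_lead c s (x : G) : (c < m s)%N -> psi (c * M s) x = rademacher R s x ^+ c.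
Proof.
move=> cm; have cM : (c * M s < M s.+1)%N by rewrite /= ltn_pmul2r ?vilenkin_M_gt0.
rewrite (psi_extend x (leq_maxl _ s.+1)).
have sL : (s < maxn (c * M s) s.+1)%N by rewrite leq_max leqnn orbT.
rewrite (bigD1 (Ordinal sL)) //= big1 ?mulr1.
  by rewrite {1}/digit mulnK ?vilenkin_M_gt0 // modn_small.
move=> k; rewrite -val_eqE /= neq_ltn => /orP[ks|sk].
  by rewrite digit_low // expr0.
by rewrite (digit_large cM) // expr0.
Qed.

(** Paley's lemma. The leading digit splits off the sum of r_s^c over c < m_s, which is m_s when x_s
    = 0 and otherwise 0, as a full geometric sum of a nontrivial root of unity. Nonnegativity of
    this kernel is what makes block sums contractions. *)
Lemma dirichlet_kernel s (x : G) : \sum_(0 <= i < M s) psi i x =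
  (if `[< @vilenkin_I m s x >] then (M s)%:R else 0).
Proof.
elim: s => [|s IH].
  by rewrite big_nat1 /psi big_ord0 asboolT.
have -> : \sum_(0 <= i < M s.+1) psi i x =
    (\sum_(0 <= c < m s) rademacher R s x ^+ c) * \sum_(0 <= i < M s) psi i x.
  suff h c : (c <= m s)%N -> \sum_(0 <= i < c * M s) psi i x =
      \sum_(0 <= d < c) (rademacher R s x ^+ d * \sum_(0 <= i < M s) psi i x).
    by rewrite mulr_suml /= h.
  elim: c => [|c IHc] cm; first by rewrite !big_geq.
  rewrite mulSnr (@big_cat_nat _ _ _ (c * M s)) ?leq_addr //= IHc ?(ltnW cm) //.
  rewrite [RHS]big_nat_recr //=; congr (_ + _).
  rewrite sum_nat_shift mulr_sumr; apply: eq_big_nat => i /andP[_ iM].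
  by rewrite psi_block // psi_lead.
rewrite {}IH; have [xs|xs] := asboolP (vilenkin_I s x); last first.
  by rewrite mulr0 asboolF // => xs'; apply: xs => k ks; apply: xs'; exact: ltnW.
have [x0|x0] := eqVneq (x s : 'Z_(m s)) 0.
  rewrite asboolT; last first.
    by move=> k; rewrite ltnS leq_eqVlt => /predU1P[->//|]; exact: xs.
  rewrite rademacher_coord0 // (eq_bigr (fun=> 1)); last by move=> c _; rewrite expr1n.
  by rewrite sumr_const_nat subn0 -natrM.
rewrite asboolF; last by move=> /(_ s (ltnSn s)) xs0; rewrite xs0 eqxx in x0.
set r := rademacher R s x; suff -> : \sum_(0 <= c < m s) r ^+ c = 0 by rewrite mul0r.
have r1 : r - 1 != 0.
  rewrite subr_eq0 /r rademacherE zeta_neq1 // lt0n; apply/andP; split.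
    by apply: contra x0 => /eqP x0; apply/eqP/val_inj.
  by have := ltn_ord (x s : 'Z_(m s)); rewrite [X in (_ < X)%N](Zp_cast (m_ge2 s)).
apply: (mulfI r1); rewrite mulr0 big_mkord -subrX1 /r rademacherE exprAC zeta_unity.
by rewrite expr1n subrr.
Qed.

End vilenkin_characters.

(** * Finite coset representatives *)

Section truncation.
Variables (m : nat -> nat) (K : nat).
Local Notation G := (vilenkin m).

(* Representatives of the cosets of [I_K]: the finite subgroup of the [x] with
   [x k = 0] for [K <= k]. *)
Definition trunc_group : finType := {dffun forall k : 'I_K, 'Z_(m k)}.

Definition trunc_val (h : trunc_group) : G := fun k =>
  if pselect (k < K)%N is left lt then h (Ordinal lt) else 0.

Definition trunc (x : G) : trunc_group := [ffun k : 'I_K => x k : 'Z_(m k)].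

Lemma trunc_val_ge h k : (K <= k)%N -> trunc_val h k = (0 : 'Z_(m k)).
Proof. by move=> Kk; rewrite /trunc_val; case: pselect => // kK; rewrite leqNgt kK in Kk. Qed.

Lemma trunc_valE x k : (k < K)%N -> trunc_val (trunc x) k = x k.
Proof. by move=> kK; rewrite /trunc_val; case: pselect => // lt; rewrite ffunE. Qed.

Lemma trunc_val_id x : (forall k, (K <= k)%N -> x k = (0 : 'Z_(m k))) ->
  trunc_val (trunc x) = x.
Proof.
move=> x0; apply: functional_extensionality_dep => k.
have [Kk|kK] := leqP K k; first by rewrite trunc_val_ge // x0.
exact: trunc_valE.
Qed.

Lemma trunc_valK : cancel trunc_val trunc.
Proof.
move=> h; apply/ffunP => -[k kK]; rewrite ffunE /trunc_val /=.
by case: pselect => // lt; rewrite (bool_irrelevance lt kK).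
Qed.

Lemma trunc_valD h h' : trunc_val (trunc (trunc_val h + trunc_val h')) = trunc_val h + trunc_val h'.
Proof.
apply: trunc_val_id => k Kk.
have -> : (trunc_val h + trunc_val h') k =
  (trunc_val h k : 'Z_(m k)) + (trunc_val h' k : 'Z_(m k)) by [].
by rewrite !trunc_val_ge // addr0.
Qed.

Lemma trunc_valB h h' : trunc_val (trunc (trunc_val h - trunc_val h')) = trunc_val h - trunc_val h'.
Proof.
apply: trunc_val_id => k Kk.
have -> : (trunc_val h - trunc_val h') k =
  (trunc_val h k : 'Z_(m k)) - (trunc_val h' k : 'Z_(m k)) by [].
by rewrite !trunc_val_ge // subr0.
Qed.

Lemma sum_trunc_shift (V : nmodType) (F : G -> V) h0 :
  \sum_h F (trunc_val h + trunc_val h0) = \sum_h F (trunc_val h).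
Proof.
rewrite [RHS](reindex (fun h => trunc (trunc_val h + trunc_val h0))) /=.
  by apply: eq_bigr => h _; rewrite trunc_valD.
exists (fun h => trunc (trunc_val h - trunc_val h0)) => h _.
  by rewrite trunc_valD addrK trunc_valK.
by rewrite trunc_valB subrK trunc_valK.
Qed.

Lemma trunc_coset x h : @vilenkin_I m K (x - trunc_val h) <-> h = trunc x.
Proof.
have xh k : (x - trunc_val h) k = (x k : 'Z_(m k)) - (trunc_val h k : 'Z_(m k)) by [].
split=> [xhK|-> k kK].
  apply/ffunP => k; rewrite ffunE; have := xhK k (ltn_ord k).
  rewrite xh => /subr0_eq ->; rewrite -[in LHS](trunc_valK h).
  by rewrite ffunE.
have -> : (x - trunc_val (trunc x)) k =
  (x k : 'Z_(m k)) - (trunc_val (trunc x) k : 'Z_(m k)) by [].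
by rewrite trunc_valE // subrr.
Qed.

Lemma card_trunc_group_gt0 : (0 < #|trunc_group|)%N.
Proof. by apply/card_gt0P; exists (trunc 0). Qed.

End truncation.

(** * Orthogonality of characters on the finite subgroup *)

Section character_orthogonality.
Variables (R : realType) (m : nat -> nat) (K : nat).
Hypothesis m_ge2 : forall k, (2 <= m k)%N.
Local Notation G := (vilenkin m).
Local Notation M := (vilenkin_M m).
Local Notation psi := (@psi R m).
Local Notation T := (trunc_group m K).

Let unit_at (k : nat) : G := fun l => if l == k then 1 : 'Z_(m l) else 0.

Lemma psi_unit_at n k : psi n (unit_at k) = expi (2 * pi / (m k)%:R) ^+ digit m n k.
Proof.
rewrite (psi_extend _ m_ge2 _ (leq_maxl n k.+1)).
have kL : (k < maxn n k.+1)%N by rewrite leq_max leqnn orbT.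
rewrite (bigD1 (Ordinal kL)) //= big1 ?mulr1.
  by rewrite rademacherE /unit_at eqxx /= expr1.
move=> l; rewrite -val_eqE /= => lk.
by rewrite rademacher_coord0 ?expr1n // /unit_at (negbTE lk).
Qed.

Lemma digit_inj i j : (i < M K)%N -> (j < M K)%N ->
  (forall k, (k < K)%N -> digit m i k = digit m j k) -> i = j.
Proof.
move=> iK jK ij.
have sumE n L : (n <= L)%N -> n = (\sum_(k < L) digit m n k * M k)%N.
  move=> nL; rewrite [LHS](digit_sum m_ge2).
  rewrite -!(big_mkord xpredT (fun k => digit m n k * M k)%N).
  rewrite [RHS](@big_cat_nat _ _ _ n) //= [X in _ = (_ + X)%N]big_nat_cond.
  rewrite [X in _ = (_ + X)%N]big1 ?addn0 // => k /andP[/andP[nk _] _].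
  by rewrite digit_eq0.
apply: etrans (sumE i _ (leq_maxl i j)) (etrans _ (esym (sumE j _ (leq_maxr i j)))).
apply: eq_bigr => k _; congr (_ * _)%N; have [Kk|] := leqP K k; last exact: ij.
by rewrite (digit_large m_ge2 iK Kk) (digit_large m_ge2 jK Kk).
Qed.

(** If i and j differ, some digit below K differs. Translating the sum by the unit vector at that
    position multiplies it by a number other than 1, so it is 0. *)
Lemma sum_psi_trunc i j : (i < M K)%N -> (j < M K)%N ->
  \sum_(h : T) psi i (trunc_val h) * psi j (- trunc_val h) =
  if i == j then #|T|%:R else 0.
Proof.
move=> iK jK; case: eqVneq => [->|ij].
  rewrite (eq_bigr (fun=> 1)) ?sumr_const // => h _.
  by rewrite -psiD // subrr psi_arg0.
have [k kK dij] : exists2 k, (k < K)%N & digit m i k != digit m j k.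
  apply: contrapT => /forall2NP hk; move/eqP: ij; apply.
  apply: (digit_inj iK jK) => k kK; apply/eqP.
  by have [//|/negP/negPn] := hk k.
pose e := trunc K (unit_at k).
have eE : trunc_val e = unit_at k.
  apply: trunc_val_id => l Kl; rewrite /unit_at gtn_eqF //; exact: leq_trans kK Kl.
pose F (x : G) := psi i x * psi j (- x).
set S := \sum_h _; have SE : S = S * F (unit_at k).
  rewrite {1}/S -(@sum_trunc_shift m K _ F e) mulr_suml; apply: eq_bigr => h _.
  by rewrite eE /F opprD !psiD // mulrACA.
have F1 : F (unit_at k) - 1 != 0.
  rewrite subr_eq0 /F psiN //; apply/eqP => h1; move/eqP: dij; apply.
  apply: (@zeta_inj R m m_ge2 k); rewrite ?digit_lt // -!psi_unit_at.
  apply: (mulIf (invr_neq0 (@psi_neq0 R m j (unit_at k)))).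
  by rewrite h1 mulfV ?psi_neq0.
by apply: (mulIf F1); rewrite mulrBr mulr1 -SE subrr mul0r.
Qed.

(** Of the characters that sum to the Dirichlet kernel only psi_0 has a nonzero sum over the
    subgroup. The identity normalizes real weights, so it is real; its proof goes through the
    embedding into the complex numbers. *)
Lemma sum_dirichlet_trunc s : (s <= K)%N ->
  \sum_(h : T) (if `[< @vilenkin_I m s (trunc_val h) >] then (M s)%:R else 0) = #|T|%:R :> R.
Proof.
move=> sK; apply: (@fmorph_inj _ _ (real_complex R)); rewrite rmorph_sum rmorph_nat.
rewrite (eq_bigr (fun h : T => \sum_(0 <= i < M s) psi i (trunc_val h))); last first.
  by move=> h _; rewrite dirichlet_kernel //; case: ifP => _; rewrite ?rmorph0 ?rmorph_nat.
rewrite exchange_big /=.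
have M0 := vilenkin_M_gt0 m_ge2 K.
rewrite (eq_big_nat _ _ (F2 := fun i => if i == 0%N then #|T|%:R else 0)); last first.
  move=> i /andP[_ iM]; rewrite -(sum_psi_trunc (leq_trans iM _) M0) //; last first.
    exact: vilenkin_M_le.
  by apply: eq_bigr => h _; rewrite /Defs.psi big_ord0 mulr1.
rewrite big_ltn ?vilenkin_M_gt0 //= big_nat_cond big1 ?addr0 // => i /andP[/andP[i0 _] _].
by rewrite gtn_eqF.
Qed.

End character_orthogonality.

(** * Fourier projections as averages of translations *)

Section translation_operators.
Variables (R : realType) (m : nat -> nat).
Hypothesis m_ge2 : forall k, (2 <= m k)%N.
Local Notation G := (vilenkin m).
Local Notation M := (vilenkin_M m).
Local Notation psi := (@psi R m).
Variables (V : lmodType R[i]) (N : V -> R).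
Hypothesis N_triangle : forall u v, N (u + v) <= N u + N v.
Hypothesis N_scale : forall c v, N (c *: v) = Normc.normc c * N v.
Variable tau : G -> {linear V -> V}.
Hypothesis tauD : forall g h v, tau (g + h) v = tau g (tau h v).
Hypothesis N_tau : forall g v, N (tau g v) = N v.
Variable K : nat.
Local Notation T := (trunc_group m K).

(** When [tau g] is v -> v(. - g), this is convolution with psi_i over the finite subgroup; the
    shift by -h replaces the conjugation. *)
Definition fourier_proj (i : nat) (v : V) : V :=
  (#|T|%:R)^-1 *: \sum_(h : T) psi i (trunc_val h) *: tau (trunc_val h) v.

Fact fourier_proj_linear i : linear (fourier_proj i).
Proof.
move=> c u v; rewrite /fourier_proj scalerA mulrC -scalerA -scalerDr; congr (_ *: _).
rewrite scaler_sumr -big_split; apply: eq_bigr => h _ /=.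
by rewrite linearP scalerDr scalerA mulrC -scalerA.
Qed.

HB.instance Definition _ i :=
  GRing.isLinear.Build _ _ _ _ (fourier_proj i) (fourier_proj_linear i).

Let card_neq0 : #|T|%:R != 0 :> R[i].
Proof. by rewrite pnatr_eq0 -lt0n card_trunc_group_gt0. Qed.

(** Up to normalization, the coefficient of [tau g] in P_i P_j is the sum over h of psi_i(h) psi_j(g
    - h), that is psi_j(g) times an orthogonality sum. *)
Lemma fourier_proj_ortho i j v : (i < M K)%N -> (j < M K)%N ->
  fourier_proj i (fourier_proj j v) = if i == j then fourier_proj i v else 0.
Proof.
move=> iK jK; rewrite {1 2}/fourier_proj.
pose F (h g : G) := (psi i h * psi j (g - h)) *: tau g v.
have -> : \sum_(h : T) psi i (trunc_val h) *: tau (trunc_val h)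
     (#|T|%:R^-1 *: \sum_(h' : T) psi j (trunc_val h') *: tau (trunc_val h') v) =
   #|T|%:R^-1 *: \sum_(h : T) \sum_(h' : T) F (trunc_val h) (trunc_val h').
  rewrite [RHS]scaler_sumr; apply: eq_bigr => h _.
  rewrite linearZ /= scalerA mulrC -scalerA; congr (_ *: _).
  rewrite linear_sum scaler_sumr /= -[RHS](@sum_trunc_shift m K _ (F (trunc_val h)) h).
  apply: eq_bigr => h' _; rewrite /F addrK linearZ /= scalerA; congr (_ *: _).
  by rewrite [_ + trunc_val h]addrC tauD.
rewrite exchange_big /=.
have -> : \sum_(h' : T) \sum_(h : T) F (trunc_val h) (trunc_val h') =
    (if i == j then #|T|%:R else 0) *: \sum_(h' : T) psi j (trunc_val h') *: tau (trunc_val h') v.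
  rewrite scaler_sumr; apply: eq_bigr => h' _; rewrite -scaler_suml scalerA.
  congr (_ *: _); rewrite -(sum_psi_trunc R m_ge2 iK jK) mulr_suml.
  by apply: eq_bigr => h _; rewrite psiD // mulrAC mulrA.
case: eqVneq => [->|_]; last by rewrite scale0r !scaler0.
by rewrite /fourier_proj !scalerA -mulrA mulVf // mulr1.
Qed.

Let dir s (h : T) : R := if `[< @vilenkin_I m s (trunc_val h) >] then (M s)%:R else 0.

Let dir_ge0 s h : 0 <= dir s h. Proof. by rewrite /dir; case: ifP. Qed.

Let sum_dir s (h : T) : \sum_(0 <= i < M s) psi i (trunc_val h) = (dir s h)%:C%C.
Proof. by rewrite dirichlet_kernel // /dir; case: ifP => _; rewrite ?rmorph0 ?rmorph_nat. Qed.

Let block_sumE s c v : \sum_(c * M s <= i < c * M s + M s) fourier_proj i v =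
  (#|T|%:R)^-1 *: \sum_(h : T) (psi (c * M s) (trunc_val h) * (dir s h)%:C%C) *:
     tau (trunc_val h) v.
Proof.
rewrite sum_nat_shift -scaler_sumr; congr (_ *: _); rewrite exchange_big /=.
apply: eq_bigr => h _; rewrite -sum_dir mulr_sumr scaler_suml.
by apply: eq_big_nat => i /andP[_ iM]; rewrite psi_block.
Qed.

Let scale_card (S : V) : N ((#|T|%:R)^-1 *: S) = (#|T|%:R)^-1 * N S.
Proof.
have -> : (#|T|%:R)^-1 = ((#|T|%:R)^-1)%:C%C :> R[i] by rewrite fmorphV rmorph_nat.
by rewrite (seminorm_real N_scale) ger0_norm // invr_ge0.
Qed.

Let card_gt0 : 0 < #|T|%:R :> R. Proof. by rewrite ltr0n card_trunc_group_gt0. Qed.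

(** Shifting the indices by c M_s only multiplies the kernel by the unimodular psi_(c M_s); the
    Dirichlet kernel that remains is nonnegative with mean 1. *)
Lemma fourier_proj_block s c v : (c * M s + M s <= M K)%N ->
  N (\sum_(c * M s <= i < c * M s + M s) fourier_proj i v) <= N v.
Proof.
move=> hK; have sK : (s <= K)%N.
  rewrite leqNgt; apply/negP => Ks; have := vilenkin_M_le m_ge2 Ks.
  have /= := leq_mul (m_ge2 K) (leqnn (M K)); have := vilenkin_M_gt0 m_ge2 K.
  move: hK; lia.
rewrite block_sumE scale_card ler_pdivrMl //.
apply: (le_trans (seminorm_sum N_triangle N_scale _ _ _)).
rewrite -(sum_dirichlet_trunc R m_ge2 sK) mulr_suml ler_sum // => h _.
by rewrite N_scale Normc.normcM normc_psi mul1r N_tau /= expr0n addr0 sqrtr_sqr ger0_norm ?dir_ge0.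
Qed.

(** E_s v is the average of [tau g v] over the g of the subgroup that lie in I_s, so v - E_s v is an
    average of differences v - tau_g v. *)
Lemma fourier_proj_approx s b v : (s <= K)%N ->
  (forall g, @vilenkin_I m s g -> N (tau g v - v) <= b) ->
  N (v - partial_sum m fourier_proj s v) <= b.
Proof.
move=> sK hb; have e1 := sum_dirichlet_trunc R m_ge2 sK.
have := block_sumE s 0 v; rewrite mul0n add0n /partial_sum => ->.
have -> : v - #|T|%:R^-1 *: \sum_(h : T) (psi 0 (trunc_val h) * (dir s h)%:C%C) *:
   tau (trunc_val h) v =
   #|T|%:R^-1 *: \sum_(h : T) (dir s h)%:C%C *: (v - tau (trunc_val h) v).
  have {1}-> : v = #|T|%:R^-1 *: ((\sum_(h : T) dir s h)%:C%C *: v).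
    by rewrite e1 rmorph_nat scalerA mulVf // scale1r.
  rewrite -scalerBr rmorph_sum scaler_suml -sumrB; congr (_ *: _).
  by apply: eq_bigr => h _; rewrite scalerBr /Defs.psi big_ord0 mul1r.
rewrite scale_card ler_pdivrMl // -e1 mulr_suml.
apply: (le_trans (seminorm_sum N_triangle N_scale _ _ _)); apply: ler_sum => h _.
rewrite (seminorm_real N_scale) ger0_norm ?dir_ge0 // /dir; case: asboolP => [hs|_].
  rewrite ler_wpM2l // -opprB (seminormN N_scale); exact: hb.
by rewrite !mul0r.
Qed.

End translation_operators.

(** * Two commuting translation actions *)

Section two_variables.
Variables (R : realType) (m : nat -> nat) (B : nat).
Hypotheses (m_ge2 : forall k, (2 <= m k)%N) (m_le : forall k, (m k <= B)%N).
Local Notation G := (vilenkin m).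
Local Notation M := (vilenkin_M m).
Variables (V : lmodType R[i]) (N : V -> R).
Hypothesis N_triangle : forall u v, N (u + v) <= N u + N v.
Hypothesis N_scale : forall c v, N (c *: v) = Normc.normc c * N v.
Variables tau1 tau2 : G -> {linear V -> V}.
Hypothesis tau1D : forall g h v, tau1 (g + h) v = tau1 g (tau1 h v).
Hypothesis tau2D : forall g h v, tau2 (g + h) v = tau2 g (tau2 h v).
Hypothesis N_tau1 : forall g v, N (tau1 g v) = N v.
Hypothesis N_tau2 : forall g v, N (tau2 g v) = N v.
Hypothesis tau12 : forall g h v, tau1 g (tau2 h v) = tau2 h (tau1 g v).
Variable K : nat.
Local Notation P1 := (fourier_proj tau1 K).
Local Notation P2 := (fourier_proj tau2 K).

Lemma tau1_proj2 i g v : tau1 g (P2 i v) = P2 i (tau1 g v).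
Proof.
rewrite /fourier_proj linearZ /= linear_sum; congr (_ *: _).
by apply: eq_bigr => h _; rewrite linearZ /= tau12.
Qed.

Lemma proj1_proj2 i j v : P1 i (P2 j v) = P2 j (P1 i v).
Proof.
have E w : P1 i w = (#|trunc_group m K|%:R)^-1 *:
    \sum_(h : trunc_group m K) @psi R m i (trunc_val h) *: tau1 (trunc_val h) w by [].
rewrite (E (P2 j v)) (E v) linearZ /= [in RHS]linear_sum; congr (_ *: _).
by apply: eq_bigr => h _; rewrite [LHS]/( _ *: tau1 _ (P2 _ _)) tau1_proj2 [RHS]linearZ.
Qed.

Local Notation E1 := (partial_sum m P1).
Local Notation E2 := (partial_sum m P2).

Variables (a b : R) (q c q' c' : R) (n l k k' : nat).
Hypotheses (a01 : 0 < a < 1) (b01 : 0 < b < 1).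
Hypotheses (q01 : 0 < q < 1) (q01' : 0 < q' < 1) (c0 : 0 < c) (c0' : 0 < c').
Hypothesis hq : forall s, ((M s)%:R `^ a)^-1 <= q ^+ s * q ^+ s.
Hypothesis hq' : forall s, ((M s)%:R `^ b)^-1 <= q' ^+ s * q' ^+ s.
Hypothesis hc : forall s, s.+1%:R <= c * (M s)%:R `^ a.
Hypothesis hc' : forall s, s.+1%:R <= c' * (M s)%:R `^ b.
Hypotheses (nk : (M k.+1 <= n < M k.+2)%N) (lk : (M k'.+1 <= l < M k'.+2)%N).
Hypotheses (nK : (n < M K)%N) (lK : (l < M K)%N).

Local Notation S1 := (cesaro_sum P1 a n).
Local Notation S2 := (cesaro_sum P2 b l).
Local Notation C1 := (cesaro_const B a q c).
Local Notation C2 := (cesaro_const B b q' c').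

Let error1 v := cesaro_error_le m_ge2 m_le N_triangle N_scale
  (@fourier_proj_ortho R m m_ge2 V tau1 tau1D K)
  (@fourier_proj_block R m m_ge2 V N N_triangle N_scale tau1 N_tau1 K)
  a01 v q01 hq c0 hc nk nK.

Let error2 v := cesaro_error_le m_ge2 m_le N_triangle N_scale
  (@fourier_proj_ortho R m m_ge2 V tau2 tau2D K)
  (@fourier_proj_block R m m_ge2 V N N_triangle N_scale tau2 N_tau2 K)
  b01 v q01' hq' c0' hc' lk lK.

Let level_lt s j t r : (M s.+1 <= r)%N -> (r < M t)%N -> (j < s.+1)%N -> (j <= t)%N.
Proof.
move=> sr rt js; rewrite leqNgt; apply/negP => tj.
have := vilenkin_M_le m_ge2 (leq_trans (ltnW tj) (ltnW js)).
by move=> h; have := leq_trans (leq_trans rt h) sr; rewrite ltnn.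
Qed.

Lemma cesaro_const_ge0 (a' q1 c1 : R) : 0 < a' < 1 -> 0 < c1 -> 0 <= cesaro_const B a' q1 c1.
Proof.
case/andP=> a0 a1 c10; rewrite /cesaro_const !addr_ge0 //.
  rewrite mulr_ge0 //; first by rewrite addr_ge0 // mulr_ge0 ?sqr_ge0 // !mulr_ge0.
  by rewrite mulr_ge0 ?powR_ge0 // invr_ge0 subr_ge0 ltW.
by rewrite !mulr_ge0 // ?invr_ge0 ?subr_ge0 ltW.
Qed.

Fact cesaro_sum_linear (P : nat -> {linear V -> V}) a' n' : linear (cesaro_sum P a' n').
Proof.
move=> x u v; rewrite /cesaro_sum scaler_sumr -big_split /=; apply: eq_bigr => i _.
by rewrite linearP scalerDr !scalerA mulrC.
Qed.

(** The cross term uses the one-variable bound twice. Since S2 commutes with E1, the vector (1 -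
    E1_j)(S2 v - v) is the S2-error of w = v - E1_j v; the second bound leads to w - E2_i w, which
    mixed differences control. The majorants [e1], [e2], [e12] are arbitrary so that real numbers
    can stand for extended-real moduli. *)
Lemma double_cesaro_error_le (e1 e2 : nat -> R) (e12 : nat -> nat -> R) v :
  (forall j g, @vilenkin_I m j g -> N (tau1 g v - v) <= e1 j) ->
  (forall i h, @vilenkin_I m i h -> N (tau2 h v - v) <= e2 i) ->
  (forall j i g h, @vilenkin_I m j g -> @vilenkin_I m i h ->
    N (tau1 g (tau2 h v - v) - (tau2 h v - v)) <= e12 j i) ->
  N (S1 (S2 v) - v) <=
    C1 * (\sum_(0 <= j < k.+1) 2^-1 ^+ (k - j) * ((M j)%:R `^ a * e1 j)) +
    C2 * (\sum_(0 <= i < k'.+1) 2^-1 ^+ (k' - i) * ((M i)%:R `^ b * e2 i)) +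
    C1 * C2 * (\sum_(0 <= j < k.+1) \sum_(0 <= i < k'.+1)
      2^-1 ^+ (k - j) * 2^-1 ^+ (k' - i) * ((M j)%:R `^ a * (M i)%:R `^ b * e12 j i)).
Proof.
move=> he1 he2 he12.
have C10 := cesaro_const_ge0 q a01 c0; have C20 := cesaro_const_ge0 q' b01 c0'.
have jK j : (j < k.+1)%N -> (j <= K)%N.
  by case/andP: nk => nk' _; exact: level_lt nk' nK.
have iK i : (i < k'.+1)%N -> (i <= K)%N.
  by case/andP: lk => lk' _; exact: level_lt lk' lK.
have approx1 j w x : (j < k.+1)%N ->
    (forall g, @vilenkin_I m j g -> N (tau1 g w - w) <= x) -> N (w - E1 j w) <= x.
  by move=> jk; apply: fourier_proj_approx => //; exact: jK.
have approx2 i w x : (i < k'.+1)%N ->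
    (forall g, @vilenkin_I m i g -> N (tau2 g w - w) <= x) -> N (w - E2 i w) <= x.
  by move=> ik; apply: fourier_proj_approx => //; exact: iK.
have c_ge0 r j : 0 <= 2^-1 ^+ (r - j) :> R by rewrite exprn_ge0.
have Q1 : N (S1 v - v) <=
    C1 * (\sum_(0 <= j < k.+1) 2^-1 ^+ (k - j) * ((M j)%:R `^ a * e1 j)).
  apply: (le_trans (error1 v)); rewrite ler_wpM2l // ler_sum_nat // => j /andP[_ jk].
  by rewrite !ler_wpM2l ?powR_ge0 // approx1 // => g; exact: he1.
have Q2 w (e : nat -> R) :
    (forall i, (i < k'.+1)%N -> N (w - E2 i w) <= e i) -> N (S2 w - w) <=
    C2 * (\sum_(0 <= i < k'.+1) 2^-1 ^+ (k' - i) * ((M i)%:R `^ b * e i)).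
  move=> he; apply: (le_trans (error2 w)); rewrite ler_wpM2l // ler_sum_nat // => i /andP[_ ik].
  by rewrite !ler_wpM2l ?powR_ge0 // he.
have tau1B g x y : tau1 g (x - y) = tau1 g x - tau1 g y by rewrite linearB.
have E1B j x y : E1 j (x - y) = E1 j x - E1 j y.
  by rewrite /partial_sum -sumrB; apply: eq_bigr => i _; rewrite linearB.
have S2E1 j x : S2 (E1 j x) = E1 j (S2 x).
  rewrite /cesaro_sum /partial_sum.
  under eq_bigr => i _ do rewrite linear_sum scaler_sumr.
  rewrite exchange_big /=; apply: eq_bigr => r _.
  by rewrite [RHS]linear_sum; apply: eq_bigr => i _; rewrite -proj1_proj2 [RHS]linearZ.
have tau2E1 g j x : tau2 g (E1 j x) = E1 j (tau2 g x).
  rewrite /partial_sum linear_sum; apply: eq_bigr => r _.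
  rewrite /fourier_proj linearZ /= linear_sum; congr (_ *: _).
  by apply: eq_bigr => h _; rewrite linearZ /= -tau12.
have S2B x y : S2 (x - y) = S2 x - S2 y.
  have -> : x - y = -1 *: y + x by rewrite scaleN1r addrC.
  by rewrite cesaro_sum_linear scaleN1r addrC.
have Q12 : N (S1 (S2 v - v) - (S2 v - v)) <=
   C1 * C2 * (\sum_(0 <= j < k.+1) \sum_(0 <= i < k'.+1)
      2^-1 ^+ (k - j) * 2^-1 ^+ (k' - i) * ((M j)%:R `^ a * (M i)%:R `^ b * e12 j i)).
  apply: (le_trans (error1 _)); rewrite -mulrA ler_wpM2l //.
  rewrite mulr_sumr ler_sum_nat // => j /andP[_ jk].
  have -> : S2 v - v - E1 j (S2 v - v) = S2 (v - E1 j v) - (v - E1 j v).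
    by rewrite E1B S2B S2E1 !opprB addrACA [in RHS]addrACA [- _ + _]addrC.
  rewrite mulrA; set w := v - E1 j v.
  have -> : C2 * \sum_(0 <= i < k'.+1) 2^-1 ^+ (k - j) * 2^-1 ^+ (k' - i) *
        ((M j)%:R `^ a * (M i)%:R `^ b * e12 j i) =
     2^-1 ^+ (k - j) * (M j)%:R `^ a *
       (C2 * (\sum_(0 <= i < k'.+1) 2^-1 ^+ (k' - i) * ((M i)%:R `^ b * e12 j i))).
    rewrite !mulr_sumr; apply: eq_bigr => i _.
    set x := _ ^+ (k - j); set y := _ ^+ (k' - i); set z := _ `^ a; set t := _ `^ b.
    ring.
  rewrite ler_wpM2l ?mulr_ge0 ?powR_ge0 //; apply: Q2 => i ik.
  apply: approx2 => // h hi.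
  have -> : tau2 h w - w = (tau2 h v - v) - E1 j (tau2 h v - v).
    rewrite /w linearB /= tau2E1 E1B !opprB addrACA [in RHS]addrACA.
    by rewrite [- _ + _]addrC.
  by apply: approx1 => // g gj; apply: he12.
have -> : S1 (S2 v) - v = (S1 v - v) + (S2 v - v) + (S1 (S2 v - v) - (S2 v - v)).
  have -> : S1 (S2 v - v) = S1 (S2 v) - S1 v.
    have -> : S2 v - v = -1 *: v + S2 v by rewrite scaleN1r addrC.
    by rewrite cesaro_sum_linear scaleN1r addrC.
  by rewrite addrACA subrr addr0 addrC addrA subrK.
apply: (le_trans (N_triangle _ _)); apply: lerD => //.
apply: (le_trans (N_triangle _ _)); apply: lerD => //.
by apply: Q2 => i ik; apply: approx2 => // h; exact: he2.
Qed.

End two_variables.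

(** * Sums of the weights 2^(j-k) *)

Section toeplitz.
Variable R : realType.

Lemma sum_half_le k : \sum_(0 <= j < k.+1) 2^-1 ^+ (k - j) <= 2 :> R.
Proof.
rewrite big_nat_rev /= (eq_big_nat _ _ (F2 := fun j => 2^-1 ^+ j)); last first.
  by move=> j /andP[_ jk]; congr (_ ^+ _); lia.
have h : 0 < (2^-1 : R) < 1 by apply/andP; split; lra.
apply: (le_trans (sum_exp_le k.+1 h)).
have -> : 1 - 2^-1 = 2^-1 :> R by lra.
by rewrite invrK.
Qed.

(** The first J weights together are of order 2^(J-k), so they vanish as k grows: the regularity
    condition of the Toeplitz argument. For k < J the right side is at least 2, the bound on all
    weights. *)
Lemma sum_half_head_le k J :
  \sum_(0 <= j < k.+1) 2^-1 ^+ (k - j) * (j < J)%N%:R <= 2 * 2^-1 ^+ k * 2 ^+ J :> R.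
Proof.
have h0 i : 0 <= 2^-1 ^+ i :> R by rewrite exprn_ge0.
have [kJ|Jk] := ltnP k J.
  apply: (@le_trans _ _ 2).
    apply: le_trans (sum_half_le k); apply: ler_sum => j _.
    by case: (j < J)%N; rewrite ?mulr1 ?mulr0.
  rewrite -mulrA ler_peMr // -(subnK (ltnW kJ)) exprD mulrCA exprVn mulVf ?mulr1.
    by rewrite exprn_ege1 // ler1n.
  by rewrite expf_neq0 // pnatr_eq0.
rewrite (@big_cat_nat _ _ _ J) //=; last exact: leqW.
rewrite [X in _ + X]big_nat_cond [X in _ + X]big1 ?addr0; last first.
  by move=> j /andP[/andP[Jj _] _]; rewrite ltnNge Jj mulr0.
case: J Jk => [|J] Jk; first by rewrite big_geq // mulr_ge0 // mulr_ge0.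
apply: (@le_trans _ _ (2^-1 ^+ (k - J) * \sum_(0 <= j < J.+1) 2^-1 ^+ (J - j))).
  rewrite mulr_sumr; apply: ler_sum_nat => j /andP[_ jJ].
  by rewrite jJ mulr1 -exprD addnBA // subnK // ltnW.
apply: (le_trans (ler_wpM2l (h0 _) (sum_half_le J))).
have -> : 2^-1 ^+ (k - J) = 2^-1 ^+ k * 2 ^+ J :> R.
  rewrite -[in RHS](subnK (ltnW Jk)) exprD -mulrA -exprMn mulVf ?pnatr_eq0 //.
  by rewrite expr1n mulr1.
rewrite mulrC -mulrA ler_wpM2l // ler_wpM2l // exprS ler_peMl ?exprn_ge0 //.
by rewrite ler1n.
Qed.

End toeplitz.

(** * Measurability for the product sigma-algebra *)

Section vilenkin_measurability.
Variables (m : nat -> nat).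
Local Notation G := (vilenkin m).

Lemma nbhs_vilenkin_coord (x : G) k : nbhs x [set y : G | y k = x k].
Proof.
pose T k : topologicalType := discrete_topology 'Z_(m k).
have := @proj_continuous nat T k x _ (discrete_set1 (x k : T k)).
by [].
Qed.

Lemma nbhs_vilenkin_trunc n (x : G) : nbhs x [set y : G | trunc n y = trunc n x].
Proof.
have h : nbhs x [set y : G | forall k, (k < n)%N -> y k = x k].
  elim: n => [|n IH]; first by apply: filterS filterT => y _ k.
  apply: filterS2 IH (nbhs_vilenkin_coord x n) => y yn yx k.
  by rewrite ltnS leq_eqVlt => /predU1P[->|/yn].
by apply: filterS h => y hy; apply/ffunP => k; rewrite !ffunE hy.
Qed.

Lemma trunc_nth n (x y : G) k : (k < n)%N -> trunc n x = trunc n y -> x k = y k.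
Proof.
by move=> kn xy; have /ffunP/(_ (Ordinal kn)) := xy; rewrite !ffunE.
Qed.

Lemma cvg_vilenkin (u : nat -> G) (x : G) :
  (forall n, trunc n (u n) = trunc n x) -> u n @[n --> \oo] --> x.
Proof.
move=> ux; apply/cvg_sup => k U [V] [[W] oW <-] /= Wx WU.
exists k.+1 => // n /= kn; apply: WU => /=.
by rewrite (trunc_nth kn (ux n)).
Qed.

(** Cylinders form a neighbourhood base: otherwise some sequence outside A agrees with x on ever
    more coordinates, hence converges to x. *)
Lemma open_vilenkin_trunc (A : set G) x : open A -> A x ->
  exists n, forall y, trunc n y = trunc n x -> A y.
Proof.
move=> oA Ax; apply: contrapT => /forallNP h.
have h' n : exists y, trunc n y = trunc n x /\ ~ A y.
  by have /existsNP[y /not_implyP yP] := h n; exists y.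
pose u n := projT1 (cid (h' n)).
have uP n : trunc n (u n) = trunc n x /\ ~ A (u n) := projT2 (cid (h' n)).
have /cvg_vilenkin ux : forall n, trunc n (u n) = trunc n x by move=> n; case: (uP n).
have [n _ /(_ n (leqnn _)) /=] := ux A (open_nbhs_nbhs (conj oA Ax)).
by case: (uP n).
Qed.

Lemma measurable_trunc_fiber n (h : trunc_group m n) : measurable [set x : G | trunc n x = h].
Proof.
apply: sub_sigma_algebra; rewrite openE => x <-.
exact: nbhs_vilenkin_trunc.
Qed.

(** There are finitely many cylinders at level n, so a set saturated at level n is a finite union of
    measurable rectangles. *)
Lemma measurable_trunc_saturated n (S : set (G * G)) :
  (forall z w, trunc n z.1 = trunc n w.1 -> trunc n z.2 = trunc n w.2 -> S z -> S w) ->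
  measurable S.
Proof.
move=> hS.
have -> : S = \bigcup_(hh in [set hh : trunc_group m n * trunc_group m n |
      S (trunc_val hh.1, trunc_val hh.2)])
   ([set x : G | trunc n x = hh.1] `*` [set x : G | trunc n x = hh.2]).
  apply/seteqP; split=> [[x y] Sxy|[x y] [[h h'] /= Sh [/= xh yh]]].
    exists (trunc n x, trunc n y) => //=.
    by apply: (hS (x, y)) => //=; rewrite trunc_valK.
  by apply: hS Sh => /=; rewrite trunc_valK.
apply: fin_bigcup_measurable => [|hh _]; first exact: finite_finset.
by apply: measurableX; exact: measurable_trunc_fiber.
Qed.

Lemma measurable_fun_trunc_saturated d (T : measurableType d) n (f : G * G -> T) :
  (forall z w, trunc n z.1 = trunc n w.1 -> trunc n z.2 = trunc n w.2 -> f z = f w) ->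
  measurable_fun setT f.
Proof.
move=> hf _ Y mY; rewrite setTI; apply: (@measurable_trunc_saturated n) => z w h1 h2 /=.
by rewrite (hf z w h1 h2).
Qed.

Lemma truncD n (x x' y y' : G) : trunc n x = trunc n x' -> trunc n y = trunc n y' ->
  trunc n (x + y) = trunc n (x' + y').
Proof.
move=> hx hy; apply/ffunP => k; rewrite !ffunE.
have -> : (x + y) k = (x k : 'Z_(m k)) + (y k : 'Z_(m k)) by [].
have -> : (x' + y') k = (x' k : 'Z_(m k)) + (y' k : 'Z_(m k)) by [].
by rewrite (trunc_nth (ltn_ord k) hx) (trunc_nth (ltn_ord k) hy).
Qed.

Lemma truncN n (x x' : G) : trunc n x = trunc n x' -> trunc n (- x) = trunc n (- x').
Proof.
move=> hx; apply/ffunP => k; rewrite !ffunE.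
have -> : (- x) k = - (x k : 'Z_(m k)) by [].
have -> : (- x') k = - (x' k : 'Z_(m k)) by [].
by rewrite (trunc_nth (ltn_ord k) hx).
Qed.

(** The source carries the product sigma-algebra, so the preimage of an open A is written as the
    countable union of the sets where the whole level-n cylinder around z.1 + z.2 lies in A; each is
    saturated at level n. *)
Lemma measurable_vilenkin_add : measurable_fun setT (fun z : G * G => z.1 + z.2).
Proof.
apply: (@measurability _ _ _ _ setT _ (@open G)) => // _ [A oA <-].
rewrite setTI.
have -> : (fun z : G * G => z.1 + z.2) @^-1` A = \bigcup_n
    [set z : G * G | forall y, trunc n y = trunc n (z.1 + z.2) -> A y].
  apply/seteqP; split=> [z /= Az|z [n _ /= h]]; last exact: h.
  by have [n hn] := open_vilenkin_trunc oA Az; exists n.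
apply: bigcupT_measurable => n; apply: (@measurable_trunc_saturated n) => z w h1 h2 /= h y.
by move=> yw; apply: h; rewrite yw; exact: truncD.
Qed.

Lemma measurable_prod_add : measurable_fun setT
  (fun zw : (G * G) * (G * G) => zw.1 + zw.2).
Proof.
apply: (measurable_fun_pair
  (f := fun zw : (G * G) * (G * G) => zw.1.1 + zw.2.1)
  (g := fun zw : (G * G) * (G * G) => zw.1.2 + zw.2.2)).
  apply: (measurableT_comp measurable_vilenkin_add
     (g := fun zw : (G * G) * (G * G) => (zw.1.1, zw.2.1))).
  by apply: measurable_fun_pair; apply: measurableT_comp.
apply: (measurableT_comp measurable_vilenkin_add
   (g := fun zw : (G * G) * (G * G) => (zw.1.2, zw.2.2))).
by apply: measurable_fun_pair; apply: measurableT_comp.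
Qed.

Lemma measurable_shift (a : G * G) : measurable_fun setT (fun z : G * G => z + a).
Proof.
apply: (measurableT_comp measurable_prod_add (g := fun z : G * G => (z, a))).
exact: measurable_fun_pair.
Qed.

End vilenkin_measurability.

Lemma le_poweR (R : realType) (r : R) (x y : \bar R) : 0 <= r ->
  (0 <= x)%E -> (x <= y)%E -> (x `^ r <= y `^ r)%E.
Proof.
move=> r0 x0 xy; apply: (gt0_ler_poweR r0) => //; rewrite in_itv /= leey andbT //.
exact: le_trans xy.
Qed.

(** * L^p norms of complex functions and their invariance *)

Section Lp_norms.
Variables (R : realType) (m : nat -> nat).
Local Notation G := (vilenkin m).
Local Notation normc := (@Normc.normc R).
Implicit Types (f g : G * G -> R[i]) (p : \bar R).

Lemma normc_ge0 (c : R[i]) : 0 <= normc c.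
Proof. by case: c => a b /=; exact: sqrtr_ge0. Qed.

Lemma normc_triangle (c d : R[i]) : normc (c + d) <= normc c + normc d.
Proof. exact: le_normcD. Qed.

Lemma normr_Re_le (c : R[i]) : `|complex.Re c| <= normc c.
Proof. by case: c => a b /=; rewrite -sqrtr_sqr ler_wsqrtr // lerDl sqr_ge0. Qed.

Lemma normr_Im_le (c : R[i]) : `|complex.Im c| <= normc c.
Proof. by case: c => a b /=; rewrite -sqrtr_sqr ler_wsqrtr // lerDr sqr_ge0. Qed.

Definition cmeasurable f :=
  measurable_fun setT (fun z => complex.Re (f z)) /\
  measurable_fun setT (fun z => complex.Im (f z)).

Lemma cmeasurableD f g : cmeasurable f -> cmeasurable g -> cmeasurable (fun z => f z + g z).
Proof.
move=> [f1 f2] [g1 g2]; split.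
  rewrite (_ : (fun _ => _) = (fun z => complex.Re (f z) + complex.Re (g z))); last first.
    by apply/funext => z; rewrite raddfD.
  exact: measurable_funD.
rewrite (_ : (fun _ => _) = (fun z => complex.Im (f z) + complex.Im (g z))); last first.
  by apply/funext => z; rewrite raddfD.
exact: measurable_funD.
Qed.

Lemma cmeasurableM f g : cmeasurable f -> cmeasurable g -> cmeasurable (fun z => f z * g z).
Proof.
move=> [f1 f2] [g1 g2]; split.
  rewrite (_ : (fun _ => _) = (fun z => complex.Re (f z) * complex.Re (g z) -
      complex.Im (f z) * complex.Im (g z))); last first.
    by apply/funext => z; case: (f z) (g z) => a b [].
  by apply: measurable_funB; exact: measurable_funM.
rewrite (_ : (fun _ => _) = (fun z => complex.Re (f z) * complex.Im (g z) +
    complex.Im (f z) * complex.Re (g z))); last first.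
  by apply/funext => z; case: (f z) (g z) => a b [].
by apply: measurable_funD; exact: measurable_funM.
Qed.

Lemma cmeasurable_cst (c : R[i]) : cmeasurable (fun=> c).
Proof. by split; exact: measurable_cst. Qed.

Lemma cmeasurable_shift f a : cmeasurable f -> cmeasurable (fun z => f (z + a)).
Proof.
by move=> [f1 f2]; split; [apply: (measurableT_comp f1)|apply: (measurableT_comp f2)];
  exact: measurable_shift.
Qed.

Lemma measurable_normc f : cmeasurable f -> measurable_fun setT (fun z => normc (f z)).
Proof.
move=> [f1 f2].
rewrite (_ : (fun _ => _) = (fun z => (complex.Re (f z) ^+ 2 + complex.Im (f z) ^+ 2) `^ 2^-1)).
  apply: (measurableT_comp (@measurable_powR R _)).
  by apply: measurable_funD; exact: measurable_funX.
apply/funext => z; rewrite powR12_sqrt ?addr_ge0 ?sqr_ge0 //.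
by case: (f z).
Qed.

Variable mu : probability (G * G)%type R.

Lemma Lp_norm_finE (r : R) f :
  Lp_norm mu r%:E f = ((\int[mu]_z (normc (f z) `^ r)%:E) `^ r^-1)%E.
Proof.
rewrite /Lp_norm unlock; apply: (congr1 (fun x => poweR x r^-1)).
apply: eq_integral => z _.
by rewrite /abse ger0_norm ?normc_ge0 // poweR_EFin.
Qed.

Lemma Lp_norm_ge0 p f : (0 <= Lp_norm mu p f)%E.
Proof.
rewrite /Lp_norm; case: ifP => _; last exact: Lnorm_ge0.
apply: (@le_trans _ _ (normc (f 0))%:E); first by rewrite lee_fin normc_ge0.
by apply: ereal_sup_ubound; exists 0.
Qed.

Lemma omega1_ge0 p f j : (0 <= omega1 mu p f j)%E.
Proof.
apply: (@le_trans _ _ (Lp_norm mu p (fun z => f (z.1 - 0, z.2) - f z))).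
  exact: Lp_norm_ge0.
by apply: ereal_sup_ubound; exists 0.
Qed.

Lemma omega2_ge0 p f j : (0 <= omega2 mu p f j)%E.
Proof.
apply: (@le_trans _ _ (Lp_norm mu p (fun z => f (z.1, z.2 - 0) - f z))).
  exact: Lp_norm_ge0.
by apply: ereal_sup_ubound; exists 0.
Qed.

Lemma omega12_ge0 p f j i : (0 <= omega12 mu p f j i)%E.
Proof.
apply: (@le_trans _ _ (Lp_norm mu p (fun z => f (z.1 - 0, z.2 - 0)
   - f (z.1 - 0, z.2) - f (z.1, z.2 - 0) + f z))).
  exact: Lp_norm_ge0.
by apply: ereal_sup_ubound; exists (0, 0).
Qed.

Lemma measurable_normc_powR f (r : R) : cmeasurable f ->
  measurable_fun setT (fun z => (normc (f z) `^ r)%:E).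
Proof.
move=> mf; apply/measurable_EFinP.
by apply: (measurableT_comp (@measurable_powR R _)); exact: measurable_normc.
Qed.

Lemma le_Lp_norm p f g : (1%:E <= p)%E -> cmeasurable f -> cmeasurable g ->
  (forall z, normc (f z) <= normc (g z)) -> (Lp_norm mu p f <= Lp_norm mu p g)%E.
Proof.
case: p => [r| |] // p1 mf mg fg.
  rewrite !Lp_norm_finE; rewrite lee_fin in p1; have r0 : 0 <= r by apply: le_trans p1.
  have r0' : 0 <= r^-1 by rewrite invr_ge0.
  apply: (le_poweR r0'); first by apply: integral_ge0 => z _; rewrite lee_fin powR_ge0.
  apply: ge0_le_integral => //.
  - by move=> z _; rewrite lee_fin powR_ge0.
  - exact: measurable_normc_powR.
  - exact: measurable_normc_powR.
  by move=> z _; rewrite lee_fin ge0_ler_powR // nnegrE normc_ge0.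
rewrite /Lp_norm eqxx; apply: ge_ereal_sup => _ [z _ <-].
apply: (@le_trans _ _ (normc (g z))%:E); first by rewrite lee_fin.
by apply: ereal_sup_ubound; exists z.
Qed.

Lemma Lp_normD p f g : (1%:E <= p)%E -> cmeasurable f -> cmeasurable g ->
  (Lp_norm mu p (fun z => (f z + g z)%R) <= Lp_norm mu p f + Lp_norm mu p g)%E.
Proof.
case: p => [r| |] // p1 mf mg.
  rewrite lee_fin in p1; have r0 : 0 <= r by apply: le_trans p1.
  have mnf := measurable_normc mf; have mng := measurable_normc mg.
  apply: (@le_trans _ _ (Lnorm mu r%:E (EFin \o
      ((fun z => normc (f z)) \+ (fun z => normc (g z)))%R))); last first.
    exact: minkowski_EFin.
  pose h z : R[i] := (normc (f z) + normc (g z))%:C%C.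
  have mh : cmeasurable h.
    split; first exact: measurable_funD.
    exact: measurable_cst.
  have hn z : normc (h z) = normc (f z) + normc (g z).
    by rewrite /h /= expr0n addr0 sqrtr_sqr ger0_norm // addr_ge0 ?normc_ge0.
  rewrite (_ : Lnorm _ _ _ = Lp_norm mu r%:E h); last first.
    by rewrite /Lp_norm /=; apply: eq_Lnorm => z; exact: (congr1 EFin (esym (hn z))).
  apply: le_Lp_norm => //; first exact: cmeasurableD.
  by move=> z; rewrite hn normc_triangle.
rewrite /Lp_norm eqxx; apply: ge_ereal_sup => _ [z _ <-].
apply: (@le_trans _ _ ((normc (f z))%:E + (normc (g z))%:E)%E).
  by rewrite -EFinD lee_fin normc_triangle.
by apply: leeD; apply: ereal_sup_ubound; exists z.
Qed.

Lemma Lp_normZ_le p f (c : R[i]) : (1%:E <= p)%E -> cmeasurable f ->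
  (Lp_norm mu p (fun z => (c * f z)%R) <= (normc c)%:E * Lp_norm mu p f)%E.
Proof.
case: p => [r| |] // p1 mf.
  rewrite lee_fin in p1; have r0 : 0 < r by apply: lt_le_trans p1.
  rewrite !Lp_norm_finE.
  under eq_integral do rewrite Normc.normcM powRM ?normc_ge0 // EFinM.
  rewrite ge0_integralZl_EFin ?powR_ge0 //; last 2 first.
  - by move=> z _; rewrite lee_fin powR_ge0.
  - exact: measurable_normc_powR.
  rewrite poweRM ?lee_fin ?powR_ge0 //; last first.
    by apply: integral_ge0 => z _; rewrite lee_fin powR_ge0.
  by rewrite poweR_EFin -powRrM mulfV ?gt_eqF // powRr1 // normc_ge0.
rewrite /Lp_norm eqxx; apply: ge_ereal_sup => _ [z _ <-].
rewrite Normc.normcM EFinM; apply: lee_wpmul2l; first by rewrite lee_fin normc_ge0.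
by apply: ereal_sup_ubound; exists z.
Qed.

Hypothesis mu_haar : haar mu.

(** Invariance on sets says that [mu] is its own image under z -> z + a: the preimage of A is the
    translate of A by -a. *)
Lemma ge0_integral_shift (h : G * G -> \bar R) a : measurable_fun setT h ->
  (forall z, (0 <= h z)%E) -> (\int[mu]_z h (z + a)%R = \int[mu]_z h z)%E.
Proof.
move=> mh h0; have ma := measurable_shift a.
have := @ge0_integral_pushforward _ _ _ _ R _ ma mu setT h measurableT mh (fun z _ => h0 z).
rewrite preimage_setT => <-; apply: eq_measure_integral => A mA _.
rewrite /= /pushforward; apply: etrans _ (mu_haar (- a) mA); congr (mu _).
apply/seteqP; split => [z /= Az|_ [z Az <-] /=].
  by exists (z + a) => //; rewrite addrCA addNr addr0.
by rewrite addrAC addNr add0r.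
Qed.

Lemma Lp_norm_shift p f a : (1%:E <= p)%E -> cmeasurable f ->
  Lp_norm mu p (fun z => f (z + a)) = Lp_norm mu p f.
Proof.
case: p => [r| |] // p1 mf.
  rewrite !Lp_norm_finE; apply: (congr1 (fun x => poweR x r^-1)).
  apply: (ge0_integral_shift (h := fun z => (normc (f z) `^ r)%:E)).
    exact: measurable_normc_powR.
  by move=> z; rewrite lee_fin powR_ge0.
rewrite /Lp_norm eqxx; congr ereal_sup; apply/seteqP; split => _ [z _ <-].
  by exists (z + a).
by exists (z - a) => //; rewrite subrK.
Qed.

End Lp_norms.

(** Young's inequality for t times y^(r-1) with exponents r and r/(r-1); at r = 1 the conjugate
    exponent degenerates. Only nonnegative terms stand on either side, so the tangent inequality can
    be integrated term by term in the extended reals. *)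
Lemma powR_tangent (R : realType) (r y t : R) : 1 <= r -> 0 <= y -> 0 <= t ->
  y `^ r + r * y `^ (r - 1) * t <= t `^ r + r * y `^ r.
Proof.
rewrite le_eqVlt => /predU1P[<- y0 t0|r1 y0 t0].
  by rewrite subrr powRr0 !powRr1 // !mul1r addrC.
have r0 : 0 < r by apply: lt_trans r1.
have r10 : 0 < r - 1 by rewrite subr_gt0.
pose q := r / (r - 1).
have := @conjugate_powR R t (y `^ (r - 1)) r q t0 (powR_ge0 _ _) r0.
have q0 : 0 < q by rewrite divr_gt0.
have e : r^-1 + q^-1 = 1.
  by rewrite /q invf_div -{1}(div1r r) -mulrDl addrC subrK mulfV // gt_eqF.
move=> /(_ q0 e); rewrite -powRrM /q mulrCA mulfV ?gt_eqF // mulr1 invf_div => h.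
have h' := ler_wpM2l (ltW r0) h.
have e1 : r * (t `^ r / r) = t `^ r by rewrite mulrC divfK // gt_eqF.
have e2 : r * (y `^ r * ((r - 1) / r)) = y `^ r * (r - 1).
  by rewrite mulrCA [r * _]mulrC divfK // gt_eqF.
rewrite mulrDr e1 e2 in h'; move: h'; lra.
Qed.

(** * Complex integrals and the measure of cosets *)

Section coset_averages.
Variables (R : realType) (m : nat -> nat).
Local Notation G := (vilenkin m).
Local Notation normc := (@Normc.normc R).
Variable mu : probability (G * G)%type R.
Hypothesis mu_haar : haar mu.
Implicit Types (f g : G * G -> R[i]).

Definition cintegrable f :=
  cmeasurable f /\ (\int[mu]_z (normc (f z))%:E < +oo)%E.

Lemma cintegrable_Re f : cintegrable f ->
  mu.-integrable setT (EFin \o (fun z => complex.Re (f z))).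
Proof.
move=> [[f1 f2] fi]; apply/integrableP; split; first exact/measurable_EFinP.
apply: le_lt_trans fi; apply: ge0_le_integral => //.
- by apply/measurable_EFinP; exact: measurableT_comp.
- by apply/measurable_EFinP; exact: measurable_normc.
by move=> z _; rewrite lee_fin normr_Re_le.
Qed.

Lemma cintegrable_Im f : cintegrable f ->
  mu.-integrable setT (EFin \o (fun z => complex.Im (f z))).
Proof.
move=> [[f1 f2] fi]; apply/integrableP; split; first exact/measurable_EFinP.
apply: le_lt_trans fi; apply: ge0_le_integral => //.
- by apply/measurable_EFinP; exact: measurableT_comp.
- by apply/measurable_EFinP; exact: measurable_normc.
by move=> z _; rewrite lee_fin normr_Im_le.
Qed.

Lemma cintegrable_normc f : cintegrable f ->
  mu.-integrable setT (EFin \o (fun z => normc (f z))).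
Proof.
move=> [mf fi]; apply/integrableP; split.
  by apply/measurable_EFinP; exact: measurable_normc.
by under eq_integral do rewrite /= ger0_norm ?normc_ge0 //.
Qed.

Lemma cintegrableD f g : cintegrable f -> cintegrable g -> cintegrable (fun z => f z + g z).
Proof.
move=> [mf fi] [mg gi]; split; first exact: cmeasurableD.
have mf' := measurable_normc mf; have mg' := measurable_normc mg.
apply: (@le_lt_trans _ _ (\int[mu]_z ((normc (f z))%:E + (normc (g z))%:E))%E).
  apply: ge0_le_integral => //.
  - by move=> z _; rewrite lee_fin normc_ge0.
  - by apply/measurable_EFinP; apply: measurable_normc; exact: cmeasurableD.
  - by apply: emeasurable_funD; exact/measurable_EFinP.
  by move=> z _; rewrite -EFinD lee_fin normc_triangle.
rewrite ge0_integralD //; first exact: lte_add_pinfty.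
- by move=> z _; rewrite lee_fin normc_ge0.
- exact/measurable_EFinP.
- by move=> z _; rewrite lee_fin normc_ge0.
- exact/measurable_EFinP.
Qed.

Lemma cintegrable_bounded b f g : cmeasurable f -> cintegrable g -> 0 <= b ->
  (forall z, normc (f z) <= b) -> cintegrable (fun z => f z * g z).
Proof.
move=> mf [mg gi] b0 fb; split; first exact: cmeasurableM.
have mg' := measurable_normc mg.
apply: (@le_lt_trans _ _ (\int[mu]_z (b%:E * (normc (g z))%:E))%E).
  apply: ge0_le_integral => //.
  - by move=> z _; rewrite lee_fin normc_ge0.
  - by apply/measurable_EFinP; apply: measurable_normc; exact: cmeasurableM.
  - by apply: emeasurable_funM => //; exact/measurable_EFinP.
  by move=> z _; rewrite -EFinM lee_fin Normc.normcM ler_wpM2r ?normc_ge0.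
rewrite ge0_integralZl_EFin //; first by rewrite lte_mul_pinfty ?lee_fin.
- by move=> z _; rewrite lee_fin normc_ge0.
- exact/measurable_EFinP.
Qed.

Lemma cintegrable_cst c : cintegrable (fun=> c).
Proof.
split; first exact: cmeasurable_cst.
rewrite integral_cst //; apply: le_lt_trans (ltry (normc c)).
rewrite -[leRHS]mule1; apply: lee_wpmul2l; first by rewrite lee_fin normc_ge0.
exact: probability_le1.
Qed.

Lemma cintegralD f g : cintegrable f -> cintegrable g ->
  cintegral mu (fun z => f z + g z) = cintegral mu f + cintegral mu g.
Proof.
move=> fi gi; rewrite /cintegral; apply/eqP; rewrite eq_complex /=; apply/andP; split; apply/eqP.
  rewrite -RintegralD //; [|exact: cintegrable_Re..].
  by apply: eq_Rintegral => z _; rewrite raddfD.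
rewrite -RintegralD //; [|exact: cintegrable_Im..].
by apply: eq_Rintegral => z _; rewrite raddfD.
Qed.

Lemma cintegralZ c f : cintegrable f ->
  cintegral mu (fun z => c * f z) = c * cintegral mu f.
Proof.
move=> fi; have fR := cintegrable_Re fi; have fI := cintegrable_Im fi.
have ZR x h : mu.-integrable setT (EFin \o h) ->
    mu.-integrable setT (EFin \o (fun z : G * G => x * h z)).
  by move=> hi; exact: (integrableZl measurableT x hi).
case: c => a b; rewrite /cintegral; apply/eqP; rewrite eq_complex /=.
apply/andP; split; apply/eqP.
  rewrite -!RintegralZl // -RintegralB //; [|exact: ZR..].
  by apply: eq_Rintegral => z _; case: (f z).
rewrite -!RintegralZl // -RintegralD //; [|exact: ZR..].
by apply: eq_Rintegral => z _; case: (f z).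
Qed.

Lemma cintegral_sum (I : Type) (s : seq I) (c : I -> R[i]) (F : I -> G * G -> R[i]) :
  (forall i, cintegrable (F i)) ->
  cintegral mu (fun z => \sum_(i <- s) c i * F i z) = \sum_(i <- s) c i * cintegral mu (F i).
Proof.
move=> Fi; have ZI i : cintegrable (fun z => c i * F i z).
  by apply: (cintegrable_bounded (b := normc (c i))) => //; exact: normc_ge0.
suff [] : cintegrable (fun z => \sum_(i <- s) c i * F i z) /\
  cintegral mu (fun z => \sum_(i <- s) c i * F i z) = \sum_(i <- s) c i * cintegral mu (F i) by [].
elim: s => [|i s [IH1 IH2]].
  rewrite big_nil (_ : (fun _ => _) = (fun=> 0)); last by apply/funext => z; rewrite big_nil.
  split; first exact: cintegrable_cst.
  by rewrite /cintegral /= Rintegral_cst // !mul0r.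
rewrite big_cons (_ : (fun _ => _) = (fun z => c i * F i z + \sum_(j <- s) c j * F j z)).
  by split; [exact: cintegrableD|rewrite cintegralD // cintegralZ // IH2].
by apply/funext => z; rewrite big_cons.
Qed.

(** The usual rotation: with c the integral, |c|^2 is the real part of the integral of conj(c) f,
    hence at most |c| times the integral of |f|. *)
Lemma normc_cintegral_le f : cintegrable f ->
  ((normc (cintegral mu f))%:E <= \int[mu]_z (normc (f z))%:E)%E.
Proof.
move=> fi; have fR := cintegrable_Re fi; have fI := cintegrable_Im fi.
have fN := cintegrable_normc fi.
have -> : (\int[mu]_z (normc (f z))%:E)%E = (\int[mu]_z normc (f z))%:E.
  by rewrite /Rintegral fineK // integrable_fin_num.
rewrite lee_fin.
set c := cintegral mu f; set A := normc c; set I := Rintegral _ _ _.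
have A0 : 0 <= A by exact: normc_ge0.
have [->|An0] := eqVneq A 0; first by apply: Rintegral_ge0 => z _; exact: normc_ge0.
have Apos : 0 < A by rewrite lt_neqAle eq_sym An0.
rewrite -(ler_pM2l Apos) -RintegralZl //.
have cJ : normc c^*%C = A by rewrite /A; case: (c) => x y /=; rewrite sqrrN.
have AE : A * A = complex.Re (c^*%C * c).
  rewrite /A; case: (c) => x y /=; rewrite -expr2 sqr_sqrtr ?addr_ge0 ?sqr_ge0 //.
  by rewrite mulNr opprK !expr2.
rewrite AE -cintegralZ //= ; apply: le_Rintegral => //.
- apply: cintegrable_Re; apply: (cintegrable_bounded (b := A)) => //.
  by move=> _; rewrite le_eqVlt; apply/orP; left; apply/eqP; exact: cJ.
- exact: (integrableZl measurableT A fN).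
move=> z _; apply: (le_trans (ler_norm _)); apply: (le_trans (normr_Re_le _)).
by rewrite Normc.normcM cJ.
Qed.

Variable K : nat.
Local Notation T := (trunc_group m K).
Local Notation card := (#|T|%:R : R).

Definition coset_ind (z w : G * G) : R :=
  ((trunc K w.1 == trunc K z.1) && (trunc K w.2 == trunc K z.2))%:R.

Lemma coset_ind_ge0 z w : 0 <= coset_ind z w.
Proof. exact: ler0n. Qed.

Lemma coset_ind_le1 z w : coset_ind z w <= 1.
Proof. by rewrite /coset_ind; case: (_ && _). Qed.

Lemma measurable_coset_ind z : measurable_fun setT (coset_ind z).
Proof.
by apply: (@measurable_fun_trunc_saturated m _ _ K) => w w' h1 h2; rewrite /coset_ind h1 h2.
Qed.

Lemma coset_ind_shift z u : coset_ind z (z + u) = coset_ind 0 u.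
Proof.
have h (x y : G) : (trunc K (x + y) == trunc K x) = (trunc K y == trunc K (0 : G)).
  apply/eqP/eqP => [e|e]; last by rewrite (truncD (erefl (trunc K x)) e) addr0.
  have := truncD (erefl (trunc K (- x))) e.
  by rewrite addrA addNr add0r.
by rewrite /coset_ind !h.
Qed.

Let card_gt0 : 0 < card. Proof. by rewrite ltr0n card_trunc_group_gt0. Qed.

Lemma coset_ind_trunc_sum w : \sum_(h : T) \sum_(h' : T)
  coset_ind (trunc_val h, trunc_val h') w = 1.
Proof.
rewrite (bigD1 (trunc K w.1)) //= [X in _ + X]big1 ?addr0; last first.
  move=> h hw; rewrite big1 // => h' _.
  by rewrite /coset_ind /= trunc_valK [_ == h]eq_sym (negbTE hw).
rewrite (bigD1 (trunc K w.2)) //= [X in _ + X]big1 ?addr0; last first.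
  by move=> h hw; rewrite /coset_ind /= !trunc_valK eqxx /= [_ == h]eq_sym (negbTE hw).
by rewrite /coset_ind /= !trunc_valK !eqxx.
Qed.

(** By invariance all cosets have the same measure, and |T|^2 of them partition a space of measure
    1. That measure is a priori an extended real, hence the final cases. *)
Lemma integral_coset_ind z : (\int[mu]_w (coset_ind z w)%:E = (card ^- 2)%:E)%E.
Proof.
have E z' : (\int[mu]_w (coset_ind z' w)%:E = \int[mu]_w (coset_ind 0 w)%:E)%E.
  rewrite -(ge0_integral_shift mu_haar (h := fun w => (coset_ind z' w)%:E) z').
  - by apply: eq_integral => w _; rewrite addrC coset_ind_shift.
  - by apply/measurable_EFinP; exact: measurable_coset_ind.
  - by move=> w; rewrite lee_fin coset_ind_ge0.
rewrite E; set I := (\int[mu]_w _)%E.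
have mi z' : measurable_fun setT (fun w => (coset_ind z' w)%:E).
  by apply/measurable_EFinP; exact: measurable_coset_ind.
have : (\int[mu]_w (1%:E) = (card ^+ 2)%:E * I)%E.
  under eq_integral => w _.
    rewrite -(coset_ind_trunc_sum w) pair_bigA /= -sumEFin.
    over.
  rewrite ge0_integral_sum //; last by move=> h w _; rewrite lee_fin coset_ind_ge0.
  under eq_bigr => h _ do rewrite E.
  rewrite big_const -/I card_prod.
  have -> : card ^+ 2 = (#|T| * #|T|)%:R by rewrite natrM expr2.
  elim: (#|T| * #|T|)%N => [|k IH] /=; first by rewrite mul0e.
  by rewrite IH -natr1 EFinD addeC ge0_muleDl ?lee_fin // mul1e.
rewrite integral_cst // mul1e => e; have {e} := etrans (esym (@probability_setT _ _ _ mu)) e.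
case: I => [x||].
- rewrite -EFinM => -[e]; congr EFin.
  apply: (mulfI (lt0r_neq0 (exprn_gt0 2 card_gt0))).
  by rewrite -e mulfV // expf_neq0 // lt0r_neq0.
- by rewrite mulry gtr0_sg ?exprn_gt0 // mul1e.
- by rewrite mulrNy gtr0_sg ?exprn_gt0 // mul1e.
Qed.

End coset_averages.

(** * Approximation by coset averages in L^p *)

Section coset_average_approximation.
Variables (R : realType) (m : nat -> nat).
Local Notation G := (vilenkin m).
Local Notation normc := (@Normc.normc R).
Variable mu : probability (G * G)%type R.
Hypothesis mu_haar : haar mu.
Variable K : nat.
Local Notation card := (#|trunc_group m K|%:R : R).
Local Notation coset_ind := (@coset_ind R m K).
Implicit Types (f g : G * G -> R[i]).

Definition coset_avg f z : R[i] :=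
  (card ^+ 2)%:C%C * cintegral mu (fun w => (coset_ind z w)%:C%C * f w).

Let le_ge0_integral (h k : G * G -> \bar R) : (forall z, (0 <= h z)%E) ->
  measurable_fun setT h -> measurable_fun setT k -> (forall z, (h z <= k z)%E) ->
  (\int[mu]_z h z <= \int[mu]_z k z)%E.
Proof. by move=> h0 mh mk hk; apply: ge0_le_integral. Qed.

Let card2_gt0 : 0 < card ^+ 2.
Proof. by rewrite exprn_gt0 // ltr0n card_trunc_group_gt0. Qed.

Let measurable_ind z : measurable_fun setT (fun w => (coset_ind z w)%:E).
Proof. by apply/measurable_EFinP; exact: measurable_coset_ind. Qed.

Let ind_ge0 z w : (0 <= (coset_ind z w)%:E)%E.
Proof. by rewrite lee_fin coset_ind_ge0. Qed.

Lemma cmeasurable_coset_ind z : cmeasurable (fun w => (coset_ind z w)%:C%C).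
Proof. by split => //=; exact: measurable_coset_ind. Qed.

Lemma cintegrable_coset_ind f z : cintegrable mu f ->
  cintegrable mu (fun w => (coset_ind z w)%:C%C * f w).
Proof.
move=> fi; apply: (cintegrable_bounded (b := 1)) => //; first exact: cmeasurable_coset_ind.
move=> w /=; rewrite expr0n addr0 sqrtr_sqr ger0_norm ?coset_ind_ge0 //.
exact: coset_ind_le1.
Qed.

Lemma cintegral_coset_ind z :
  cintegral mu (fun w => (coset_ind z w)%:C%C) = (card ^- 2)%:C%C.
Proof.
rewrite /cintegral /= Rintegral_cst // mul0r; congr (_ +i* _)%C.
by rewrite /Rintegral (integral_coset_ind mu_haar).
Qed.

Lemma cmeasurable_coset_avg f : cmeasurable (coset_avg f).
Proof.
have E z w : trunc K z.1 = trunc K w.1 -> trunc K z.2 = trunc K w.2 ->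
    coset_avg f z = coset_avg f w.
  move=> h1 h2; rewrite /coset_avg; congr (_ * cintegral mu _); apply/funext => u.
  by rewrite /coset_ind h1 h2.
by split; apply: (@measurable_fun_trunc_saturated m _ _ K) => z w h1 h2;
  rewrite (E z w).
Qed.

Lemma coset_avg_dist f z : cintegrable mu f ->
  ((normc (coset_avg f z - f z))%:E <=
   (card ^+ 2)%:E * \int[mu]_w (coset_ind z w * normc (f w - f z)%R)%:E)%E.
Proof.
move=> fi.
have fi' := cintegrable_coset_ind z fi.
have ci : cintegrable mu (fun w => - f z * (coset_ind z w)%:C%C).
  have := cintegrable_coset_ind z (cintegrable_cst mu (- f z)).
  by congr cintegrable; apply/funext => w; rewrite mulrC.
have ii : cintegrable mu (fun w => (coset_ind z w)%:C%C).
  have := cintegrable_coset_ind z (cintegrable_cst mu 1).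
  by congr cintegrable; apply/funext => w; rewrite mulr1.
have -> : coset_avg f z - f z = (card ^+ 2)%:C%C *
   cintegral mu (fun w => (coset_ind z w)%:C%C * f w + - f z * (coset_ind z w)%:C%C).
  rewrite cintegralD // cintegralZ // cintegral_coset_ind mulrDr; congr (_ + _).
  by rewrite mulrCA -rmorphM mulfV ?mulr1 // lt0r_neq0.
rewrite Normc.normcM EFinM /= expr0n addr0 sqrtr_sqr ger0_norm ?(ltW card2_gt0) //.
apply: lee_wpmul2l; first by rewrite lee_fin ltW.
apply: (le_trans (normc_cintegral_le (cintegrableD fi' ci))).
apply: ge0_le_integral => //.
- by move=> w _; rewrite lee_fin normc_ge0.
- apply/measurable_EFinP; apply: measurable_normc; apply: cmeasurableD.
    by case: fi'.
  by case: ci.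
- apply/measurable_EFinP; apply: measurable_funM; first exact: measurable_coset_ind.
  apply: measurable_normc; apply: cmeasurableD; first by case: fi.
  exact: cmeasurable_cst.
move=> w _; rewrite lee_fin [- f z * _]mulrC -mulrDr Normc.normcM.
by rewrite /= expr0n addr0 sqrtr_sqr ger0_norm ?coset_ind_ge0.
Qed.

(* Integrates the tangent line of [t `^ r] at [y], so that convexity is needed only
   pointwise. *)
Lemma coset_jensen (r y : R) (g : G * G -> R) z : 1 <= r -> 0 <= y ->
  measurable_fun setT g -> (forall w, 0 <= g w) ->
  (y%:E <= (card ^+ 2)%:E * \int[mu]_w (coset_ind z w * g w)%:E)%E ->
  ((y `^ r)%:E <= (card ^+ 2)%:E * \int[mu]_w (coset_ind z w * g w `^ r)%:E)%E.
Proof.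
move=> r1 y0 mg g0 yg; have r0 : 0 <= r by apply: le_trans r1.
have mgr : measurable_fun setT (fun w => (coset_ind z w * g w `^ r)%:E).
  apply/measurable_EFinP; apply: measurable_funM; first exact: measurable_coset_ind.
  exact: (measurableT_comp (@measurable_powR R r) mg).
have mg1 : measurable_fun setT (fun w => (coset_ind z w * g w)%:E).
  by apply/measurable_EFinP; apply: measurable_funM => //; exact: measurable_coset_ind.
(* Value and slope of the tangent. Since b y = r a, the two terms r a cancel once each constant has
   been integrated against the coset of mass [card ^- 2]. *)
pose a := y `^ r; pose b := r * y `^ (r - 1).
have a0 : 0 <= a by exact: powR_ge0.
have b0 : 0 <= b by rewrite mulr_ge0 ?powR_ge0.
have by_ : b * y = r * a.
  by rewrite /b /a -mulrA; congr (_ * _); rewrite mulrC mulr_powRB1 // (lt_le_trans ltr01).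
have ZE c h : 0 <= c -> measurable_fun setT (fun w => (coset_ind z w * h w)%:E) ->
    (forall w, 0 <= h w) ->
    (\int[mu]_w (c * (coset_ind z w * h w)%R)%:E = c%:E * \int[mu]_w (coset_ind z w * h w)%:E)%E.
  move=> c0 mh h0; rewrite -ge0_integralZl_EFin //.
  by move=> w _; rewrite lee_fin mulr_ge0 ?coset_ind_ge0.
have main : (\int[mu]_w ((a * (coset_ind z w * 1)%R)%:E + (b * (coset_ind z w * g w)%R)%:E) <=
   \int[mu]_w ((coset_ind z w * g w `^ r)%:E + ((r * a) * (coset_ind z w * 1)%R)%:E))%E.
  have m1 c : measurable_fun setT (fun w => (c * (coset_ind z w * 1)%R)%:E).
    apply/measurable_EFinP; apply: measurable_funM => //.
    by apply: measurable_funM => //; exact: measurable_coset_ind.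
  apply: ge0_le_integral => //.
  - by move=> w _; rewrite -EFinD lee_fin addr_ge0 // !mulr_ge0 // powR_ge0.
  - apply: emeasurable_funD => //; apply/measurable_EFinP; apply: measurable_funM => //.
    by apply: measurable_funM => //; exact: measurable_coset_ind.
  - exact: emeasurable_funD.
  move=> w _; rewrite -!EFinD lee_fin.
  have := ler_wpM2l (@coset_ind_ge0 R m K z w) (powR_tangent r1 y0 (g0 w)).
  rewrite -/a -/b; lra.
have m1 : measurable_fun setT (fun w => (coset_ind z w * 1)%:E).
  by apply/measurable_EFinP; apply: measurable_funM => //; exact: measurable_coset_ind.
have ge0 (c : R) (h : G * G -> R) : 0 <= c -> (forall w, 0 <= h w) ->
    forall w, setT w -> (0 <= (c * (coset_ind z w * h w))%:E)%E.
  by move=> c0 h0 w _; rewrite lee_fin !mulr_ge0.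
have mZ (c : R) (h : G * G -> R) : measurable_fun setT (fun w => (coset_ind z w * h w)%:E) ->
    measurable_fun setT (fun w => (c * (coset_ind z w * h w))%:E).
  by move=> /measurable_EFinP mh; apply/measurable_EFinP; exact: measurable_funM.
have I1 : (\int[mu]_w (coset_ind z w * 1)%:E = (card ^- 2)%:E)%E.
  by rewrite -(integral_coset_ind mu_haar K z); under eq_integral do rewrite mulr1.
rewrite ge0_integralD // in main; [|exact: ge0|exact: mZ|exact: ge0|exact: mZ].
rewrite ge0_integralD // in main; [|by move=> w _; rewrite lee_fin mulr_ge0 ?powR_ge0|
  by apply: ge0 => //; exact: mulr_ge0|exact: mZ].
rewrite (ZE a) // (ZE b) // (ZE (r * a)) ?mulr_ge0 // I1 in main.
set J := (\int[mu]_w (coset_ind z w * g w)%:E)%E in main yg.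
set Z := (\int[mu]_w _)%E in main *.
have c20 : (0 <= (card ^+ 2)%:E)%E by rewrite lee_fin ltW.
have J0 : (0 <= J)%E by apply: integral_ge0 => w _; rewrite lee_fin mulr_ge0.
have Z0 : (0 <= Z)%E by apply: integral_ge0 => w _; rewrite lee_fin mulr_ge0 ?powR_ge0.
clearbody J Z.
have e (c : R) : ((card ^+ 2)%:E * (c%:E * (card ^- 2)%:E) = c%:E)%E.
  by rewrite -!EFinM mulrCA mulfV ?mulr1 // lt0r_neq0.
have := lee_wpmul2l c20 main.
rewrite ge0_muleDr ?mule_ge0 ?lee_fin ?invr_ge0 ?(ltW card2_gt0) //.
rewrite ge0_muleDr ?mule_ge0 ?lee_fin ?invr_ge0 ?(ltW card2_gt0) ?mulr_ge0 //.
rewrite !e muleCA => h.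
have : (a%:E + (r * a)%:E <= (card ^+ 2)%:E * Z + (r * a)%:E)%E.
  apply: le_trans h; rewrite leeD2lE // -by_ EFinM.
  by apply: lee_wpmul2l; [rewrite lee_fin|exact: yg].
by rewrite leeD2rE.
Qed.

(** Jensen bounds the r-th power at z by the average over u in I_K x I_K of |f(z+u) - f(z)|^r.
    Tonelli lets z be integrated first, which for each u gives at most b^r. For [p = +oo] the
    average is bounded pointwise. *)
Lemma coset_avg_approx p f (b : R) : (1%:E <= p)%E -> cintegrable mu f ->
  (forall u, trunc K u.1 = trunc K (0 : G) -> trunc K u.2 = trunc K (0 : G) ->
    (Lp_norm mu p (fun z => (f (z + u) - f z)%R) <= b%:E)%E) ->
  (Lp_norm mu p (fun z => (coset_avg f z - f z)%R) <= b%:E)%E.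
Proof.
case: p => [r| |] // p1 fi hb; have [mf _] := fi.
  rewrite lee_fin in p1; have r0 : 0 < r by apply: lt_le_trans p1.
  have b0 : 0 <= b.
    rewrite -lee_fin; apply: le_trans (hb 0 erefl erefl).
    exact: Lp_norm_ge0.
  pose F (zu : (G * G) * (G * G)) : \bar R :=
    (coset_ind 0 zu.2 * normc (f (zu.1 + zu.2) - f zu.1) `^ r)%:E.
  have F0 zu : (0 <= F zu)%E by rewrite lee_fin mulr_ge0 ?powR_ge0 ?coset_ind_ge0.
  have mF : measurable_fun setT F.
    apply/measurable_EFinP; apply: measurable_funM.
      exact: (measurableT_comp (@measurable_coset_ind R m K 0)).
    apply: (measurableT_comp (@measurable_powR R r)).
    have mdiff (part : R[i] -> R) : measurable_fun setT (fun z => part (f z)) ->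
        {morph part : x y / x - y} -> measurable_fun setT (fun zu : (G * G) * (G * G) =>
          part (f (zu.1 + zu.2) - f zu.1)).
      move=> mp pB.
      rewrite (_ : (fun _ => _) = (fun zu => part (f (zu.1 + zu.2)) - part (f zu.1))); last first.
        by apply/funext => zu; rewrite pB.
      apply: measurable_funB; last exact: (measurableT_comp mp).
      by apply: (measurableT_comp mp); exact: measurable_prod_add.
    rewrite (_ : (fun _ => _) = (fun zu =>
      (complex.Re (f (zu.1 + zu.2) - f zu.1) ^+ 2 +
       complex.Im (f (zu.1 + zu.2) - f zu.1) ^+ 2) `^ 2^-1)); last first.
      apply/funext => zu; rewrite powR12_sqrt ?addr_ge0 ?sqr_ge0 //.
      by case: (_ - _).
    apply: (measurableT_comp (@measurable_powR R _)).
    by apply: measurable_funD; apply: measurable_funX; apply: mdiff;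
      [case: mf|exact: raddfB|case: mf|exact: raddfB].
  have mG z : cmeasurable (fun w => f w - f z).
    by apply: cmeasurableD => //; exact: cmeasurable_cst.
  have jensen z : ((normc (coset_avg f z - f z) `^ r)%:E <=
      (card ^+ 2)%:E * \int[mu]_u F (z, u))%E.
    have := coset_jensen p1 (normc_ge0 _) (measurable_normc (mG z)) (fun w => normc_ge0 _)
      (coset_avg_dist z fi).
    move=> /le_trans; apply; apply: lee_wpmul2l; first by rewrite lee_fin ltW.
    rewrite -(ge0_integral_shift mu_haar
      (h := fun w => (coset_ind z w * normc (f w - f z) `^ r)%:E) z).
    - rewrite le_eqVlt; apply/orP; left; apply/eqP; apply: eq_integral => u _.
      by rewrite /F /= addrC coset_ind_shift.
    - apply/measurable_EFinP; apply: measurable_funM; first exact: measurable_coset_ind.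
      apply: (measurableT_comp (@measurable_powR R r)); exact: measurable_normc.
    - by move=> w; rewrite lee_fin mulr_ge0 ?powR_ge0 ?coset_ind_ge0.
  have inner u : (\int[mu]_z F (z, u) <= (coset_ind 0 u * b `^ r)%:E)%E.
    have mu_ : measurable_fun setT (fun z : G * G => (normc (f (z + u) - f z) `^ r)%:E).
      apply: measurable_normc_powR; apply: cmeasurableD; first exact: cmeasurable_shift.
      have := cmeasurableM (cmeasurable_cst m (-1)) mf.
      by congr cmeasurable; apply/funext => z; rewrite mulN1r.
    rewrite /F /=; under eq_integral do rewrite EFinM.
    rewrite ge0_integralZl_EFin ?coset_ind_ge0 //; last first.
      by move=> z _; rewrite lee_fin powR_ge0.
    rewrite /coset_ind; case: andP => [[/eqP u1 /eqP u2]|_]; last by rewrite !mul0e mul0r.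
    rewrite mul1e mul1r; have := hb u u1 u2; rewrite Lp_norm_finE => /(le_poweR (ltW r0)).
    rewrite poweR_EFin -poweRrM mulVf ?gt_eqF // poweRe1; last first.
      by apply: integral_ge0 => z _; rewrite lee_fin powR_ge0.
    by apply; exact: poweR_ge0.
  have mI : measurable_fun setT (fun z => (\int[mu]_u F (z, u))%E).
    exact: (measurable_fun_fubini_tonelli_F F mF F0).
  have I0 z : (0 <= \int[mu]_u F (z, u))%E by apply: integral_ge0.
  have total : (\int[mu]_z (normc (coset_avg f z - f z) `^ r)%:E <= (b `^ r)%:E)%E.
    apply: (@le_trans _ _ (\int[mu]_z ((card ^+ 2)%:E * \int[mu]_u F (z, u)))%E).
      apply: (@le_ge0_integral (fun z => (normc (coset_avg f z - f z) `^ r)%:E)).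
      - by move=> z; rewrite lee_fin powR_ge0.
      - apply: measurable_normc_powR; apply: cmeasurableD; last first.
          have := cmeasurableM (cmeasurable_cst m (-1)) mf.
          by congr cmeasurable; apply/funext => z; rewrite mulN1r.
        exact: cmeasurable_coset_avg.
      - by apply: emeasurable_funM => //; exact: mI.
      exact: jensen.
    rewrite ge0_integralZl_EFin ?(ltW card2_gt0) // (fubini_tonelli F mF F0).
    apply: (@le_trans _ _ ((card ^+ 2)%:E * \int[mu]_u ((b `^ r)%:E * (coset_ind 0 u)%:E))%E).
      apply: lee_wpmul2l; first by rewrite lee_fin ltW.
      apply: (@le_ge0_integral (fun u => \int[mu]_z F (z, u))%E).
      - by move=> u; apply: integral_ge0 => z _; exact: F0.
      - exact: (measurable_fun_fubini_tonelli_G F mF F0).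
      - by apply: emeasurable_funM => //; exact: measurable_ind.
      by move=> u; rewrite -EFinM mulrC; exact: inner.
    rewrite ge0_integralZl_EFin ?powR_ge0 // (integral_coset_ind mu_haar K 0).
    by rewrite -!EFinM mulrCA mulfV ?mulr1 ?lt0r_neq0.
  rewrite Lp_norm_finE; apply: (le_trans (le_poweR _ _ total)).
  - by rewrite invr_ge0 ltW.
  - by apply: integral_ge0 => z _; rewrite lee_fin powR_ge0.
  by rewrite poweR_EFin -powRrM mulfV ?gt_eqF // powRr1.
rewrite /Lp_norm eqxx; apply: ge_ereal_sup => _ [z _ <-].
apply: (le_trans (coset_avg_dist z fi)).
have hb' u : trunc K u.1 = trunc K (0 : G) -> trunc K u.2 = trunc K (0 : G) ->
    normc (f (z + u) - f z) <= b.
  move=> u1 u2; rewrite -lee_fin; apply: le_trans (hb u u1 u2).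
  by rewrite /Lp_norm eqxx; apply: ereal_sup_ubound; exists z.
have b0 : 0 <= b by apply: le_trans (hb' 0 erefl erefl); exact: normc_ge0.
apply: (@le_trans _ _ ((card ^+ 2)%:E * \int[mu]_w (b%:E * (coset_ind z w)%:E))%E).
  apply: lee_wpmul2l; first by rewrite lee_fin ltW.
  apply: ge0_le_integral => //.
  - by move=> w _; rewrite lee_fin mulr_ge0 ?normc_ge0 ?coset_ind_ge0.
  - apply/measurable_EFinP; apply: measurable_funM; first exact: measurable_coset_ind.
    apply: measurable_normc; apply: cmeasurableD => //; exact: cmeasurable_cst.
  - by apply: emeasurable_funM.
  move=> w _; rewrite -EFinM lee_fin [leRHS]mulrC.
  have -> : w = z + (w - z) by rewrite addrC subrK.
  rewrite coset_ind_shift /coset_ind.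
  case: andP => [[/eqP u1 /eqP u2]|_]; last by rewrite !mul0r.
  by rewrite !mul1r hb'.
rewrite ge0_integralZl_EFin // (integral_coset_ind mu_haar K z).
by rewrite -!EFinM mulrCA mulfV ?mulr1 ?lt0r_neq0.
Qed.

End coset_average_approximation.

(** * Measurability and integrability of the given function *)

Section continuous_functions.
Variables (R : realType) (m : nat -> nat).
Local Notation G := (vilenkin m).
Implicit Types (f : G * G -> R[i]).

(** f is the pointwise limit of its compositions with truncations, and these depend on finitely many
    coordinates. *)
Lemma cmeasurable_continuous f :
  continuous (f : G * G -> (R[i] : numFieldType)) -> cmeasurable f.
Proof.
move=> cf.
pose u n (z : G * G) : G * G := (trunc_val (trunc n z.1), trunc_val (trunc n z.2)).
pose fC : G * G -> (R[i] : numFieldType) := f.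
have cu z : fC (u n z) @[n --> \oo] --> fC z.
  have ct (x : G) : trunc_val (trunc n x) @[n --> \oo] --> x.
    by apply: cvg_vilenkin => n; rewrite trunc_valK.
  apply: (continuous_cvg _ (cf z)); case: z => x y.
  exact: (cvg_pair (ct x) (ct y)).
have cpart (part : R[i] -> R) : {morph part : x y / x - y} ->
    (forall c, `|part c| <= Normc.normc c) -> measurable_fun setT (fun z => part (f z)).
  move=> pB pN; apply: (measurable_fun_cvg (h := fun n z => part (f (u n z)))) => [n|z _].
    by apply: (@measurable_fun_trunc_saturated m _ _ n) => z w h1 h2; rewrite /u h1 h2.
  apply/cvgrPdist_lt => e e0.
  have e0' : 0 < (e%:C)%C :> R[i] by rewrite ltcR.
  have /cvgrPdist_lt/(_ _ e0') := cu z.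
  apply: filterS => n; rewrite normc_def ltcR => h.
  rewrite -pB; apply: le_lt_trans (pN _) _.
  by move: h; rewrite /fC; case: (f z - f (u n z)).
split; first by apply: cpart; [exact: raddfB|exact: normr_Re_le].
by apply: cpart; [exact: raddfB|exact: normr_Im_le].
Qed.

Variable mu : probability (G * G)%type R.

Lemma in_Lp_cmeasurable p f : in_Lp mu p f -> cmeasurable f.
Proof. by rewrite /in_Lp; case: ifP => _; [exact: cmeasurable_continuous|case]. Qed.

(** On a probability space L^p embeds in L^1, since t <= 1 + t^r for r >= 1. *)
Lemma Lp_norm_cintegrable p f : (1%:E <= p)%E -> cmeasurable f ->
  (Lp_norm mu p f < +oo)%E -> cintegrable mu f.
Proof.
case: p => [r| |] // p1 mf fp; split => //.
  rewrite lee_fin in p1; have r0 : 0 < r by apply: lt_le_trans p1.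
  have fr : (\int[mu]_z (Normc.normc (f z) `^ r)%:E < +oo)%E.
    move: fp; rewrite Lp_norm_finE => /lty_poweRy; apply.
    by rewrite invr_eq0 gt_eqF.
  apply: (@le_lt_trans _ _ (\int[mu]_z (1 + (Normc.normc (f z) `^ r)%:E))%E).
    apply: ge0_le_integral => //.
    - by move=> z _; rewrite lee_fin normc_ge0.
    - by apply/measurable_EFinP; exact: measurable_normc.
    - by apply: emeasurable_funD => //; exact: measurable_normc_powR.
    move=> z _; rewrite -EFinD lee_fin.
    have [h|/ltW h] := leP (Normc.normc (f z)) 1.
      by apply: (le_trans h); rewrite lerDl powR_ge0.
    by apply: (le_trans (le1r_powR h p1)); rewrite lerDr.
  rewrite ge0_integralD //.
  - rewrite integral_cst // lte_add_pinfty // mul1e.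
    exact: le_lt_trans (probability_le1 _ _) (ltry _).
  - by move=> z _; rewrite lee_fin powR_ge0.
  - exact: measurable_normc_powR.
have f0 : (0 <= Lp_norm mu +oo f)%E by exact: Lp_norm_ge0.
have [b bE] : exists b : R, Lp_norm mu +oo f = b%:E.
  by move: f0 fp; case: (Lp_norm mu +oo f) => [b||] // _ _; exists b.
apply: (@le_lt_trans _ _ (\int[mu]_z b%:E)%E).
  apply: ge0_le_integral => //.
  - by move=> z _; rewrite lee_fin normc_ge0.
  - by apply/measurable_EFinP; exact: measurable_normc.
  move=> z _; rewrite -bE /Lp_norm eqxx; apply: ereal_sup_ubound.
  by exists z.
rewrite integral_cst //; apply: (@le_lt_trans _ _ (b%:E * 1)%E); last by rewrite mule1 ltry.
apply: lee_wpmul2l; first by rewrite -bE.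
exact: probability_le1.
Qed.

End continuous_functions.

(** * Fourier coefficients as finite averages *)

Section fourier_coefficients.
Variables (R : realType) (m : nat -> nat).
Hypothesis m_ge2 : forall k, (2 <= m k)%N.
Local Notation G := (vilenkin m).
Local Notation M := (vilenkin_M m).
Local Notation psi := (@psi R m).
Variable mu : probability (G * G)%type R.
Variable K : nat.
Local Notation T := (trunc_group m K).
Implicit Types (f : G * G -> R[i]).

Lemma psi_trunc i (x : G) : (i < M K)%N -> psi i x = psi i (trunc_val (trunc K x)).
Proof.
move=> iK; have xK : @vilenkin_I m K (x - trunc_val (trunc K x)) by apply/trunc_coset.
rewrite -[in LHS](subrK (trunc_val (trunc K x)) x) psiD //.
by rewrite (psi_coord0 _ m_ge2 iK xK) mul1r.
Qed.

(** The right side is the value at z of the two discrete projections applied to [coset_avg]. For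
    fixed w exactly one pair (h, h') puts w into the coset of z - (h, h'), namely the truncation of
    z - w, and there psi_i(h) = psi_i(z.1 - w.1) because i < M_K; likewise for j. *)
Lemma fourier_coefE f i j z : cintegrable mu f -> (i < M K)%N -> (j < M K)%N ->
  fourier_coef mu f i j * psi i z.1 * psi j z.2 =
  (#|T|%:R)^-1 * (\sum_(h : T) psi i (trunc_val h) *
   ((#|T|%:R)^-1 * \sum_(h' : T) psi j (trunc_val h') *
      coset_avg mu K f (z.1 - trunc_val h, z.2 - trunc_val h'))).
Proof.
move=> fi iK jK.
pose F (hh : T * T) w := (coset_ind R K (z.1 - trunc_val hh.1, z.2 - trunc_val hh.2) w)%:C%C * f w.
pose c (hh : T * T) := psi i (trunc_val hh.1) * psi j (trunc_val hh.2) /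
   (psi i z.1 * psi j z.2).
have Fi hh : cintegrable mu (F hh) by exact: cintegrable_coset_ind.
have psi0 : psi i z.1 * psi j z.2 != 0 by rewrite mulf_neq0 // psi_neq0.
have -> : fourier_coef mu f i j = \sum_(hh : T * T) c hh * cintegral mu (F hh).
  rewrite -cintegral_sum //; congr (cintegral mu _); apply/funext => w.
  pose h0 := (trunc K (z.1 - w.1), trunc K (z.2 - w.2)).
  have ind_ x y (h : T) : (trunc K y == trunc K (x - trunc_val h)) = (h == trunc K (x - y)).
    apply/eqP/eqP => [e|->].
      have := truncD (erefl (trunc K x)) (truncN e).
      by rewrite opprB addrCA subrr addr0 trunc_valK.
    have e : trunc K (trunc_val (trunc K (x - y))) = trunc K (x - y) by rewrite trunc_valK.
    have := truncD (erefl (trunc K x)) (truncN e).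
    by rewrite opprB addrCA subrr addr0.
  rewrite (bigD1 h0) //= big1 ?addr0; last first.
    move=> hh hne; rewrite /F /coset_ind /= !ind_ -[_ && _]/(hh == h0) (negbTE hne).
    by rewrite mul0r mulr0.
  rewrite /F /coset_ind /= !ind_ !eqxx /= mul1r /c /= -!psi_trunc // !psiD // !psiN //.
  rewrite !conj_psi // !psiN //.
  have cancel (x a b c' d : R[i]) : a * b != 0 -> x * c' * d = a * c' * (b * d) / (a * b) * x.
    by move=> ab0; rewrite [a * c' * _]mulrACA [X in X * x]mulrAC mulfV // mul1r [RHS]mulrC mulrA.
  exact: cancel.
rewrite -mulrA mulr_suml mulr_sumr.
have card0 : #|T|%:R != 0 :> R[i] by rewrite pnatr_eq0 -lt0n card_trunc_group_gt0.
rewrite -(pair_bigA _ (fun h h' => c (h, h') * cintegral mu (F (h, h')) *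
  (psi i z.1 * psi j z.2))) /=.
apply: eq_bigr => h _; rewrite !mulr_sumr; apply: eq_bigr => h' _.
have -> : coset_avg mu K f (z.1 - trunc_val h, z.2 - trunc_val h') =
   #|T|%:R ^+ 2 * cintegral mu (F (h, h')).
  by rewrite /coset_avg rmorphXn rmorph_nat.
rewrite [LHS]mulrAC /c divfK //=.
rewrite [in RHS]mulrCA -!mulrA; congr (_ * _).
rewrite [X in _ = _ * X]mulrCA [RHS]mulrCA; congr (_ * _).
by rewrite !mulKf.
Qed.

End fourier_coefficients.

(** * The module of L^p functions and its translations *)

Section Lp_space.
Variables (R : realType) (m : nat -> nat).
Local Notation G := (vilenkin m).
Local Notation normc := (@Normc.normc R).
Variable mu : probability (G * G)%type R.
Hypothesis mu_haar : haar mu.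
(* [1 <= p] is an argument of the predicate so that the module structure below,
   which depends on it, can be inferred from the type. *)
Definition Lp_pred (p : \bar R) (_ : (1%:E <= p)%E) : {pred (G * G -> R[i]^o)} :=
  fun f => `[< cmeasurable f /\ (Lp_norm mu p f < +oo)%E >].

Variables (p : \bar R) (p1 : (1%:E <= p)%E).

Fact Lp_submod_closed : submod_closed (Lp_pred p1).
Proof.
split.
  apply/asboolP; split; first exact: (cmeasurable_cst m 0).
  have := Lp_normZ_le mu 0 p1 (cmeasurable_cst m (0 : R[i])).
  rewrite Normc.normc0 mul0e => h; apply: le_lt_trans (ltry 0).
  move: h; congr (Lp_norm mu p _ <= _)%E; apply/funext => z; exact: mulr0.
move=> c f g /asboolP[mf ff] /asboolP[mg fg]; apply/asboolP.
have mcf : cmeasurable (fun z => c * f z) by apply: cmeasurableM => //; exact: cmeasurable_cst.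
split; first exact: cmeasurableD.
apply: (le_lt_trans (Lp_normD mu p1 mcf mg)); apply: lte_add_pinfty => //.
apply: (le_lt_trans (Lp_normZ_le mu c p1 mf)).
by rewrite lte_mul_pinfty ?lee_fin ?normc_ge0.
Qed.

HB.instance Definition _ :=
  GRing.isSubmodClosed.Build R[i] (G * G -> R[i]^o) (Lp_pred p1) Lp_submod_closed.

(** Functions are not identified almost everywhere, so for finite p [Lp_fnorm] is only a seminorm,
    which is all the abstract estimates ask for, and operator identities hold pointwise. For
    [p = +oo] these are the bounded measurable functions. *)
Record Lp_space := MkLp { Lp_val :> G * G -> R[i]^o; _ : Lp_val \in Lp_pred p1 }.

HB.instance Definition _ := [isSub for Lp_val].
HB.instance Definition _ := [Choice of Lp_space by <:].
HB.instance Definition _ := [SubChoice_isSubLmodule of Lp_space by <:].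

Implicit Types (u v : Lp_space).

Lemma Lp_space_ext u v : (forall z, u z = v z) -> u = v.
Proof. by move=> uv; apply: val_inj; apply/funext. Qed.

Lemma Lp_val_cmeasurable v : cmeasurable v.
Proof. by case: v => f /= /asboolP[]. Qed.

Lemma Lp_val_lty v : (Lp_norm mu p v < +oo)%E.
Proof. by case: v => f /= /asboolP[]. Qed.

Definition Lp_fnorm v : R := fine (Lp_norm mu p v).

Lemma Lp_fnormE v : ((Lp_fnorm v)%:E = Lp_norm mu p v)%E.
Proof. by rewrite fineK // ge0_fin_numE ?Lp_norm_ge0 // Lp_val_lty. Qed.

Lemma Lp_fnormD u v : Lp_fnorm (u + v) <= Lp_fnorm u + Lp_fnorm v.
Proof.
rewrite -lee_fin EFinD !Lp_fnormE.
exact: Lp_normD p1 (Lp_val_cmeasurable u) (Lp_val_cmeasurable v).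
Qed.

(** Equality follows from the inequality alone, applied to c and to its inverse. *)
Lemma Lp_fnormZ c v : Lp_fnorm (c *: v) = normc c * Lp_fnorm v.
Proof.
have Zle d w : Lp_fnorm (d *: w) <= normc d * Lp_fnorm w.
  rewrite -lee_fin EFinM !Lp_fnormE.
  exact: Lp_normZ_le p1 (Lp_val_cmeasurable w).
apply/eqP; rewrite eq_le Zle /=.
have [->|c0] := eqVneq c 0.
  by rewrite Normc.normc0 mul0r fine_ge0 // Lp_norm_ge0.
have nc0 : 0 < normc c.
  rewrite lt_neqAle normc_ge0 andbT eq_sym; apply: contra c0 => /eqP.
  by move=> /Normc.eq0_normc ->.
rewrite -ler_pdivlMl // -Normc.normcV.
by have := Zle c^-1 (c *: v); rewrite scalerA mulVf // scale1r.
Qed.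

Fact Lp_shift_subproof a v : (fun z => v (z + a)) \in Lp_pred p1.
Proof.
apply/asboolP; have mv := Lp_val_cmeasurable v; split; first exact: cmeasurable_shift.
by rewrite (Lp_norm_shift mu_haar) // Lp_val_lty.
Qed.

Definition Lp_shift a v : Lp_space := MkLp (Lp_shift_subproof (- a) v).

Fact Lp_shift_linear a : linear (Lp_shift a).
Proof. by move=> c u v; apply: val_inj. Qed.

HB.instance Definition _ a :=
  GRing.isLinear.Build _ _ _ _ (Lp_shift a) (Lp_shift_linear a).

Lemma Lp_fnorm_shift a v : Lp_fnorm (Lp_shift a v) = Lp_fnorm v.
Proof.
by rewrite /Lp_fnorm /= (Lp_norm_shift mu_haar) //; exact: Lp_val_cmeasurable.
Qed.

Lemma Lp_valZ c v z : (c *: v) z = c * (v z : R[i]).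
Proof. by []. Qed.

Lemma Lp_val_sum (I : Type) (r : seq I) (F : I -> Lp_space) z :
  (\sum_(i <- r) F i) z = \sum_(i <- r) (F i : Lp_space) z.
Proof. by elim/big_rec2: _ => // i x y _ <-. Qed.

End Lp_space.

(** * Toeplitz limits in one and two indices *)

Section toeplitz_limits.
Variable R : realType.
Implicit Types (a : nat -> R).

Lemma half_exp_small (c e : R) : 0 <= c -> 0 < e ->
  exists k0, forall k, (k0 <= k)%N -> c * 2^-1 ^+ k <= e.
Proof.
(* As (k + 1) 2^(-k) <= 2, it suffices that k + 1 >= 2c/e. *)
move=> c0 e0; exists (Num.bound (2 * c / e)) => k hk.
have h : 0 < (2^-1 : R) < 1 by apply/andP; split; lra.
have := natr_exp_le k h.
have -> : 1 - 2^-1 = 2^-1 :> R by lra.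
rewrite invrK => h2.
have hb : 2 * c / e <= k.+1%:R.
  have x0 : 0 <= 2 * c / e by rewrite divr_ge0 ?mulr_ge0 // ltW.
  apply: (le_trans (ltW (archi_boundP x0))); rewrite ler_nat; exact: leqW.
have x0 : 0 <= 2^-1 ^+ k :> R by rewrite exprn_ge0.
move: hb; rewrite ler_pdivrMr // => hb.
have := ler_wpM2r x0 hb; have := ler_wpM2l (ltW e0) h2; lra.
Qed.

Lemma eventually_le_bounded a : (forall e, 0 < e -> exists J, forall j, (J <= j)%N -> a j <= e) ->
  exists2 A, 0 <= A & forall j, a j <= A.
Proof.
move=> /(_ 1 ltr01)[J hJ]; exists (1 + \sum_(j < J) `|a j|).
  by rewrite addr_ge0 // sumr_ge0.
move=> j; have [Jj|jJ] := leqP J j.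
  by apply: (le_trans (hJ _ Jj)); rewrite lerDl sumr_ge0.
rewrite (bigD1 (Ordinal jJ)) //=; apply: (le_trans (ler_norm _)).
by rewrite addrCA lerDl addr_ge0 // sumr_ge0.
Qed.

(** Beyond J the terms are at most e/4 and the weights sum to at most 2; the first J terms are
    bounded and their weights tend to 0. *)
Lemma toeplitz a : (forall e, 0 < e -> exists J, forall j, (J <= j)%N -> a j <= e) ->
  forall e, 0 < e -> exists k0, forall k, (k0 <= k)%N ->
    \sum_(0 <= j < k.+1) 2^-1 ^+ (k - j) * a j <= e.
Proof.
move=> ha e e0; have [A A0 hA] := eventually_le_bounded ha.
have e4 : 0 < e / 4 by rewrite divr_gt0.
have [J hJ] := ha _ e4.
have c0 : 0 <= A * (2 * 2 ^+ J) by rewrite !mulr_ge0 // exprn_ge0.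
have e2 : 0 < e / 2 by rewrite divr_gt0.
have [k0 hk0] := half_exp_small c0 e2; exists k0 => k /hk0 hk.
apply: (@le_trans _ _ (\sum_(0 <= j < k.+1) (2^-1 ^+ (k - j) * (e / 4) +
    2^-1 ^+ (k - j) * (j < J)%N%:R * A))).
  apply: ler_sum => j _; rewrite -mulrA -mulrDr ler_wpM2l ?exprn_ge0 //.
  have [jJ|Jj] := ltnP j J; first by rewrite mul1r ler_wpDl ?(ltW e4).
  by rewrite mul0r addr0 hJ.
rewrite big_split /= -!mulr_suml.
have := ler_wpM2r (ltW e4) (@sum_half_le R k).
have := ler_wpM2r A0 (@sum_half_head_le R k J); lra.
Qed.

(** Smallness is known only when both indices are large, so the uniform bound [A] serves the two
    strips j < J and i < J, where one factor of the weights is a head sum of order 2^(J-k) or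
    2^(J-l). Each strip costs e/4 and the remaining quadrant, of weight at most 4, costs e/2. *)
Lemma double_toeplitz (a : nat -> nat -> R) (A : R) : 0 <= A ->
  (forall j i, a j i <= A) ->
  (forall e, 0 < e -> exists J, forall j i, (J <= j)%N -> (J <= i)%N -> a j i <= e) ->
  forall e, 0 < e -> exists k0, forall k l, (k0 <= k)%N -> (k0 <= l)%N ->
    \sum_(0 <= j < k.+1) \sum_(0 <= i < l.+1)
      2^-1 ^+ (k - j) * 2^-1 ^+ (l - i) * a j i <= e.
Proof.
move=> A0 hA ha e e0.
have e8 : 0 < e / 8 by rewrite divr_gt0.
have [J hJ] := ha _ e8.
have c0 : 0 <= 2 * A * (2 * 2 ^+ J) by rewrite !mulr_ge0 // exprn_ge0.
have e4 : 0 < e / 4 by rewrite divr_gt0.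
have [k0 hk0] := half_exp_small c0 e4; exists k0 => k l /hk0 hk /hk0 hl.
have p0 r s : 0 <= 2^-1 ^+ (r - s) :> R by rewrite exprn_ge0.
pose X := \sum_(0 <= j < k.+1) 2^-1 ^+ (k - j) : R.
pose Y := \sum_(0 <= i < l.+1) 2^-1 ^+ (l - i) : R.
pose X' := \sum_(0 <= j < k.+1) 2^-1 ^+ (k - j) * (j < J)%N%:R : R.
pose Y' := \sum_(0 <= i < l.+1) 2^-1 ^+ (l - i) * (i < J)%N%:R : R.
apply: (@le_trans _ _ (X * (Y * (e / 8) + Y' * A) + X' * (Y * A))).
  have -> : Y * (e / 8) + Y' * A = \sum_(0 <= i < l.+1)
      (2^-1 ^+ (l - i) * (e / 8) + 2^-1 ^+ (l - i) * (i < J)%N%:R * A).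
    by rewrite big_split /= -!mulr_suml.
  have -> : Y * A = \sum_(0 <= i < l.+1) 2^-1 ^+ (l - i) * A by rewrite -mulr_suml.
  rewrite /X /X' !mulr_suml -big_split /=; apply: ler_sum => j _.
  rewrite !mulr_sumr -big_split /=; apply: ler_sum => i _.
  rewrite -!mulrA -!mulrDr ler_wpM2l // mulrCA -mulrDr.
  rewrite ler_wpM2l //.
  have [jJ|Jj] := ltnP j J.
    rewrite mul1r; apply: (le_trans (hA j i)); rewrite lerDr addr_ge0 ?(ltW e8) //.
    by rewrite mulr_ge0.
  rewrite mul0r addr0; have [iJ|Ji] := ltnP i J.
    by rewrite mul1r ler_wpDl ?(ltW e8).
  by rewrite mul0r addr0 hJ.
have X2 : X <= 2 by exact: sum_half_le.
have Y2 : Y <= 2 by exact: sum_half_le.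
have X0 : 0 <= X by apply: sumr_ge0.
have Y0 : 0 <= Y by apply: sumr_ge0.
have X'0 : 0 <= X' by apply: sumr_ge0 => j _; rewrite mulr_ge0.
have Y'0 : 0 <= Y' by apply: sumr_ge0 => j _; rewrite mulr_ge0.
have X'2 : X' <= 2 * 2^-1 ^+ k * 2 ^+ J by exact: sum_half_head_le.
have Y'2 : Y' <= 2 * 2^-1 ^+ l * 2 ^+ J by exact: sum_half_head_le.
have h1 : X * (Y * (e / 8)) <= 2 * (2 * (e / 8)).
  exact: ler_pM X0 (mulr_ge0 Y0 (ltW e8)) X2 (ler_wpM2r (ltW e8) Y2).
have h2 : X * (Y' * A) <= 2 * (2 * 2^-1 ^+ l * 2 ^+ J * A).
  exact: ler_pM X0 (mulr_ge0 Y'0 A0) X2 (ler_wpM2r A0 Y'2).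
have h3 : X' * (Y * A) <= 2 * 2^-1 ^+ k * 2 ^+ J * (2 * A).
  exact: ler_pM X'0 (mulr_ge0 Y0 A0) X'2 (ler_wpM2r A0 Y2).
rewrite mulrDr; lra.
Qed.

End toeplitz_limits.

Lemma vilenkin_level (m : nat -> nat) : (forall k, (2 <= m k)%N) ->
  forall J n, (vilenkin_M m J.+1 <= n)%N ->
  exists2 k, (J <= k)%N & (vilenkin_M m k.+1 <= n < vilenkin_M m k.+2)%N.
Proof.
move=> m_ge2 J n hn.
have ex : exists k, (vilenkin_M m k.+1 <= n)%N by exists J.
have ub k : (vilenkin_M m k.+1 <= n)%N -> (k <= n)%N.
  by move=> h; apply: leq_trans h; apply/ltnW/ltnW; exact: ltn_vilenkin_M.
case: (ex_maxnP ex ub) => k hk kmax; exists k; first exact: kmax.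
by rewrite hk ltnNge; apply/negP => /kmax; rewrite ltnn.
Qed.

(** * Real majorants of extended-real moduli *)

Section capped_reals.
Variable R : realType.
Implicit Types (x : \bar R) (c y : R).

Definition cap x c : R := fine (Order.min x c%:E).

Lemma capE x c : (0 <= x)%E -> (cap x c)%:E = Order.min x c%:E.
Proof. by rewrite /cap; case: x => [x||] // _; rewrite /Order.min; case: ifP. Qed.

Lemma cap_le x c : (0 <= x)%E -> cap x c <= c.
Proof. by move=> x0; rewrite -lee_fin capE // ge_min lexx orbT. Qed.

Lemma le_cap x c y : (0 <= x)%E -> (y%:E <= x)%E -> y <= c -> y <= cap x c.
Proof. by move=> x0 yx yc; rewrite -lee_fin capE // le_min yx lee_fin. Qed.

Lemma mul_cap_le x c e t : (0 <= x)%E -> 0 <= t -> (t%:E * x < e%:E)%E -> t * cap x c <= e.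
Proof.
move=> x0 t0 h; rewrite -lee_fin EFinM; apply: le_trans (ltW h).
by apply: lee_wpmul2l; rewrite ?lee_fin // capE // ge_min lexx.
Qed.

Lemma ereal_cvg0_lt (T : Type) (F : set_system T) (FF : Filter F) (h : T -> \bar R) (e : R) :
  h t @[t --> F] --> (0%:E : \bar R) -> 0 < e -> \forall t \near F, (h t < e%:E)%E.
Proof.
move=> hF e0; apply: (hF [set x | (x < e%:E)%E]).
by apply: open_nbhs_nbhs; split; [exact: open_ereal_lt_ereal|rewrite /= lte_fin].
Qed.

End capped_reals.

(** * Discretized Cesaro means on L^p *)

Section assembly.
Variables (R : realType) (m : nat -> nat) (B : nat).
Hypotheses (m_ge2 : forall k, (2 <= m k)%N) (m_le : forall k, (m k <= B)%N).
Local Notation G := (vilenkin m).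
Local Notation M := (vilenkin_M m).
Variable mu : probability (G * G)%type R.
Hypothesis mu_haar : haar mu.
Variables (p : \bar R) (p1 : (1%:E <= p)%E).
Local Notation L := (Lp_space mu p1).
Local Notation N := (@Lp_fnorm R m mu p p1).
Implicit Types (v w : L) (g h : G).

Let N_triangle := @Lp_fnormD R m mu p p1.
Let N_scale := @Lp_fnormZ R m mu p p1.

Definition shift1 g : {linear L -> L} := Lp_shift mu_haar (g, 0).
Definition shift2 h : {linear L -> L} := Lp_shift mu_haar (0, h).

Lemma shift1E g v z : shift1 g v z = v (z.1 - g, z.2).
Proof.
have -> : shift1 g v z = v (z.1 - g, z.2 - 0) by [].
by rewrite subr0.
Qed.

Lemma shift2E h v z : shift2 h v z = v (z.1, z.2 - h).
Proof.
have -> : shift2 h v z = v (z.1 - 0, z.2 - h) by [].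
by rewrite subr0.
Qed.

Lemma shift1D g h v : shift1 (g + h) v = shift1 g (shift1 h v).
Proof. by apply: Lp_space_ext => z; rewrite !shift1E opprD addrA. Qed.

Lemma shift2D g h v : shift2 (g + h) v = shift2 g (shift2 h v).
Proof. by apply: Lp_space_ext => z; rewrite !shift2E opprD addrA. Qed.

Lemma shift12 g h v : shift1 g (shift2 h v) = shift2 h (shift1 g v).
Proof. by apply: Lp_space_ext => z; rewrite !(shift1E, shift2E). Qed.

Lemma N_shift1 g v : N (shift1 g v) = N v.
Proof. exact: Lp_fnorm_shift. Qed.

Lemma N_shift2 h v : N (shift2 h v) = N v.
Proof. exact: Lp_fnorm_shift. Qed.

Variable v : L.
Local Notation F := (N v).

(* Real-valued majorants of the moduli: the moduli themselves could be [+oo] at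
   small indices. *)
Definition mod1 j : R := cap (omega1 mu p v j) (2 * F).
Definition mod2 i : R := cap (omega2 mu p v i) (2 * F).
Definition mod12 j i : R :=
  cap (omega12 mu p v j i) (Num.min (2 * mod1 j) (2 * mod2 i)).

Lemma shift1_mod j g : @vilenkin_I m j g -> N (shift1 g v - v) <= mod1 j.
Proof.
move=> gj; apply: le_cap; first exact: omega1_ge0.
  rewrite Lp_fnormE; apply: ereal_sup_ubound; exists g => //.
  by congr (Lp_norm mu p _); apply/funext => z; rewrite -shift1E.
apply: (le_trans (seminormB N_triangle N_scale _ _)).
by rewrite N_shift1 mulrDl mul1r.
Qed.

Lemma shift2_mod i h : @vilenkin_I m i h -> N (shift2 h v - v) <= mod2 i.
Proof.
move=> hi; apply: le_cap; first exact: omega2_ge0.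
  rewrite Lp_fnormE; apply: ereal_sup_ubound; exists h => //.
  by congr (Lp_norm mu p _); apply/funext => z; rewrite -shift2E.
apply: (le_trans (seminormB N_triangle N_scale _ _)).
by rewrite N_shift2 mulrDl mul1r.
Qed.

(** A mixed difference is a first difference of [shift1 g v - v] and also of [shift2 h v - v],
    whence the two caps. They are what bounds the weighted mixed moduli when one index stays
    small. *)
Lemma shift12_mod j i g h : @vilenkin_I m j g -> @vilenkin_I m i h ->
  N (shift1 g (shift2 h v - v) - (shift2 h v - v)) <= mod12 j i.
Proof.
move=> gj hi; apply: le_cap; first exact: omega12_ge0.
  rewrite Lp_fnormE; apply: ereal_sup_ubound; exists (g, h) => //.
  congr (Lp_norm mu p _); apply/funext => z.
  have -> : (shift1 g (shift2 h v - v) - (shift2 h v - v)) z =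
     shift1 g (shift2 h v - v) z - (shift2 h v z - v z) by [].
  rewrite shift1E.
  have -> : (shift2 h v - v) (z.1 - g, z.2) = shift2 h v (z.1 - g, z.2) - v (z.1 - g, z.2) by [].
  rewrite !shift2E /=.
  have E (a b c d : R[i]) : a - b - c + d = a - b - (c - d).
    by rewrite opprB addrA [RHS]addrAC.
  exact: E.
rewrite le_min; apply/andP; split.
  have -> : shift1 g (shift2 h v - v) - (shift2 h v - v) =
      shift2 h (shift1 g v - v) - (shift1 g v - v).
    rewrite [shift1 g (_ - _)]linearB [shift2 h (_ - _)]linearB shift12 !opprB.
    by rewrite addrACA [RHS]addrACA [X in _ = _ + X]addrC.
  apply: (le_trans (seminormB N_triangle N_scale _ _)).
  by rewrite N_shift2 mulrDl mul1r lerD // shift1_mod.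
apply: (le_trans (seminormB N_triangle N_scale _ _)).
by rewrite N_shift1 mulrDl mul1r lerD // shift2_mod.
Qed.

Variable K : nat.
Local Notation P1 := (fourier_proj shift1 K).
Local Notation P2 := (fourier_proj shift2 K).
Local Notation T := (trunc_group m K).

(** Translation by u is a shift in each variable; the two differences are bounded separately, one of
    them after an isometric shift. *)
Lemma coset_avg_mod : (Lp_norm mu p (fun z => (coset_avg mu K v z - v z)%R) <=
  (mod1 K + mod2 K)%:E)%E.
Proof.
apply: coset_avg_approx => //.
  exact: Lp_norm_cintegrable p1 (Lp_val_cmeasurable v) (Lp_val_lty v).
move=> u u1 u2.
have I_ (x : G) : trunc K x = trunc K (0 : G) -> @vilenkin_I m K (- x).
  move=> hx k kK; have -> : (- x) k = - (x k : 'Z_(m k)) by [].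
  by rewrite (trunc_nth kK hx) -[X in - X]/(0 : 'Z_(m k)) oppr0.
have -> : (fun z => v (z + u) - v z) =
    (shift1 (- u.1) (shift2 (- u.2) v - v) + (shift1 (- u.1) v - v) : L).
  apply/funext => z.
  have -> : (shift1 (- u.1) (shift2 (- u.2) v - v) + (shift1 (- u.1) v - v)) z =
     shift1 (- u.1) (shift2 (- u.2) v - v) z + (shift1 (- u.1) v z - v z) by [].
  rewrite !shift1E.
  have -> : (shift2 (- u.2) v - v) (z.1 - - u.1, z.2) =
    shift2 (- u.2) v (z.1 - - u.1, z.2) - v (z.1 - - u.1, z.2) by [].
  by rewrite shift2E /= !opprK addrA subrK.
rewrite -Lp_fnormE lee_fin addrC; apply: (le_trans (N_triangle _ _)).
apply: lerD; first exact: shift1_mod (I_ _ u1).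
by rewrite N_shift1; exact: shift2_mod (I_ _ u2).
Qed.

Fact coset_avg_Lp : (coset_avg mu K v : G * G -> R[i]^o) \in Lp_pred mu p1.
Proof.
apply/asboolP; split; first exact: cmeasurable_coset_avg.
have mv := Lp_val_cmeasurable v; have ma := cmeasurable_coset_avg mu K v.
have mNv : cmeasurable (fun z => - v z).
  have := cmeasurableM (cmeasurable_cst m (-1)) mv.
  by congr cmeasurable; apply/funext => z; rewrite mulN1r.
have -> : (coset_avg mu K v : G * G -> R[i]) = (fun z => (coset_avg mu K v z - v z) + v z).
  by apply/funext => z; rewrite subrK.
apply: (le_lt_trans (Lp_normD mu p1 (cmeasurableD ma mNv) mv)).
apply: lte_add_pinfty; last exact: Lp_val_lty.
exact: le_lt_trans coset_avg_mod (ltry _).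
Qed.

Definition avg : L := MkLp coset_avg_Lp.

Lemma avg_mod : N (avg - v) <= mod1 K + mod2 K.
Proof. by rewrite -lee_fin Lp_fnormE; exact: coset_avg_mod. Qed.

Lemma fourier_projE (tau : G -> {linear L -> L}) i w z : fourier_proj tau K i w z =
  (#|T|%:R)^-1 * \sum_(h : T) @psi R m i (trunc_val h) * (tau (trunc_val h) w) z.
Proof.
by rewrite /fourier_proj Lp_valZ Lp_val_sum.
Qed.

Lemma cesaro_sumE (P : nat -> {linear L -> L}) a n w z : cesaro_sum P a n w z =
  \sum_(0 <= i < n.+1) (cesaro_number (- a) (n - i) / cesaro_number (- a) n)%:C%C * P i w z.
Proof. by rewrite /cesaro_sum Lp_val_sum. Qed.

Variables (alpha beta : R) (n l : nat).
Hypotheses (a01 : 0 < alpha < 1) (b01 : 0 < beta < 1).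
Hypotheses (nK : (n < M K)%N) (lK : (l < M K)%N).

(** Exact as soon as n, l < M_K: all indices in the mean are then below M_K, where the coefficients
    of v are those of its coset average. *)
Lemma cesaro_mean_avg z : cesaro_mean mu (- alpha) (- beta) n l v z =
  cesaro_sum P1 alpha n (cesaro_sum P2 beta l avg) z.
Proof.
rewrite cesaro_sumE /cesaro_mean mulr_sumr; apply: eq_big_nat => i /andP[_ iN].
have -> : P1 i (cesaro_sum P2 beta l avg) z = \sum_(0 <= j < l.+1)
   (cesaro_number (- beta) (l - j) / cesaro_number (- beta) l)%:C%C * P1 i (P2 j avg) z.
  rewrite /cesaro_sum linear_sum Lp_val_sum; apply: eq_bigr => j _.
  by rewrite linearZ.
rewrite !mulr_sumr; apply: eq_big_nat => j /andP[_ jL].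
have vi := Lp_norm_cintegrable p1 (Lp_val_cmeasurable v) (Lp_val_lty v).
have E : P1 i (P2 j avg) z = fourier_coef mu v i j * @psi R m i z.1 * @psi R m j z.2.
  rewrite (fourier_coefE m_ge2 z vi (leq_ltn_trans _ nK) (leq_ltn_trans _ lK)) //.
  rewrite fourier_projE; under eq_bigr => h _.
    rewrite shift1E fourier_projE; under eq_bigr => h' _ do rewrite shift2E.
    over.
  by [].
have coef (x y c d : R) (X Y Z : R[i]) : ((x * y)^-1)%:C%C * ((c * d)%:C%C * X * Y * Z) =
    (c / x)%:C%C * ((d / y)%:C%C * (X * Y * Z)).
  by rewrite !mulrA -!rmorphM; congr (_%:C%C * _ * _ * _); rewrite invfM; ring.
by rewrite E; exact: coef.
Qed.

(** Only blocks of length one are used. The bound depends on r, which is harmless: it is applied at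
    fixed orders to [avg - v], which a large [K] makes small. *)
Lemma cesaro_sum_crude_le (tau : G -> {linear L -> L}) a r w :
  (forall g u, N (tau g u) = N u) -> (r < M K)%N ->
  N (cesaro_sum (fourier_proj tau K) a r w) <=
  (\sum_(0 <= i < r.+1) `|cesaro_number (- a) (r - i) / cesaro_number (- a) r|) * N w.
Proof.
move=> N_tau rK; rewrite mulr_suml; apply: (le_trans (seminorm_sum N_triangle N_scale _ _ _)).
apply: ler_sum_nat => i /andP[_ ir]; rewrite (seminorm_real N_scale) ler_wpM2l //.
have := @fourier_proj_block R m m_ge2 L N N_triangle N_scale tau N_tau K 0 i w.
by rewrite muln1 addn1 big_nat1; apply; exact: leq_trans ir rK.
Qed.

End assembly.

(** * The limit for vectors of L^p *)

Section limit.
Variables (R : realType) (m : nat -> nat) (B : nat).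
Hypotheses (m_ge2 : forall k, (2 <= m k)%N) (m_le : forall k, (m k <= B)%N).
Local Notation G := (vilenkin m).
Local Notation M := (vilenkin_M m).
Variable mu : probability (G * G)%type R.
Hypothesis mu_haar : haar mu.
Variables (p : \bar R) (p1 : (1%:E <= p)%E) (v : Lp_space mu p1).
Variables (alpha beta : R).
Hypotheses (a01 : 0 < alpha < 1) (b01 : 0 < beta < 1).
Hypothesis omega1_lim :
  ((((M k)%:R `^ alpha)%:E * omega1 mu p v k)%E @[k --> \oo]) --> (0%:E : \bar R).
Hypothesis omega2_lim :
  ((((M l)%:R `^ beta)%:E * omega2 mu p v l)%E @[l --> \oo]) --> (0%:E : \bar R).
Hypothesis omega12_lim :
  ((((M kl.1)%:R `^ alpha * (M kl.2)%:R `^ beta)%:E * omega12 mu p v kl.1 kl.2)%E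
     @[kl --> (\oo, \oo)]) --> (0%:E : \bar R).

Let Ma j : R := (M j)%:R `^ alpha.
Let Mb j : R := (M j)%:R `^ beta.

Let Ma_ge0 j : 0 <= Ma j. Proof. exact: powR_ge0. Qed.
Let Mb_ge0 j : 0 <= Mb j. Proof. exact: powR_ge0. Qed.

Lemma mod1_ge0 j : 0 <= mod1 v j.
Proof.
have h0 : @vilenkin_I m j 0 by [].
apply: le_trans (shift1_mod mu_haar v h0).
by rewrite fine_ge0 // Lp_norm_ge0.
Qed.

Lemma mod2_ge0 j : 0 <= mod2 v j.
Proof.
have h0 : @vilenkin_I m j 0 by [].
apply: le_trans (shift2_mod mu_haar v h0).
by rewrite fine_ge0 // Lp_norm_ge0.
Qed.

Let mod1_small e : 0 < e -> exists J, forall j, (J <= j)%N -> Ma j * mod1 v j <= e.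
Proof.
move=> e0; have [J _ hJ] := ereal_cvg0_lt _ omega1_lim e0; exists J => j /hJ h.
exact: mul_cap_le (omega1_ge0 mu p v j) (Ma_ge0 j) h.
Qed.

Let mod2_small e : 0 < e -> exists J, forall j, (J <= j)%N -> Mb j * mod2 v j <= e.
Proof.
move=> e0; have [J _ hJ] := ereal_cvg0_lt _ omega2_lim e0; exists J => j /hJ h.
exact: mul_cap_le (omega2_ge0 mu p v j) (Mb_ge0 j) h.
Qed.

Let mod12_small e : 0 < e -> exists J, forall j i, (J <= j)%N -> (J <= i)%N ->
  Ma j * Mb i * mod12 v j i <= e.
Proof.
move=> e0; have [[P Q] [[J1 _ hP] [J2 _ hQ]] hPQ] := ereal_cvg0_lt _ omega12_lim e0.
exists (maxn J1 J2) => j i; rewrite !geq_max => /andP[/hP jP _] /andP[_ /hQ iQ].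
have M0 : 0 <= Ma j * Mb i by exact: mulr_ge0.
exact: mul_cap_le (omega12_ge0 mu p v j i) M0 (hPQ (j, i) (conj jP iQ)).
Qed.

(** If j < J, then [mod12] is at most twice [mod2 i], the weighted [mod2] is bounded and M_j^alpha
    <= M_J^alpha; the case i < J is symmetric, and for both indices at least J the mixed hypothesis
    applies. *)
Let mod12_bounded : exists2 A, 0 <= A & forall j i, Ma j * Mb i * mod12 v j i <= A.
Proof.
have [A1 A10 hA1] := eventually_le_bounded mod1_small.
have [A2 A20 hA2] := eventually_le_bounded mod2_small.
have [J hJ] := mod12_small ltr01.
have h1 j i : mod12 v j i <= 2 * mod1 v j.
  by apply: (le_trans (cap_le _ (omega12_ge0 mu p v j i))); rewrite ge_min lexx.
have h2 j i : mod12 v j i <= 2 * mod2 v i.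
  by apply: (le_trans (cap_le _ (omega12_ge0 mu p v j i))); rewrite ge_min lexx orbT.
have mono c s t : 0 < c < 1 -> (s <= t)%N -> (M s)%:R `^ c <= (M t)%:R `^ c :> R.
  case/andP=> c0 _ st; apply: ge0_ler_powR; rewrite ?nnegrE ?(ltW c0) //.
  by rewrite ler_nat vilenkin_M_le.
exists (1 + 2 * (Ma J * A2) + 2 * (Mb J * A1)).
  by rewrite !addr_ge0 // !mulr_ge0.
have X0 : 0 <= Ma J * A2 by rewrite mulr_ge0.
have Y0 : 0 <= Mb J * A1 by rewrite mulr_ge0.
move=> j i; have [jJ|Jj] := ltnP j J.
  apply: (@le_trans _ _ (2 * (Ma J * A2))); last lra.
  apply: (le_trans (ler_wpM2l (mulr_ge0 (Ma_ge0 j) (Mb_ge0 i)) (h2 j i))).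
  rewrite mulrCA ler_wpM2l // -mulrA; apply: ler_pM => //.
    by rewrite mulr_ge0 // mod2_ge0.
  exact: mono (ltnW jJ).
have [iJ|Ji] := ltnP i J; last by apply: (le_trans (hJ j i Jj Ji)); lra.
apply: (@le_trans _ _ (2 * (Mb J * A1))); last lra.
apply: (le_trans (ler_wpM2l (mulr_ge0 (Ma_ge0 j) (Mb_ge0 i)) (h1 j i))).
rewrite mulrCA ler_wpM2l // [Ma j * _]mulrC -mulrA; apply: ler_pM => //.
  by rewrite mulr_ge0 // mod1_ge0.
exact: mono (ltnW iJ).
Qed.

(** Four quarters of e: the passage to the coset average, the two simple errors and the mixed error.
    The last three fix n0; only then, for given n and l, is [K] taken so large that discretization
    costs at most e/4. *)
Lemma cesaro_mean_small e : 0 < e -> exists n0, forall n l, (n0 <= n)%N -> (n0 <= l)%N ->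
  (Lp_norm mu p (fun z => (cesaro_mean mu (- alpha) (- beta) n l v z - v z)%R) <= e%:E)%E.
Proof.
move=> e0; have [a0 _] := andP a01; have [b0 _] := andP b01.
have [q q01 hq] := vilenkin_M_powR m_ge2 a0.
have [c c0 hc] := natr_vilenkin_M_powR m_ge2 a0.
have [q' q01' hq'] := vilenkin_M_powR m_ge2 b0.
have [c' c0' hc'] := natr_vilenkin_M_powR m_ge2 b0.
set C1 := cesaro_const B alpha q c; set C2 := cesaro_const B beta q' c'.
have C10 : 0 <= C1 by exact: cesaro_const_ge0.
have C20 : 0 <= C2 by exact: cesaro_const_ge0.
have small C : 0 <= C -> 0 < e / 4 / (C + 1) /\ C * (e / 4 / (C + 1)) <= e / 4.
  move=> C0; have C0' : 0 < C + 1 by rewrite ltr_wpDl.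
  have e4 : 0 < e / 4 by rewrite divr_gt0.
  split; first by rewrite divr_gt0.
  rewrite mulrA ler_pdivrMr // mulrC ler_wpM2l ?(ltW e4) //; lra.
have [A A0 hA] := mod12_bounded.
have [e1 he1] := small _ C10; have [e2 he2] := small _ C20.
have [e12 he12] := small _ (mulr_ge0 C10 C20).
have [k1 hk1] := toeplitz mod1_small e1.
have [k2 hk2] := toeplitz mod2_small e2.
have [k3 hk3] := double_toeplitz A0 hA mod12_small e12.
pose k0 := maxn k1 (maxn k2 k3).
exists (M k0.+1) => n l nM lM.
have [k k0k nk] := vilenkin_level m_ge2 nM.
have [k' k0k' lk] := vilenkin_level m_ge2 lM.
pose S1 := \sum_(0 <= i < n.+1)
  `|cesaro_number (- alpha) (n - i) / cesaro_number (- alpha) n|.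
pose S2 := \sum_(0 <= i < l.+1)
  `|cesaro_number (- beta) (l - i) / cesaro_number (- beta) l|.
have S0 : 0 <= S1 * S2 by rewrite mulr_ge0 // sumr_ge0.
have [eS heS] := small _ S0.
(* Half for each of [mod1 K] and [mod2 K], whose sum bounds [avg - v]. *)
have eS2 : 0 < e / 4 / (S1 * S2 + 1) / 2 by rewrite divr_gt0.
have [J1 hJ1] := mod1_small eS2; have [J2 hJ2] := mod2_small eS2.
pose K := maxn (maxn n l) (maxn J1 J2).
have nK : (n < M K)%N.
  apply: leq_trans (ltn_vilenkin_M m_ge2 n) (vilenkin_M_le m_ge2 _).
  by rewrite /K !leq_max leqnn.
have lK : (l < M K)%N.
  apply: leq_trans (ltn_vilenkin_M m_ge2 l) (vilenkin_M_le m_ge2 _).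
  by rewrite /K !leq_max leqnn orbT.
pose sigma w := cesaro_sum (fourier_proj (shift1 mu_haar p1) K) alpha n
  (cesaro_sum (fourier_proj (shift2 mu_haar p1) K) beta l w).
have -> : (fun z => cesaro_mean mu (- alpha) (- beta) n l v z - v z) =
    (sigma (avg mu_haar v K) - v : Lp_space mu p1).
  by apply/funext => z; rewrite (cesaro_mean_avg m_ge2 mu_haar v alpha beta nK lK).
rewrite -Lp_fnormE lee_fin.
have tri := @Lp_fnormD R m mu p p1; have sca := @Lp_fnormZ R m mu p p1.
have sigmaB u w : sigma (u - w) = sigma u - sigma w.
  have lin (tau : vilenkin m -> {linear Lp_space mu p1 -> Lp_space mu p1}) a r x y :
      cesaro_sum (fourier_proj tau K) a r (x - y) =
      cesaro_sum (fourier_proj tau K) a r x - cesaro_sum (fourier_proj tau K) a r y.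
    have -> : x - y = -1 *: y + x by rewrite scaleN1r addrC.
    by rewrite cesaro_sum_linear scaleN1r addrC.
  by rewrite /sigma !lin.
have -> : sigma (avg mu_haar v K) - v = sigma (avg mu_haar v K - v) + (sigma v - v).
  by rewrite sigmaB addrA subrK.
apply: (le_trans (tri _ _)).
have T1 : Lp_fnorm (sigma (avg mu_haar v K - v)) <= e / 4.
  have S10 : 0 <= S1 by apply: sumr_ge0.
  have S20 : 0 <= S2 by apply: sumr_ge0.
  apply: (le_trans (cesaro_sum_crude_le m_ge2 alpha _ (@N_shift1 R m mu mu_haar p p1) nK)).
  apply: (le_trans (ler_wpM2l S10
    (cesaro_sum_crude_le m_ge2 beta _ (@N_shift2 R m mu mu_haar p p1) lK))).
  rewrite mulrA; apply: le_trans heS; rewrite ler_wpM2l //.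
  apply: (le_trans (avg_mod mu_haar v K)).
  have J1K : (J1 <= K)%N by rewrite /K !leq_max leqnn !orbT.
  have J2K : (J2 <= K)%N by rewrite /K !leq_max leqnn !orbT.
  (* The weights are at least 1, so smallness of the weighted moduli passes to the moduli. *)
  have m1 : mod1 v K <= Ma K * mod1 v K.
    by rewrite ler_peMl ?mod1_ge0 // vilenkin_M_powR_ge1.
  have m2 : mod2 v K <= Mb K * mod2 v K.
    by rewrite ler_peMl ?mod2_ge0 // vilenkin_M_powR_ge1.
  have := hJ1 K J1K; have := hJ2 K J2K; lra.
have := double_cesaro_error_le m_ge2 m_le tri sca (shift1D mu_haar (p1 := p1))
  (shift2D mu_haar (p1 := p1)) (N_shift1 mu_haar (p1 := p1)) (N_shift2 mu_haar (p1 := p1))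
  (shift12 mu_haar (p1 := p1)) a01 b01 q01 q01' c0 c0' hq hq' hc hc' nk lk nK lK
  (@shift1_mod R m mu mu_haar p p1 v) (@shift2_mod R m mu mu_haar p p1 v)
  (@shift12_mod R m mu mu_haar p p1 v).
rewrite -/C1 -/C2 -/(sigma v) => T2.
have := hk1 k (leq_trans (leq_maxl _ _) k0k).
have k2k' : (k2 <= k')%N by apply: leq_trans k0k'; rewrite /k0 !leq_max leqnn orbT.
have := hk2 k' k2k'.
have k3k : (k3 <= k)%N by apply: leq_trans k0k; rewrite /k0 !leq_max leqnn !orbT.
have k3k' : (k3 <= k')%N by apply: leq_trans k0k'; rewrite /k0 !leq_max leqnn !orbT.
have := hk3 k k' k3k k3k'.
move=> /(ler_wpM2l (mulr_ge0 C10 C20)) x12 /(ler_wpM2l C20) x2 /(ler_wpM2l C10) x1.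
move: T1 T2 (le_trans x12 he12) (le_trans x2 he2) (le_trans x1 he1).
rewrite /Ma /Mb; lra.
Qed.

End limit.

(** When both moduli are below 1 at some level, each value of f is within 2 of its value at one of
    finitely many coset representatives; [S] bounds all of these. *)
Lemma Lp_norm_pinfty_lty (R : realType) (m : nat -> nat)
    (mu : probability (vilenkin m * vilenkin m)%type R)
    (f : vilenkin m * vilenkin m -> R[i]) k l :
  (omega1 mu +oo f k < 1)%E -> (omega2 mu +oo f l < 1)%E -> (Lp_norm mu +oo f < +oo)%E.
Proof.
move=> h1 h2; pose S := \sum_(h : trunc_group m k) \sum_(h' : trunc_group m l)
   Normc.normc (f (trunc_val h, trunc_val h')).
suff H z : Normc.normc (f z) <= 2 + S.
  apply: (@le_lt_trans _ _ (2 + S)%:E); last exact: ltry.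
  by rewrite /Lp_norm eqxx; apply: ge_ereal_sup => _ [z _ <-]; rewrite lee_fin.
case: z => x y.
have tri a b : Normc.normc a <= Normc.normc b + Normc.normc (b - a) :> R.
  rewrite -[Normc.normc (b - a)]normcN opprB.
  by rewrite -{1}[a](subrK b) addrC; exact: normc_triangle.
have s1 : Normc.normc (f (trunc_val (trunc k x), y) - f (x, y)) <= 1.
  rewrite -lee_fin; apply: le_trans (ltW h1).
  pose u := x - trunc_val (trunc k x).
  have uk : @vilenkin_I m k u by apply/trunc_coset.
  have -> : trunc_val (trunc k x) = x - u by rewrite /u opprB addrCA subrr addr0.
  apply: (@le_trans _ _ (Lp_norm mu +oo (fun z => (f (z.1 - u, z.2) - f z)%R))).
    by rewrite /Lp_norm eqxx; apply: ereal_sup_ubound; exists (x, y).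
  by apply: ereal_sup_ubound; exists u.
set x' := trunc_val (trunc k x) in s1 *.
have s2 : Normc.normc (f (x', trunc_val (trunc l y)) - f (x', y)) <= 1.
  rewrite -lee_fin; apply: le_trans (ltW h2).
  pose u := y - trunc_val (trunc l y).
  have ul : @vilenkin_I m l u by apply/trunc_coset.
  have -> : trunc_val (trunc l y) = y - u by rewrite /u opprB addrCA subrr addr0.
  apply: (@le_trans _ _ (Lp_norm mu +oo (fun z => (f (z.1, z.2 - u) - f z)%R))).
    by rewrite /Lp_norm eqxx; apply: ereal_sup_ubound; exists (x', y).
  by apply: ereal_sup_ubound; exists u.
have s3 : Normc.normc (f (x', trunc_val (trunc l y))) <= S.
  rewrite /S (bigD1 (trunc k x)) //= (bigD1 (trunc l y)) //= -addrA lerDl addr_ge0 //.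
    by apply: sumr_ge0 => h _; exact: normc_ge0.
  by apply: sumr_ge0 => h _; apply: sumr_ge0 => h' _; exact: normc_ge0.
have := tri (f (x, y)) (f (x', y)); have := tri (f (x', y)) (f (x', trunc_val (trunc l y))).
lra.
Qed.

Unset Implicit Arguments.

Theorem corollary1 (R : realType) (m : nat -> nat)
    (m_ge2 : forall k : nat, (2 <= m k)%N)
    (m_bounded : exists B : nat, forall k : nat, (m k <= B)%N)
    (mu : probability (vilenkin m * vilenkin m)%type R) (mu_haar : haar mu)
    (alpha beta : R) (alpha01 : 0 < alpha < 1) (beta01 : 0 < beta < 1)
    (p : \bar R) (p_ge1 : (1%:E <= p)%E)
    (f : vilenkin m * vilenkin m -> R[i]) (f_Lp : in_Lp mu p f)
    (f_omega1 :
      ((((vilenkin_M m k)%:R `^ alpha)%:E * omega1 mu p f k)%E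
        @[k --> \oo]) --> (0%:E : \bar R))
    (f_omega2 :
      ((((vilenkin_M m l)%:R `^ beta)%:E * omega2 mu p f l)%E
        @[l --> \oo]) --> (0%:E : \bar R))
    (f_omega12 :
      ((((vilenkin_M m kl.1)%:R `^ alpha * (vilenkin_M m kl.2)%:R `^ beta)%:E
          * omega12 mu p f kl.1 kl.2)%E
        @[kl --> (\oo, \oo)]) --> (0%:E : \bar R)) :
  Lp_norm mu p
    (fun z => cesaro_mean mu (- alpha) (- beta) nl.1 nl.2 f z - f z)
    @[nl --> (\oo, \oo)] --> (0%:E : \bar R).
Proof.
have [B m_le] := m_bounded.
have weight (c t : R) (x : \bar R) : 1 <= c -> (0 <= x)%E -> (c%:E * x < t%:E)%E -> (x < t%:E)%E.
  by move=> c1 x0; apply: le_lt_trans; rewrite lee_pemull // lee_fin.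
(* For finite p this is part of [in_Lp]. For [p = +oo] it is read off from the moduli, which fall
   below 1 because their weights are at least 1. *)
have f_lty : (Lp_norm mu p f < +oo)%E.
  case: p p_ge1 f_Lp f_omega1 f_omega2 {f_omega12} => [r| |] // p_ge1 f_Lp f1 f2.
    by move: f_Lp; rewrite /in_Lp /= => -[].
  have [k _ /(_ k (leqnn _)) /= hk] := ereal_cvg0_lt _ f1 ltr01.
  have [l _ /(_ l (leqnn _)) /= hl] := ereal_cvg0_lt _ f2 ltr01.
  have [[a0 _] [b0 _]] := (andP alpha01, andP beta01).
  apply: (@Lp_norm_pinfty_lty _ _ mu f k l).
    exact: weight (vilenkin_M_powR_ge1 m_ge2 k a0) (omega1_ge0 _ _ _ _) hk.
  exact: weight (vilenkin_M_powR_ge1 m_ge2 l b0) (omega2_ge0 _ _ _ _) hl.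
have fP : (f : vilenkin m * vilenkin m -> R[i]^o) \in Lp_pred mu p_ge1.
  by apply/asboolP; split => //; exact: in_Lp_cmeasurable f_Lp.
pose v : Lp_space mu p_ge1 := MkLp fP.
have small := cesaro_mean_small m_ge2 m_le mu_haar (v := v) alpha01 beta01
  f_omega1 f_omega2 f_omega12.
have near_pair (Q : nat * nat -> Prop) n0 :
    (forall n l, (n0 <= n)%N -> (n0 <= l)%N -> Q (n, l)) -> \forall nl \near (\oo, \oo), Q nl.
  move=> h; exists ([set n | (n0 <= n)%N], [set n | (n0 <= n)%N]) => /=.
    by split; exists n0.
  by move=> [n l] [/= hn hl]; exact: h.
(* The limit is transferred to real numbers, so the norms must first be shown finite eventually. *)
apply: cvg_EFin.
  have [n0 hn0] := small 1 ltr01; apply: (near_pair _ n0) => n l hn hl /=.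
  rewrite ge0_fin_numE ?Lp_norm_ge0 //.
  exact: le_lt_trans (hn0 n l hn hl) (ltry _).
apply/cvgr0Pnorm_le => e e0; have [n0 hn0] := small e e0.
apply: (near_pair _ n0) => n l hn hl /=.
rewrite ger0_norm ?fine_ge0 ?Lp_norm_ge0 //.
have h := hn0 n l hn hl; rewrite -lee_fin fineK //.
rewrite ge0_fin_numE ?Lp_norm_ge0 //.
exact: le_lt_trans h (ltry _).
Qed.
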